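(* Let $K$ be a field, let $(\gamma,q)$ be a compatible nondegenerate pair on a $7$-dimensional $K$-vector space $V$ with automorphism group $G$ (simple of type $\mathrm{G}_2$), let $E$ be a $2$-dimensional vector space, let $A=K[\operatorname{Hom}(E,V)]$ be the graded polynomial ring, and let $Y_2\subset\operatorname{Hom}(E,V)$ be the subvariety of linear maps $\varphi$ such that $\varphi(E)$ is a $\gamma$-isotropic subspace. Write $\beta_{i,j}=\dim_K\operatorname{Tor}_i^A(K,K[Y_2])_j$. (a) If $\operatorname{char}K\neq2$, the nonzero graded Betti numbers are $\beta_{0,0}=1$, $\beta_{1,2}=10$, $\beta_{2,3}=16$, $\beta_{3,5}=16$, $\beta_{4,6}=10$, $\beta_{5,8}=1$. (b) If $\operatorname{char}K=2$, the nonzero graded Betti numbers are $\beta_{0,0}=1$, $\beta_{1,2}=10$, $\beta_{2,3}=16$, $\beta_{2,4}=1$, $\beta_{3,4}=1$, $\beta_{3,5}=16$, $\beta_{4,6}=10$, $\beta_{5,8}=1$. (c) If $\operatorname{char}K=0$, the terms of the minimal free resolution $\mathbf{F}_\bullet$ of $K[Y_2]$ over $A$ are, as $\mathbf{GL}(E)\times G$-equivariant modules, $$\mathbf{F}_0=A,\qquad \mathbf{F}_1=\bigl(\det E\otimes V\oplus\operatorname{Sym}^2E\bigr)\otimes A(-2),$$ $$\mathbf{F}_2=\det E\otimes E\otimes(K\oplus V)\otimes A(-3),\qquad \mathbf{F}_3=(\det E)^2\otimes E\otimes(K\oplus V)\otimes A(-5),$$ $$\mathbf{F}_4=\bigl((\det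 E)^3\otimes V\oplus(\det E)^2\otimes\operatorname{Sym}^2E\bigr)\otimes A(-6),\qquad \mathbf{F}_5=(\det E)^4\otimes A(-8).$$
   Context: Let $x_1,\dots,x_7$ be a basis of $V^*$ and put $\gamma_0=x_1\wedge x_4\wedge x_7+x_2\wedge x_4\wedge x_6+x_3\wedge x_4\wedge x_5-x_2\wedge x_3\wedge x_7-x_1\wedge x_5\wedge x_6\in\bigwedge^3V^*$ and $q_0=x_1x_7+x_2x_6+x_3x_5+x_4^2\in\operatorname{Sym}^2(V^* )$. A pair $(\gamma,q)\in\bigwedge^3V^*\oplus\operatorname{Sym}^2(V^* )$ is a compatible nondegenerate pair if it is equivalent to $(\gamma_0,q_0)$ after a change of basis. Its automorphism group $G$ is a simple algebraic group of type $\mathrm{G}_2$. A $2$-dimensional subspace $W\subset V$ is ($\gamma$-)isotropic if $\gamma(w,w',v)=0$ for all $w,w'\in W$, $v\in V$; a $1$-dimensional subspace is isotropic if it is contained in some $2$-dimensional isotropic subspace; the zero subspace is isotropic. $Y_2$ has its reduced structure. $A(-d)$ denotes the free module $A$ with generator in degree $d$. In characteristic $0$ one has $V\cong V^*$ as $G$-modules, and $A=\operatorname{Sym}(E\otimes V^* )$.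
   Formalization: The quadratic form q_0 is taken as x_1x_7 − x_2x_6 − x_3x_5 + x_4^2: with γ_0 as printed, the form with plus signs is not the invariant form of γ_0, so the printed pair would not have automorphism group of type G_2 in characteristic ≠ 2; γ_0, Y_2, (a) and (b) are unchanged. *)

(* Defs.v *)
From HB Require Import structures.
From mathcomp Require Export all_boot all_order all_algebra.
From mathcomp.multinomials Require Export mpoly.
From mathcomp.real_closed Require Import mxtens.

Set Implicit Arguments.
Unset Strict Implicit.
Unset Printing Implicit Defensive.

Import GRing.Theory.
Local Open Scope ring_scope.

(* Vectors are row vectors: E = 'rV_2, V = 'rV_7, and a matrix M acts by       *)
(* u |-> u *m M.  Thus phi : 'M_(2, 7) is a linear map E -> V, its image is    *)
(* its row space, and subspaces of V are row spaces (scope %MS).               *)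

(* A trilinear form on R^7, given by its values on the standard basis, and a   *)
(* quadratic form, given by a polynomial (so that both can be base changed     *)
(* and is not confused with the function it induces over small fields).         *)
Definition trilinear (R : Type) := 'I_7 -> 'I_7 -> 'I_7 -> R.
Definition quadratic (R : nzRingType) := {mpoly R[7]}.

Section Forms.

Variable R : comUnitRingType.

Definition trilin_eval (gamma : trilinear R) (u v w : 'rV[R]_7) : R :=
  \sum_a \sum_b \sum_c gamma a b c * u 0 a * v 0 b * w 0 c.

Definition gamma_pull (P : 'M[R]_7) (gamma : trilinear R) : trilinear R :=
  fun a b c => trilin_eval gamma (row a P) (row b P) (row c P).

(* v |-> q (v *m P) *)
Definition quad_pull (P : 'M[R]_7) (q : quadratic R) : quadratic R :=
  q \mPo [tuple \sum_a P a k *: 'X_a | k < 7].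

(* x_i /\ x_j /\ x_k, with i, j, k ranging over 1..7, as an alternating form *)
Definition wedge3 (i j k : nat) : trilinear R := fun a b c =>
  \det (\matrix_(r < 3, s < 3)
          (nth 0%N [:: i; j; k] r == (tnth [tuple a; b; c] s).+1)%:R).

Definition gamma0 : trilinear R := fun a b c =>
    wedge3 1 4 7 a b c + wedge3 2 4 6 a b c + wedge3 3 4 5 a b c
  - wedge3 2 3 7 a b c - wedge3 1 5 6 a b c.

(* The minus signs are forced: up to scalars this is the form                  *)
(* (u, v) |-> i_u gamma0 /\ i_v gamma0 /\ gamma0.  With plus signs instead the *)
(* pair would not have an automorphism group of type G_2 in characteristic 0.  *)
(* Negating x_4, x_5, x_6 turns (gamma0, q0) into the equivalent pair with     *)
(* x_1 /\ x_4 /\ x_7 negated and x_1 x_7 + x_2 x_6 + x_3 x_5 + x_4 ^ 2.        *)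
Definition q0 : quadratic R :=
  let x (i : nat) : {mpoly R[7]} := 'X_(inord i.-1 : 'I_7) in
  x 1%N * x 7%N - x 2%N * x 6%N - x 3%N * x 5%N + x 4%N ^+ 2.

End Forms.

Definition compatible_nondegenerate (K : fieldType)
    (gamma : trilinear K) (q : quadratic K) : Prop :=
  exists2 P : 'M[K]_7, P \in unitmx &
    (forall a b c, gamma a b c = gamma_pull P (@gamma0 K) a b c)
    /\ q = quad_pull P (q0 K).

Definition gamma_map (K R : nzRingType) (iota : {rmorphism K -> R})
    (gamma : trilinear K) : trilinear R := fun a b c => iota (gamma a b c).

(* The R-points of the automorphism group scheme G of (gamma, q). *)
Definition in_G (K : fieldType) (R : comUnitRingType)
    (iota : {rmorphism K -> R}) (gamma : trilinear K) (q : quadratic K)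
    (h : 'M[R]_7) : Prop :=
  [/\ h \in unitmx,
      forall a b c, gamma_pull h (gamma_map iota gamma) a b c
                    = iota (gamma a b c)
    & quad_pull h (map_mpoly iota q) = map_mpoly iota q].

Section Isotropic.

Variables (L : fieldType) (gamma : trilinear L).

Definition gamma_null m (W : 'M[L]_(m, 7)) : Prop :=
  forall w w' v : 'rV[L]_7,
    (w <= W)%MS -> (w' <= W)%MS -> trilin_eval gamma w w' v = 0.

Definition isotropic m (W : 'M[L]_(m, 7)) : Prop :=
  [\/ \rank W = 2%N /\ gamma_null W,
      \rank W = 1%N /\
        (exists W' : 'M[L]_7,
           [/\ \rank W' = 2%N, gamma_null W' & (W <= W')%MS])
    | \rank W = 0%N].

End Isotropic.

(* A = K[Hom(E, V)]: the variable of index mxvec_index a k is the function     *)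
(* phi |-> phi a k.                                                            *)
Definition coord_ring (R : nzRingType) := {mpoly R[2 * 7]}.

Definition eval_at (K L : comNzRingType) (iota : {rmorphism K -> L})
    (f : coord_ring K) (phi : 'M[L]_(2, 7)) : L :=
  (map_mpoly iota f).@[mxvec phi 0].

(* The ideal of Y_2 with its reduced structure.  As K need not be              *)
(* algebraically closed (it may be finite), one tests points over all field    *)
(* extensions of K; K[Y_2] is A modulo this ideal.                             *)
Definition ideal_Y2 (K : fieldType) (gamma : trilinear K)
    (f : coord_ring K) : Prop :=
  forall (L : fieldType) (iota : {rmorphism K -> L}) (phi : 'M[L]_(2, 7)),
    isotropic (gamma_map iota gamma) phi -> eval_at iota f phi = 0.

Section Resolutions.

Variables (n : nat) (K : fieldType).
Local Notation A := {mpoly K[n]}.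

Definition homogeneous_of_degree (e : int) (p : A) : Prop :=
  match e with
  | Posz d => p \is d.-homog
  | Negz _ => p = 0
  end.

(* F_i = \bigoplus_s A(- gdeg s), with elements written as row vectors;        *)
(* gdiff i : F_(i+1) -> F_i is v |-> v *m gdiff i, and gaug : F_0 -> A.        *)
Record free_complex := FreeComplex {
  grank : nat -> nat;
  gdeg : forall i, 'I_(grank i) -> int;
  gdiff : forall i, 'M[A]_(grank i.+1, grank i);
  gaug : 'cV[A]_(grank 0)
}.

(* F is a graded free resolution of A / I, via gaug modulo I. *)
Definition resolves (I : A -> Prop) (F : free_complex) : Prop :=
  [/\ (forall i s t, homogeneous_of_degree
         (gdeg (i := i.+1) s - gdeg (i := i) t) (gdiff F i s t))
      /\ (forall s, homogeneous_of_degree (gdeg (i := 0) s) (gaug F s 0)),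
      forall p : A, exists v : 'rV_(grank F 0), I ((v *m gaug F) 0 0 - p),
      forall v : 'rV_(grank F 0),
        I ((v *m gaug F) 0 0) <-> exists w, v = w *m gdiff F 0
    & forall i (v : 'rV_(grank F i.+1)),
        v *m gdiff F i = 0 <-> exists w, v = w *m gdiff F i.+1].

(* The differentials of K (x)_A F. *)
Definition reduced_diff (F : free_complex) i
    : 'M[K]_(grank F i.+1, grank F i) := map_mx (mcoeff 0%MM) (gdiff F i).

Definition minimal (F : free_complex) : Prop :=
  forall i, reduced_diff F i = 0.

Definition reduced_cycles (F : free_complex) i : 'M[K]_(grank F i) :=
  match i return 'M[K]_(grank F i) with
  | 0 => 1%:M
  | i'.+1 => kermx (reduced_diff F i')
  end.

Definition degree_part (F : free_complex) i (j : int) : 'M[K]_(grank F i) :=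
  diag_mx (\row_s (gdeg (i := i) s == j)%:R).

(* dim of the degree j part of H_i(K (x)_A F): the rank of a complement of     *)
(* the boundaries in the cycles, in degree j.                                  *)
Definition tor_dim (F : free_complex) (i : nat) (j : int) : nat :=
  \rank ((reduced_cycles F i :&: degree_part F i j)
         :\: (reduced_diff F i :&: degree_part F i j))%MS.

(* dim_K Tor_i^A(K, A / I)_j = b; Tor is computed by any graded free           *)
(* resolution.                                                                 *)
Definition is_betti (I : A -> Prop) (i : nat) (j : int) (b : nat) : Prop :=
  (exists F, resolves I F) /\ forall F, resolves I F -> tor_dim F i j = b.

(* The triples (i, j, beta_(i,j)) in the list give all the nonzero graded      *)
(* Betti numbers.                                                              *)
Definition betti_table (I : A -> Prop) (tbl : seq (nat * nat * nat)) : Prop :=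
  forall (i : nat) (j : int),
    is_betti I i j
      (\sum_(t <- tbl | (t.1.1 == i) && (t.1.2%:Z == j)) t.2)%N.

End Resolutions.

(* Representations of GL(E) x GL(V), polynomial in the matrix entries, given   *)
(* on R-points in a basis; they are restricted to GL(E) x G below.             *)
Record rep := Rep {
  rdim : nat;
  ract : forall R : comUnitRingType, 'M[R]_2 -> 'M[R]_7 -> 'M[R]_rdim
}.

Definition rep0 := @Rep 0 (fun R g h => 0).
Definition repK := @Rep 1 (fun R g h => 1%:M).
Definition repE := @Rep 2 (fun R g h => g).
Definition repV := @Rep 7 (fun R g h => h).
Definition repdetE := @Rep 1 (fun R g h => (\det g)%:M).

(* Sym^2 E in the basis e_0 ^ 2, e_0 e_1, e_1 ^ 2. *)
Definition sym2_basis (i : 'I_3) : 'I_2 * 'I_2 :=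
  tnth [tuple (ord0, ord0); (ord0, ord_max); (ord_max, ord_max)] i.

Definition sym2_mx (R : comUnitRingType) (g : 'M[R]_2) : 'M[R]_3 :=
  \matrix_(r, s)
    let: (a, c) := sym2_basis r in let: (b, d) := sym2_basis s in
    if b == d then g a b * g c d else g a b * g c d + g a d * g c b.

Definition repSym2E := @Rep 3 (fun R g h => sym2_mx g).

Definition rep_sum (U W : rep) :=
  @Rep (rdim U + rdim W)
    (fun R g h => block_mx (ract U g h) 0 0 (ract W g h)).

Definition rep_tensor (U W : rep) :=
  @Rep (rdim U * rdim W) (fun R g h => tensmx (ract U g h) (ract W g h)).

Notation "U \oplus W" := (rep_sum U W) (at level 50, left associativity).
Notation "U \otimes W" := (rep_tensor U W) (at level 40, left associativity).

(* The action of (g, h) on R[Hom(E, V)]: the automorphism (g, h) sends phi to  *)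
(* g^-1 *m phi *m h, hence f to the function phi |-> f (g *m phi *m h^-1).     *)
Definition poly_act (R : comUnitRingType) (g : 'M[R]_2) (h : 'M[R]_7)
    (f : coord_ring R) : coord_ring R :=
  let X : 'M[coord_ring R]_(2, 7) := \matrix_(a, k) 'X_(mxvec_index a k) in
  let C m (M : 'M[R]_m) : 'M[coord_ring R]_m := map_mx (@mpolyC (2 * 7) R) M in
  f \mPo [tuple (mxvec (C 2%N g *m X *m C 7%N (invmx h))) 0 i | i < 2 * 7].

(* The diagonal action on U (x) R[Hom(E, V)]. *)
Definition module_act (R : comUnitRingType) (U : rep) (g : 'M[R]_2)
    (h : 'M[R]_7) (v : 'rV[coord_ring R]_(rdim U)) :
    'rV[coord_ring R]_(rdim U) :=
  map_mx (poly_act g h) v *m map_mx (@mpolyC (2 * 7) R) (ract U g h).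

(* An A-linear map U (x) A -> W (x) A is GL(E) x G-equivariant when it         *)
(* commutes with R-points of GL(E) x G for every K-algebra R.                  *)
Definition equivariant (K : fieldType) (gamma : trilinear K)
    (q : quadratic K) (U W : rep)
    (D : 'M[coord_ring K]_(rdim U, rdim W)) : Prop :=
  forall (R : comUnitRingType) (iota : {rmorphism K -> R})
         (g : 'M[R]_2) (h : 'M[R]_7),
    g \in unitmx -> in_G iota gamma q h ->
    forall v : 'rV[coord_ring R]_(rdim U),
      let DR := map_mx (map_mpoly iota) D in
      module_act g h v *m DR = module_act g h (v *m DR).

(* terms lists pairs (U_i, d_i); there is a minimal graded free resolution of  *)
(* A / I by GL(E) x G-equivariant modules and maps whose i-th term is          *)
(* U_i (x) A(- d_i), for i < size terms, and 0 afterwards.                     *)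
Definition has_equivariant_minimal_resolution (K : fieldType)
    (gamma : trilinear K) (q : quadratic K) (I : coord_ring K -> Prop)
    (terms : seq (rep * nat)) : Prop :=
  let U i := (nth (rep0, 0%N) terms i).1 in
  let d i := (nth (rep0, 0%N) terms i).2 in
  exists (D : forall i, 'M[coord_ring K]_(rdim (U i.+1), rdim (U i)))
         (aug : 'M[coord_ring K]_(rdim (U 0%N), rdim repK)),
    let F := @FreeComplex _ _ (fun i => rdim (U i))
               (fun i _ => (d i)%:Z) D aug in
    [/\ resolves I F,
        minimal F,
        forall i, equivariant gamma q (D i)
      & equivariant gamma q aug].

(* Main.v *)
From HB Require Import structures.
Require Import Defs.
From mathcomp Require Import all_boot all_order all_algebra.
From mathcomp.multinomials Require Import ssrcomplements.
From mathcomp.real_closed Require Import mxtens.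
From mathcomp Require Import ring.
From Stdlib Require ClassicalEpsilon.

Set Implicit Arguments.
Unset Strict Implicit.
Unset Printing Implicit Defensive.

Import GRing.Theory.
Local Open Scope ring_scope.

(* The image of phi, with rows u and v, is gamma0-null if and only if the seven *)
(* quadrics c_k = gamma0 (u, v, e_k) vanish; Y_2 is cut out by these and by     *)
(* q0 (u), q0 (v) and the polar form of q0 at (u, v), the latter being replaced *)
(* in characteristic 2 by half of it modulo the c_k.  The resolution is given   *)
(* explicitly: in characteristic different from 2 by block matrices built from  *)
(* gamma0 and q0, which makes it equivariant, and in characteristic 2 by        *)
(* tables.  It is exact because five of the c_k act on it by 0 up to homotopy   *)
(* (once multiplied by 8) and form a regular sequence, their leading monomials  *)
(* being pairwise coprime: along such a sequence exactness modulo               *)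
(* (c_1, ..., c_i) descends from i + 1 to i, and the complex has length 5.      *)
(* The leading monomials are also prime to u_1, hence u_1 is a nonzerodivisor   *)
(* modulo the ten quadrics, and these generate the ideal of Y_2 because on the  *)
(* chart u_1 <> 0 they define the graph of a polynomial map over u_1.  An       *)
(* arbitrary pair (gamma, q) is reduced to (gamma0, q0) by a linear             *)
(* substitution.  Polynomial identities over the integers are decided by        *)
(* computation.                                                                 *)

(** Let u and v be the rows of [phi]. The plane that they span is null for gamma0 exactly when the
    seven quadrics c_k = gamma0 (u, v, e_k) vanish. If u and v are independent, then q0 (u), q0 (v)
    and the polar form at (u, v) vanish as well ([gamma_null_zero_locus]). These ten quadrics span a
    copy of det E ⊗ V plus Sym^2 E. The chart u_1 <> 0 of the variety has 9 free coordinates out of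
    14, so the codimension is 5, and the proof exhibits a complex F of length 5 that starts with the
    ten quadrics. Three things remain: F is exact, the quadrics generate the vanishing ideal, and F
    is minimal and, outside characteristic 2, equivariant.

    Exactness. If multiplication by a is null-homotopic on F and a is a nonzerodivisor modulo r, the
    long exact sequence of multiplication by a on F/rF breaks into short ones, so vanishing of
    H_(i+1) of F/(a, r)F forces vanishing of H_i of F/rF ([exact_mod_step]). Five such steps along a
    regular sequence lead from degrees above 5, where F is zero, to every positive degree
    ([exact_mod_regular]). The sequence consists, up to sign, of c_1, ..., c_5. It is regular
    because the leading monomials are pairwise coprime ([sys_regular]): a linear automorphism of A,
    unitriangular for a weight, turns multiplication by these monomials into multiplication by the
    polynomials that they lead. The homotopies are explicit matrices verified by computation.

    Generation. Since u_1 followed by the same five quadrics is still regular, F/u_1 F is exact at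
    F_1, and u_1 is a nonzerodivisor modulo the ten quadrics ([pideal_nonzerodivisor]). Modulo them,
    every f times a power of u_1 becomes a polynomial g whose value at a generic isotropic point
    over the fraction field of A is g itself. If f vanishes on the variety, then g = 0, and
    cancelling u_1 puts f in the ideal ([vanishing_ideal]).

    Betti numbers. Tor is the same for all graded resolutions, by lifting of chain maps and
    homotopies ([tor_dim_eq]), and a minimal one displays it in its generators ([tor_dim_minimal]).
    In characteristic 2 the polar form of q0 is degenerate and does not recover q0, so a second
    complex is used, with one more generator of degree 4 in each of F_2 and F_3.

    Equivariance. Outside characteristic 2 the differentials are blocks made of gamma0, the polar
    form of q0 and twice its inverse, which an element of G preserves ([formula1_aut] to
    [formula5_aut]). For GL(E) equivariance is a polynomial identity in the entries of u, v and g
    ([term_glP]). A general pair is reached by substituting the matrix P that relates it to (gamma0,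
    q0), and by letting P act on each term of F ([transport_resolves],
    [equivariant_complex_equivariant]). *)

(** * Computable polynomials *)

(* A list of terms (coefficient, indices of the variables with multiplicity).  *)
Definition pol := seq (int * seq nat).

Definition pscale (k : int) (p : pol) : pol :=
  if k == 0 then [::] else [seq (k * t.1, t.2) | t <- p].

Definition pmul (p q : pol) : pol :=
  [seq (s.1 * t.1, s.2 ++ t.2) | s <- p, t <- q].

Definition psubst (sigma : nat -> pol) (p : pol) : pol :=
  flatten [seq pscale t.1 (foldr pmul [:: (1, [::])] (map sigma t.2)) | t <- p].

Fixpoint pinsert (k : int) (m : seq nat) (p : pol) : pol :=
  if p is t :: p' then
    if m == t.2 then (k + t.1, m) :: p' else t :: pinsert k m p'
  else [:: (k, m)].

Definition pnorm (p : pol) : pol :=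
  [seq t <- foldr (fun t => pinsert t.1 (sort leq t.2)) [::] p | t.1 != 0].

(** Divisibility by [c] lets the same test serve identities over the integers, with [c = 0], and
    identities that hold only in characteristic 2, with [c = 2]. *)
Definition pzero (c : int) (p : pol) : bool :=
  all (fun t => (c %| t.1)%Z) (pnorm p).

(* Matrices of polynomials; their sizes are given to the operations.           *)
Definition pmx := nat -> nat -> pol.

Definition pmulmx (n : nat) (P Q : pmx) : pmx :=
  fun i j => flatten [seq pmul (P i l) (Q l j) | l <- iota 0 n].

Definition pscalemx (k : int) (P : pmx) : pmx := fun i j => pscale k (P i j).

Definition paddmx (P Q : pmx) : pmx := fun i j => P i j ++ Q i j.

Definition ptrmx (P : pmx) : pmx := fun i j => P j i.

Definition p0mx : pmx := fun _ _ => [::].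

Definition p1mx : pmx := fun i j => if i == j then [:: (1, [::])] else [::].

Definition prow_mx (n1 : nat) (P Q : pmx) : pmx :=
  fun i j => if (j < n1)%N then P i j else Q i (j - n1)%N.

Definition pcol_mx (m1 : nat) (P Q : pmx) : pmx :=
  fun i j => if (i < m1)%N then P i j else Q (i - m1)%N j.

Definition psubstmx (sigma : nat -> pol) (P : pmx) : pmx :=
  fun i j => psubst sigma (P i j).

Definition ptab (T : seq (seq pol)) : pmx :=
  fun i j => nth [::] (nth [::] T i) j.

(** Storing normal forms prevents the entries of a [pmx], which is a function, from being recomputed
    at each access. *)
Definition tabulate (m n : nat) (P : pmx) : seq (seq pol) :=
  [seq [seq pnorm (P i j) | j <- iota 0 n] | i <- iota 0 m].

Definition pmxeq (c : int) (m n : nat) (P Q : pmx) : bool :=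
  all (fun i => all (fun j => pzero c (P i j ++ pscale (-1) (Q i j)))
                    (iota 0 n)) (iota 0 m).

Section Evaluation.

Variables (R : comNzRingType) (e : nat -> R).

Definition moneval (m : seq nat) : R := \prod_(i <- m) e i.

Definition peval (p : pol) : R := \sum_(t <- p) t.1%:~R * moneval t.2.

Definition mxeval m n (P : pmx) : 'M[R]_(m, n) :=
  \matrix_(i, j) peval (P i j).

Lemma peval_nil : peval [::] = 0.
Proof. by rewrite /peval big_nil. Qed.

Lemma peval_cons t p : peval (t :: p) = t.1%:~R * moneval t.2 + peval p.
Proof. by rewrite /peval big_cons. Qed.

Lemma peval_cat p q : peval (p ++ q) = peval p + peval q.
Proof. by rewrite /peval big_cat. Qed.

Lemma peval_const k : peval [:: (k, [::])] = k%:~R.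
Proof. by rewrite peval_cons peval_nil /moneval big_nil mulr1 addr0. Qed.

Lemma peval_var i : peval [:: (1, [:: i])] = e i.
Proof. by rewrite peval_cons peval_nil /moneval big_seq1 mul1r addr0. Qed.

Lemma peval_flatten ps : peval (flatten ps) = \sum_(p <- ps) peval p.
Proof.
by elim: ps => [|p ps IH] /=; rewrite ?big_nil ?peval_nil // peval_cat big_cons IH.
Qed.

Lemma peval_scale k p : peval (pscale k p) = k%:~R * peval p.
Proof.
rewrite /pscale; case: eqP => [->|_]; first by rewrite peval_nil mul0r.
rewrite /peval big_map mulr_sumr; apply: eq_bigr => t _.
by rewrite intrM mulrA.
Qed.

Lemma moneval_cat m n : moneval (m ++ n) = moneval m * moneval n.
Proof. by rewrite /moneval big_cat. Qed.

Lemma peval_mul p q : peval (pmul p q) = peval p * peval q.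
Proof.
rewrite /peval /pmul big_allpairs_dep mulr_suml; apply: eq_bigr => s _ /=.
rewrite mulr_sumr; apply: eq_bigr => t _ /=.
by rewrite intrM moneval_cat mulrACA.
Qed.

Lemma peval_insert k m p : peval (pinsert k m p) = k%:~R * moneval m + peval p.
Proof.
elim: p => [|t p IH] /=; first by rewrite peval_cons.
case: eqP => [->|_]; rewrite !peval_cons /=; first by rewrite intrD mulrDl addrA.
by rewrite IH addrCA.
Qed.

Lemma peval_norm p : peval (pnorm p) = peval p.
Proof.
transitivity (peval (foldr (fun t => pinsert t.1 (sort leq t.2)) [::] p)).
  rewrite /pnorm; elim: (foldr _ _ _) => //= t q IH.
  by case: eqP => [t0|_]; rewrite !peval_cons IH // t0 mul0r add0r.
elim: p => //= t p IH; rewrite peval_insert peval_cons IH /moneval.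
by congr (_ * _ + _); apply: perm_big; rewrite perm_sort.
Qed.

Lemma peval_zero c p : c%:~R = 0 :> R -> pzero c p -> peval p = 0.
Proof.
move=> c0; rewrite -peval_norm /pzero.
elim: (pnorm p) => [|t q IH] /=; first by rewrite peval_nil.
case/andP => /dvdzP [k tE] /IH qE.
by rewrite peval_cons qE tE intrM c0 mulr0 mul0r addr0.
Qed.

Lemma mxeval_mul m n k P Q :
  mxeval m n P *m mxeval n k Q = mxeval m k (pmulmx n P Q).
Proof.
apply/matrixP=> i j; rewrite !mxE /pmulmx peval_flatten big_map.
have -> : iota 0 n = index_iota 0 n by rewrite /index_iota subn0.
rewrite big_mkord; apply: eq_bigr => l _.
by rewrite !mxE peval_mul.
Qed.

Lemma mxeval_add m n P Q :
  mxeval m n P + mxeval m n Q = mxeval m n (paddmx P Q).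
Proof. by apply/matrixP=> i j; rewrite !mxE /paddmx peval_cat. Qed.

Lemma mxeval_scale m n k P :
  k%:~R *: mxeval m n P = mxeval m n (pscalemx k P).
Proof. by apply/matrixP=> i j; rewrite !mxE /pscalemx peval_scale. Qed.

Lemma mxeval_opp m n P : - mxeval m n P = mxeval m n (pscalemx (-1) P).
Proof. by rewrite -mxeval_scale scaleN1r. Qed.

Lemma mxeval_tr m n P : (mxeval m n P)^T = mxeval n m (ptrmx P).
Proof. by apply/matrixP=> i j; rewrite !mxE. Qed.

Lemma mxeval0 m n : mxeval m n p0mx = 0.
Proof. by apply/matrixP=> i j; rewrite !mxE peval_nil. Qed.

Lemma mxeval1 n : mxeval n n p1mx = 1%:M.
Proof.
apply/matrixP=> i j; rewrite !mxE /p1mx -val_eqE /=.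
by case: (_ == _); rewrite ?peval_nil // peval_const.
Qed.

Lemma mxeval_row m n1 n2 P Q :
  row_mx (mxeval m n1 P) (mxeval m n2 Q) = mxeval m (n1 + n2) (prow_mx n1 P Q).
Proof.
apply/matrixP=> i j; rewrite !mxE /prow_mx.
by case: (splitP j) => k jk; rewrite !mxE jk ?ltn_ord ?addKn.
Qed.

Lemma mxeval_col m1 m2 n P Q :
  col_mx (mxeval m1 n P) (mxeval m2 n Q) = mxeval (m1 + m2) n (pcol_mx m1 P Q).
Proof.
apply/matrixP=> i j; rewrite !mxE /pcol_mx.
by case: (splitP i) => k ik; rewrite !mxE ik ?ltn_ord ?addKn.
Qed.

Lemma mxeval_tab m n P : mxeval m n (ptab (tabulate m n P)) = mxeval m n P.
Proof.
apply/matrixP=> i j; rewrite !mxE /ptab /tabulate.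
rewrite (nth_map 0%N) ?size_iota // (nth_map 0%N) ?size_iota //.
by rewrite !nth_iota // !add0n peval_norm.
Qed.

Lemma mxeval_eq c m n P Q :
  c%:~R = 0 :> R -> pmxeq c m n P Q -> mxeval m n P = mxeval m n Q.
Proof.
move=> c0 /allP PQ; apply/matrixP=> i j; rewrite !mxE; apply/eqP.
rewrite -subr_eq0 -[- _]mulN1r -(peval_scale (-1)) -peval_cat.
have /PQ/allP PQi : (i : nat) \in iota 0 m by rewrite mem_iota ltn_ord.
by apply/eqP/(peval_zero c0)/PQi; rewrite mem_iota ltn_ord.
Qed.

End Evaluation.

Lemma eq_peval (R : comNzRingType) (e e' : nat -> R) p :
  e =1 e' -> peval e p = peval e' p.
Proof.
by move=> ee; apply: eq_bigr => t _; congr (_ * _); apply: eq_bigr => i _.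
Qed.

Lemma peval_morph (R S : comNzRingType) (f : {rmorphism R -> S}) e p :
  f (peval e p) = peval (f \o e) p.
Proof.
rewrite rmorph_sum; apply: eq_bigr => t _; rewrite rmorphM rmorph_int.
by rewrite rmorph_prod.
Qed.

Lemma mxeval_morph (R S : comNzRingType) (f : {rmorphism R -> S}) e m n P :
  map_mx f (mxeval e m n P) = mxeval (f \o e) m n P.
Proof. by apply/matrixP=> i j; rewrite !mxE peval_morph. Qed.

Lemma peval_subst (R : comNzRingType) (e : nat -> R) sigma p :
  peval e (psubst sigma p) = peval (fun i => peval e (sigma i)) p.
Proof.
rewrite peval_flatten big_map; apply: eq_bigr => t _.
rewrite peval_scale; congr (_ * _); elim: t.2 => [|i m IH] /=.
  by rewrite peval_const /moneval big_nil.
by rewrite peval_mul IH /moneval big_cons.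
Qed.

Lemma mxeval_subst (R : comNzRingType) (e : nat -> R) sigma m n P :
  mxeval e m n (psubstmx sigma P) =
  mxeval (fun i => peval e (sigma i)) m n P.
Proof. by apply/matrixP=> i j; rewrite !mxE peval_subst. Qed.

(** The rank of F_0 is the value of a function and equals 1 only propositionally, hence the
    arbitrary index [s] in place of 0. *)
Lemma mul_unit_aug (R : comNzRingType) (e : nat -> R) n (v : 'rV[R]_n) s :
  n = 1%N -> (v *m mxeval e n 1 p1mx) 0 0 = v 0 s.
Proof. by move=> n1; move: v s; rewrite n1 => v s; rewrite mxeval1 mulmx1 ord1. Qed.

(** * An exactness criterion *)

Section Exactness.

Variable A : comNzRingType.

(** Generators are peeled off one at a time, so that membership modulo [a :: r] is by computation
    membership modulo [r] after subtraction of a multiple of [a]; this is the shape of the induction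
    along a regular sequence. *)
Fixpoint in_ideal (r : seq A) (f : A) : Prop :=
  if r is a :: r' then exists b, in_ideal r' (f - b * a) else f = 0.

Lemma in_ideal0 r : in_ideal r 0.
Proof. by elim: r => [|a r IH] //; exists 0; rewrite mul0r subr0. Qed.

Lemma in_idealD r f g : in_ideal r f -> in_ideal r g -> in_ideal r (f + g).
Proof.
elim: r f g => [|a r IH] f g /= => [-> ->|[b fb] [c gc]]; first by rewrite addr0.
by exists (b + c); rewrite mulrDl opprD addrACA; apply: IH.
Qed.

Lemma in_idealM r f g : in_ideal r f -> in_ideal r (g * f).
Proof.
elim: r f => [|a r IH] f /= => [->|[b fb]]; first by rewrite mulr0.
by exists (g * b); rewrite -mulrA -mulrBr; apply: IH.
Qed.

Lemma in_ideal_sum r (I : finType) (F : I -> A) :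
  (forall i, in_ideal r (F i)) -> in_ideal r (\sum_i F i).
Proof.
move=> rF; apply: (big_ind (in_ideal r)) => // [|f g]; first exact: in_ideal0.
exact: in_idealD.
Qed.

Definition nonzerodivisor_mod (r : seq A) (a : A) : Prop :=
  forall f, in_ideal r (a * f) -> in_ideal r f.

Definition vec_in_ideal (r : seq A) n (v : 'rV[A]_n) : Prop :=
  forall j, in_ideal r (v 0 j).

Lemma vec_in_idealD r n (v w : 'rV[A]_n) :
  vec_in_ideal r v -> vec_in_ideal r w -> vec_in_ideal r (v + w).
Proof. by move=> rv rw j; rewrite mxE; apply: in_idealD. Qed.

Lemma vec_in_idealM r m n (v : 'rV[A]_m) (M : 'M[A]_(m, n)) :
  vec_in_ideal r v -> vec_in_ideal r (v *m M).
Proof.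
by move=> rv j; rewrite mxE; apply: in_ideal_sum => k; rewrite mulrC; apply: in_idealM.
Qed.

Lemma vec_in_ideal_cons a r n (v : 'rV[A]_n) :
  vec_in_ideal (a :: r) v <-> exists w, vec_in_ideal r (v - a *: w).
Proof.
split=> [/fin_all_exists [b vb]|[w vw] j].
  by exists (\row_j b j) => j; have := vb j; rewrite !mxE [a * _]mulrC.
by exists (w 0 j); have := vw j; rewrite !mxE [a * _]mulrC.
Qed.

Variables (rk : nat -> nat) (d : forall i, 'M[A]_(rk i.+1, rk i)).

(** This is exactness at the term of index [i.+1] of the complex reduced modulo the ideal generated
    by [r]. *)
Definition exact_mod (i : nat) (r : seq A) : Prop :=
  forall v : 'rV_(rk i.+1), vec_in_ideal r (v *m d i) ->
    exists w, vec_in_ideal r (v - w *m d i.+1).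

(** The relation is asked at the terms of index [i.+1], the places where exactness is claimed. *)
Definition null_homotopic (a : A) : Prop :=
  exists s : forall i, 'M[A]_(rk i, rk i.+1),
    forall i, a%:M = d i *m s i + s i.+1 *m d i.+1.

Hypothesis dd0 : forall i, d i.+1 *m d i = 0.

(* The long exact sequence of multiplication by a, on which a acts by 0.       *)
Lemma exact_mod_step i r a :
  null_homotopic a -> nonzerodivisor_mod r a ->
  exact_mod i.+1 (a :: r) -> exact_mod i r.
Proof.
move=> [s sE] nzd_a ex v rv.
(* For a cycle v modulo r the homotopy gives a v = w d modulo r. So w is a cycle modulo (a, r),
   hence a boundary up to a multiple a w', and cancelling a shows that v is the boundary of w'. *)
pose w := v *m s i.+1.
have rav : vec_in_ideal r (a *: v - w *m d i.+1).
  rewrite -mul_mx_scalar sE mulmxDr !mulmxA -/w addrK.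
  exact: vec_in_idealM.
have [|y] := ex w.
  apply/vec_in_ideal_cons; exists v.
  by move=> j; have := in_idealM (-1) (rav j); rewrite !mxE mulN1r opprB.
case/vec_in_ideal_cons=> w' rw'; exists w' => j; apply: nzd_a.
have := vec_in_idealD rav (vec_in_idealM (d i.+1) rw').
rewrite !mulmxBl -!mulmxA dd0 mulmx0 subr0 addrA subrK -scalemxAl -scalerBr.
by move/(_ j); rewrite mxE.
Qed.

Fixpoint regular_mod (r s : seq A) : Prop :=
  if s is a :: s' then nonzerodivisor_mod r a /\ regular_mod (a :: r) s'
  else True.

(** Each element of [s] is traded for one homological degree: exactness at i follows from exactness
    at i + 1 modulo one more element. When [s] is exhausted the term has index above n and is
    zero. *)
Lemma exact_mod_regular n i r s :
  (forall j, (n < j)%N -> rk j = 0%N) -> (n <= i + size s)%N ->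
  {in s, forall a, null_homotopic a} -> regular_mod r s -> exact_mod i r.
Proof.
move=> rk0; elim: s i r => [|a s IH] i r /=.
  rewrite addn0 => ni _ _ v _; exists 0; rewrite mul0mx subr0 => j.
  by exfalso; move: j; rewrite rk0 ?ltnS // => -[].
rewrite addnS -addSn => ni hs [nzd_a reg].
apply: (exact_mod_step (a := a)) => //; first by apply: hs; rewrite mem_head.
by apply: IH => // b bs; apply: hs; rewrite inE bs orbT.
Qed.

(* Exactness of F/aF makes a injective on H_0(F).                              *)
Lemma nonzerodivisor_coker a :
  exact_mod 0 [:: a] -> GRing.lreg a ->
  forall v : 'rV_(rk 0), (exists w, a *: v = w *m d 0) ->
    exists w, v = w *m d 0.
Proof.
move=> ex rega v [w vw].
have [|y] := ex w.
  by move=> j; exists (v 0 j); rewrite -vw mxE mulrC subrr.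
case/vec_in_ideal_cons=> w' rw'; exists w'.
have {rw'} wE : w = y *m d 1 + a *: w'.
  apply/eqP; rewrite eq_sym -subr_eq0 -oppr_eq0 opprB; apply/eqP/rowP=> j.
  by rewrite [RHS]mxE opprD addrA; apply: rw'.
move: vw; rewrite wE mulmxDl -mulmxA dd0 mulmx0 add0r -scalemxAl => vw.
by apply/rowP=> j; apply: rega; move/rowP/(_ j): vw; rewrite !mxE.
Qed.

End Exactness.

(** * Regular sequences with coprime leading monomials *)

Section LeadingMonomials.

Variables (n : nat) (R : comNzRingType).
Local Notation mon := 'X_{1..n}.
Local Notation A := {mpoly R[n]}.

Variable wt : mon -> nat.
Hypothesis wtD : forall m1 m2 : mon, wt (m1 + m2)%MM = (wt m1 + wt m2)%N.

(** An additive weight takes the place of a monomial order: it suffices that in each polynomial of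
    the system the leading monomial is strictly heavier than the other terms. *)
Definition weight_lt (k : nat) (f : A) : Prop :=
  {in msupp f, forall m, (wt m < k)%N}.

Lemma weight_ltD k f g : weight_lt k f -> weight_lt k g -> weight_lt k (f + g).
Proof.
by move=> kf kg m /msuppD_le; rewrite mem_cat => /orP[/kf|/kg].
Qed.

Lemma weight_ltZ k c f : weight_lt k f -> weight_lt k (c *: f).
Proof. by move=> kf m /msuppZ_le /kf. Qed.

Lemma weight_lt0 k : weight_lt k 0.
Proof. by move=> m; rewrite msupp0. Qed.

Lemma weight_lt_sum (T : eqType) k (s : seq T) (F : T -> A) :
  {in s, forall i, weight_lt k (F i)} -> weight_lt k (\sum_(i <- s) F i).
Proof.
move=> kF; rewrite big_seq; elim/big_rec: _ => [|i f si kf]; first exact: weight_lt0.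
by apply: weight_ltD => //; apply: kF.
Qed.

Lemma weight_ltM k l f g :
  weight_lt k f -> weight_lt l.+1 g -> weight_lt (k + l) (f * g).
Proof.
move=> kf lg m /msuppM_le /allpairsP [[m1 m2] /= [/kf fm1 /lg gm2 ->]].
by rewrite wtD -addSn leq_add.
Qed.

Lemma weight_ltW k l f : (k <= l)%N -> weight_lt k f -> weight_lt l f.
Proof. by move=> kl kf m /kf /leq_trans; apply. Qed.

Lemma weight_ltX m : weight_lt (wt m).+1 'X_[m].
Proof. by move=> m'; rewrite msuppX mem_seq1 => /eqP ->. Qed.

Lemma weight_lt_ex f : exists k, weight_lt k f.
Proof.
exists (\max_(m <- msupp f) wt m).+1 => m mf.
by rewrite ltnS (@leq_bigmax_seq _ _ xpredT).
Qed.

(* Leading monomials, together with the polynomials they lead.                 *)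
Variable sys : seq (mon * A).

Hypothesis sys_neq0 : {in sys, forall x, x.1 != 0%MM}.
Hypothesis sys_lead : {in sys, forall x, weight_lt (wt x.1) (x.2 - 'X_[x.1])}.
Hypothesis sys_coprime : {in sys &, forall x y : mon * A, x != y ->
  forall i, (x.1 i == 0%N) || (y.1 i == 0%N)}.

(** In a variable that occurs in x the exponent of y is 0, so adding y cannot help x to divide. *)
Lemma coprime_lepm x y m :
  x \in sys -> y \in sys -> x != y -> (x.1 <= m + y.1)%MM -> (x.1 <= m)%MM.
Proof.
move=> xs ys xy /mnm_lepP le_x; apply/mnm_lepP => i.
have := le_x i; rewrite mnmDE.
by case/orP: (sys_coprime xs ys xy i) => /eqP -> //; rewrite addn0.
Qed.

(** [k] is fuel; the degree of [m] is enough, because a leading monomial is not 1 and dividing by it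
    lowers the degree. The list fixes which monomial is divided out first, but by coprimality the
    order is immaterial ([sys_phiD]). *)
Fixpoint sys_phi_rec (k : nat) (m : mon) : A :=
  if k is k'.+1 then
    if [seq x <- sys | (x.1 <= m)%MM] is x :: _
    then x.2 * sys_phi_rec k' (m - x.1)%MM else 'X_[m]
  else 'X_[m].

(* Replaces in m each maximal power of a leading monomial by the same power of *)
(* the polynomial that it leads.                                               *)
Definition sys_phi (m : mon) : A := sys_phi_rec (mdeg m) m.

Lemma mdeg_sub_sys x m : x \in sys -> (x.1 <= m)%MM -> (mdeg (m - x.1)%MM < mdeg m)%N.
Proof.
move=> xs xm; rewrite -[in X in (_ < X)%N](submK xm) mdegD -[X in (X < _)%N]addn0.
by rewrite ltn_add2l lt0n mdeg_eq0 sys_neq0.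
Qed.

Lemma sys_phi_recE k m : (mdeg m <= k)%N -> sys_phi_rec k m = sys_phi m.
Proof.
rewrite /sys_phi; elim: k {-2}k (leqnn k) m => [|K IH] k kK m mk.
  by move: kK mk; rewrite leqn0 => /eqP ->; rewrite leqn0 => /eqP ->.
case: k kK mk => [|k] kK mk; first by move: mk; rewrite leqn0 => /eqP ->.
have [m0|] := posnP (mdeg m).
  rewrite m0 /=; case E: [seq _ <- _ | _] => [|x s] //.
  have : x \in [seq x <- sys | (x.1 <= m)%MM] by rewrite E mem_head.
  by rewrite mem_filter => /andP[xm xs]; have := mdeg_sub_sys xs xm; rewrite m0.
move=> m_gt0; have [l ml] : exists l, mdeg m = l.+1.
  by exists (mdeg m).-1; rewrite prednK.
rewrite ml /=.
case E: [seq _ <- _ | _] => [|x s] //.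
have : x \in [seq x <- sys | (x.1 <= m)%MM] by rewrite E mem_head.
rewrite mem_filter => /andP[xm xs]; congr (_ * _).
have lt_m := mdeg_sub_sys xs xm.
rewrite ml ltnS in mk; rewrite ml ltnS in lt_m.
by rewrite (IH k) ?(IH l) ?(leq_trans lt_m) // (leq_trans mk).
Qed.

Lemma sys_phiE m : sys_phi m =
  if [seq x <- sys | (x.1 <= m)%MM] is x :: _
  then x.2 * sys_phi (m - x.1)%MM else 'X_[m].
Proof.
rewrite -(@sys_phi_recE (mdeg m).+1) //=.
case E: [seq _ <- _ | _] => [|x s] //.
have : x \in [seq x <- sys | (x.1 <= m)%MM] by rewrite E mem_head.
rewrite mem_filter => /andP[xm xs].
by rewrite sys_phi_recE // ltnW // mdeg_sub_sys.
Qed.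

(** If the recursion extracts another y first, y already divides m by coprimality, and by induction
    the two factors may be exchanged. *)
Lemma sys_phiD x m : x \in sys -> sys_phi (m + x.1)%MM = x.2 * sys_phi m.
Proof.
elim: {m}(mdeg m).+1 {-2}m x (ltnSn (mdeg m)) => // k IH m x mk xs.
rewrite sys_phiE; case E: [seq _ <- _ | _] => [|y s].
  have : x \in [seq y <- sys | (y.1 <= m + x.1)%MM].
    by rewrite mem_filter xs lem_addl.
  by rewrite E.
have : y \in [seq y <- sys | (y.1 <= m + x.1)%MM] by rewrite E mem_head.
rewrite mem_filter => /andP[ym ys].
have [->|yx] := eqVneq y x; first by rewrite addmK.
have {}ym := coprime_lepm ys xs yx ym.
have lt_m := mdeg_sub_sys ys ym.
have lt_k : (mdeg (m - y.1)%MM < k)%N by rewrite (leq_trans lt_m).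
have -> : (m + x.1 - y.1 = (m - y.1) + x.1)%MM by rewrite addmC -addmBA // addmC.
by rewrite IH // -[in RHS](submK ym) IH // mulrCA.
Qed.

Lemma sys_phi_lead m : weight_lt (wt m) (sys_phi m - 'X_[m]).
Proof.
elim: {m}(mdeg m).+1 {-2}m (ltnSn (mdeg m)) => // k IH m mk.
rewrite sys_phiE; case E: [seq _ <- _ | _] => [|x s].
  by rewrite subrr; apply: weight_lt0.
have : x \in [seq x <- sys | (x.1 <= m)%MM] by rewrite E mem_head.
rewrite mem_filter => /andP[xm xs].
have lt_m := mdeg_sub_sys xs xm.
have {IH} := IH _ (leq_trans lt_m mk).
set f := sys_phi _ => lt_f.
rewrite -(submK xm) mpolyXD wtD addrC.
have -> : - ('X_[m - x.1] * 'X_[x.1]) + x.2 * f =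
  (x.2 - 'X_[x.1]) * 'X_[m - x.1] + (f - 'X_[m - x.1]) * x.2 :> A.
  rewrite mulrBl mulrBl [_ * x.2]mulrC [_ * x.2]mulrC [in RHS]addrC addrA subrK.
  by rewrite addrC ['X_[x.1] * _]mulrC.
apply: weight_ltD; first by rewrite addnC; apply/weight_ltM/weight_ltX/sys_lead.
apply: weight_ltM => //; rewrite -[x.2](subrK 'X_[x.1]).
by apply/weight_ltD/weight_ltX; apply/(weight_ltW (leqnSn _))/sys_lead.
Qed.

(** The linear extension of [sys_phi] is a bijection of A that intertwines multiplication by each
    leading monomial with multiplication by its polynomial ([sys_PhiM]). It reduces regularity of
    the polynomials to regularity of coprime monomials, without division algorithm or Groebner
    bases. *)
Definition sys_Phi (f : A) : A := \sum_(m <- msupp f) f@_m *: sys_phi m.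

Lemma sys_PhiE k f : (msize f <= k)%N ->
  sys_Phi f = \sum_(m : 'X_{1..n < k}) f@_m *: sys_phi m.
Proof.
move=> le_fk; rewrite /sys_Phi (big_mksub ('X_{1..n < k})) ?msupp_uniq //=.
  by rewrite big_rmcond //= => m /memN_msupp_eq0 ->; rewrite scale0r.
by move=> m /msize_mdeg_lt /leq_trans; apply.
Qed.

Lemma sys_PhiD f g : sys_Phi (f + g) = sys_Phi f + sys_Phi g.
Proof.
pose k := maxn (msize (f + g)) (maxn (msize f) (msize g)).
rewrite !(@sys_PhiE k) ?leq_max ?leqnn ?orbT // -big_split.
by apply: eq_bigr => m _; rewrite mcoeffD scalerDl.
Qed.

Lemma sys_PhiZ c f : sys_Phi (c *: f) = c *: sys_Phi f.
Proof.
pose k := maxn (msize (c *: f)) (msize f).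
rewrite !(@sys_PhiE k) ?leq_max ?leqnn ?orbT // scaler_sumr.
by apply: eq_bigr => m _; rewrite mcoeffZ scalerA.
Qed.

Lemma sys_PhiB f g : sys_Phi (f - g) = sys_Phi f - sys_Phi g.
Proof. by rewrite sys_PhiD -scaleN1r sys_PhiZ scaleN1r. Qed.

Lemma sys_PhiX m : sys_Phi 'X_[m] = sys_phi m.
Proof. by rewrite /sys_Phi msuppX big_seq1 mcoeffX eqxx scale1r. Qed.

Lemma sys_Phi0 : sys_Phi 0 = 0.
Proof. by rewrite /sys_Phi msupp0 big_nil. Qed.

Lemma sys_PhiM x f : x \in sys -> sys_Phi (f * 'X_[x.1]) = x.2 * sys_Phi f.
Proof.
move=> xs; elim/mpolyind: f => [|c m f _ _ IH].
  by rewrite mul0r sys_Phi0 mulr0.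
rewrite mulrDl !sys_PhiD IH mulrDr -scalerAl -mpolyXD !sys_PhiZ !sys_PhiX.
by rewrite sys_phiD // scalerAr.
Qed.

(** This is unitriangularity: the map is the identity plus an operator that lowers the weight.
    Injectivity and surjectivity follow by induction on a bound for the weight. *)
Lemma sys_Phi_lead k f : weight_lt k.+1 f -> weight_lt k (sys_Phi f - f).
Proof.
move=> kf; rewrite {2}[f]mpolyE /sys_Phi -sumrB.
apply: weight_lt_sum => m mf; rewrite -scalerBr; apply: weight_ltZ.
by apply: (weight_ltW (k := wt m)); [rewrite -ltnS kf | apply: sys_phi_lead].
Qed.

Lemma weight_lt0_eq0 f : weight_lt 0 f -> f = 0.
Proof.
by move=> f0; rewrite [f]mpolyE big_seq big1 // => m /f0.
Qed.

Lemma sys_Phi_inj f : sys_Phi f = 0 -> f = 0.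
Proof.
have [k kf] := weight_lt_ex f; elim: k kf => [|k IH] kf f0.
  exact: weight_lt0_eq0.
apply: IH => //; have := weight_ltZ (c := -1) (sys_Phi_lead kf).
by rewrite f0 sub0r scaleN1r opprK.
Qed.

Lemma sys_Phi_surj f : exists g, sys_Phi g = f.
Proof.
have [k kf] := weight_lt_ex f; elim: k f kf => [|k IH] f kf.
  by exists 0; rewrite sys_Phi0 (weight_lt0_eq0 kf).
have [|g gE] := IH (f - sys_Phi f).
  by rewrite -opprB -scaleN1r; apply/weight_ltZ/sys_Phi_lead.
by exists (f + g); rewrite sys_PhiD gE addrC subrK.
Qed.

(** A multiple of a polynomial of the system is, by surjectivity, the image of a multiple of its
    leading monomial, so the monomial ideal is carried onto the ideal of the polynomials. *)
Lemma in_ideal_sys_Phi s f : {subset s <= sys} ->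
  in_ideal [seq x.2 | x <- s] (sys_Phi f) <->
  in_ideal [seq 'X_[x.1] | x <- s] f.
Proof.
elim: s f => [|x s IH] f ss /=.
  by split=> [/sys_Phi_inj //|->]; rewrite sys_Phi0.
have xs : x \in sys by apply: ss; rewrite mem_head.
have {}ss : {subset s <= sys} by move=> y ys; apply: ss; rewrite inE ys orbT.
split=> [[b]|[b /(IH _ ss)]].
  have [g <-] := sys_Phi_surj b; rewrite mulrC -sys_PhiM // -sys_PhiB.
  by move/(IH _ ss); exists g.
by rewrite sys_PhiB sys_PhiM // mulrC; exists (sys_Phi b).
Qed.

Lemma in_monomial_ideal (s : seq mon) (f : A) :
  in_ideal [seq 'X_[m] | m <- s] f <->
  {in msupp f, forall m, has (fun l => (l <= m)%MM) s}.
Proof.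
elim: s f => [|l s IH] f /=.
  split=> [->|f0] => [m|]; first by rewrite msupp0.
  by rewrite [f]mpolyE big_seq big1 // => m /f0.
split=> [[b /IH fs] m|fs].
  rewrite -[f](subrK (b * 'X_[l])) => /msuppD_le; rewrite mem_cat.
  case/orP=> [/fs ->|]; first by rewrite orbT.
  rewrite (perm_mem (msuppMX _ _)) => /mapP[m' _ ->].
  by rewrite lem_addr.
exists (\sum_(m <- msupp f | (l <= m)%MM) f@_m *: 'X_[m - l]).
apply/IH; rewrite {1}[f]mpolyE (bigID (fun m => (l <= m)%MM)) /=.
rewrite mulr_suml addrAC -sumrB big1 => [|m lm].
  rewrite add0r => m /msupp_sum_le /flattenP[/= ms] /mapP[m'].
  rewrite mem_filter => /andP[lm' m'f] -> /msuppZ_le.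
  rewrite msuppX mem_seq1 => /eqP ->.
  by have := fs _ m'f; rewrite (negbTE lm').
by rewrite -scalerAl -mpolyXD submK ?subrr.
Qed.

(** After transport to monomials the claim is about divisibility: a leading monomial that divides m
    times the leading monomial of x divides m, being coprime to the latter. *)
Lemma sys_nonzerodivisor x s : x \in sys -> {subset s <= sys} -> x \notin s ->
  nonzerodivisor_mod [seq y.2 | y <- s] x.2.
Proof.
move=> xs ss x's f; have [g <-] := sys_Phi_surj f.
rewrite -sys_PhiM // !in_ideal_sys_Phi // (map_comp (fun m => 'X_[m]) fst).
rewrite !in_monomial_ideal => gs m mg.
have /gs/hasP[_ /mapP[y ys ->] ym] : (x.1 + m)%MM \in msupp (g * 'X_[x.1]).
  by rewrite (perm_mem (msuppMX _ _)) map_f.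
apply/hasP; exists y.1; first exact: map_f.
apply: (coprime_lepm (y := x)) => //; first exact: ss; last by rewrite addmC.
by apply: contraNneq x's => <-.
Qed.

(** [regular_mod] pushes the elements already treated onto [r], which reverses them; hence
    [catrev]. *)
Lemma sys_regular r s : uniq (catrev s r) -> {subset r <= sys} ->
  {subset s <= sys} ->
  regular_mod [seq y.2 | y <- r] [seq y.2 | y <- s].
Proof.
elim: s r => //= x s IH r us rs ss; split; last first.
  apply: (IH (x :: r)) => // y => [|ys]; last by apply: ss; rewrite inE ys orbT.
  by rewrite inE => /orP[/eqP ->|/rs //]; apply: ss; rewrite mem_head.
apply: sys_nonzerodivisor => //; first by apply: ss; rewrite mem_head.
by move: us; rewrite catrevE cat_uniq => /and3P[_ _ /= /andP[]].
Qed.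

End LeadingMonomials.

(** * Independence of Tor from the resolution *)

Section HomogeneousParts.

Variables (n : nat) (K : fieldType).
Local Notation A := {mpoly K[n]}.
Implicit Types (p q : A) (e : int).

Definition hpart e p : A :=
  \sum_(m <- msupp p | (mdeg m)%:Z == e) p@_m *: 'X_[m].

Lemma mcoeff_hpart e p m :
  (hpart e p)@_m = if (mdeg m)%:Z == e then p@_m else 0.
Proof.
rewrite raddf_sum /=; case: ifP => [me|mne].
  rewrite [in RHS](mpolyE p) raddf_sum /=.
  rewrite [RHS](bigID (fun l => (mdeg l)%:Z == e)) /= [X in _ + X]big1 ?addr0 //.
  move=> l lne; rewrite mcoeffZ mcoeffX.
  by case: eqP => [lm|_]; [rewrite lm me in lne | rewrite mulr0].
apply: big1 => l le; rewrite mcoeffZ mcoeffX.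
by case: eqP => [lm|_]; [rewrite lm mne in le | rewrite mulr0].
Qed.

Lemma homogeneous_mcoeff e p m :
  homogeneous_of_degree e p -> (mdeg m)%:Z != e -> p@_m = 0.
Proof.
case: e => [d|d] /=; last by move=> ->; rewrite mcoeff0.
by move=> ph md; apply: (dhomog_nemf_coeff ph).
Qed.

Lemma homogeneousP e p :
  (forall m, (mdeg m)%:Z != e -> p@_m = 0) -> homogeneous_of_degree e p.
Proof.
case: e => [d|d] /= pe.
  apply/dhomogP => m; rewrite mcoeff_msupp.
  by apply: contraNeq => md; rewrite pe.
by apply/mpolyP => m; rewrite mcoeff0 pe.
Qed.

Lemma hpart_homogeneous e p : homogeneous_of_degree e (hpart e p).
Proof. by apply: homogeneousP => m /negbTE me; rewrite mcoeff_hpart me. Qed.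

Lemma hpart_id e p : homogeneous_of_degree e p -> hpart e p = p.
Proof.
move=> pe; apply/mpolyP => m; rewrite mcoeff_hpart.
by case: ifPn => // /(homogeneous_mcoeff pe) ->.
Qed.

Lemma hpartB e p q : hpart e (p - q) = hpart e p - hpart e q.
Proof.
apply/mpolyP => m; rewrite mcoeffB !mcoeff_hpart.
by case: ifP; rewrite ?mcoeffB ?subr0.
Qed.

Lemma hpart_sum e (I : finType) (F : I -> A) :
  hpart e (\sum_i F i) = \sum_i hpart e (F i).
Proof.
apply/mpolyP => m; rewrite mcoeff_hpart !(raddf_sum (mcoeff m)) /=.
case: ifP => me; last by rewrite big1 // => i _; rewrite mcoeff_hpart me.
by apply: eq_bigr => i _; rewrite mcoeff_hpart me.
Qed.

Lemma hpartMl d e p q :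
  homogeneous_of_degree d p -> hpart (d + e) (p * q) = p * hpart e q.
Proof.
move=> pd; apply/mpolyP => m; rewrite mcoeff_hpart !mcoeffM.
case: ifP => me; first apply: eq_bigr; last (apply/esym/big1);
  case=> -[m1 /= _] [m2 /= _] /= /eqP mE; rewrite mcoeff_hpart;
  (have [m1d|/(homogeneous_mcoeff pd) ->] := eqVneq (mdeg m1)%:Z d;
    last by rewrite !mul0r).
  move: me; rewrite mE mdegD PoszD m1d => /eqP /addrI ->.
  by rewrite eqxx.
case: eqP => [m2e|_]; last by rewrite mulr0.
by move: me; rewrite mE mdegD PoszD m1d m2e eqxx.
Qed.

Lemma homogeneous_coeff0 e p :
  homogeneous_of_degree e p -> e != 0 -> p@_0%MM = 0.
Proof.
by move=> pe e0; apply: (homogeneous_mcoeff pe); rewrite mdeg0 eq_sym.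
Qed.

(** The degree-preserving part of M, seen as a map between graded free modules with generators in
    degrees [da] and [db]. *)
Definition hmx a b (da : 'I_a -> int) (db : 'I_b -> int) (M : 'M[A]_(a, b)) :=
  \matrix_(s, t) hpart (da s - db t) (M s t).

Definition homogeneous_mx a b (da : 'I_a -> int) (db : 'I_b -> int)
    (M : 'M[A]_(a, b)) : Prop :=
  forall s t, homogeneous_of_degree (da s - db t) (M s t).

Lemma hmx_homogeneous a b (da : 'I_a -> int) (db : 'I_b -> int) M :
  homogeneous_mx da db (hmx da db M).
Proof. by move=> s t; rewrite mxE; apply: hpart_homogeneous. Qed.

Lemma hmx_id a b (da : 'I_a -> int) (db : 'I_b -> int) M :
  homogeneous_mx da db M -> hmx da db M = M.
Proof. by move=> Mh; apply/matrixP => s t; rewrite mxE hpart_id. Qed.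

Lemma hmxB a b (da : 'I_a -> int) (db : 'I_b -> int) (M N : 'M[A]_(a, b)) :
  hmx da db (M - N) = hmx da db M - hmx da db N.
Proof. by apply/matrixP => s t; rewrite !mxE hpartB. Qed.

Lemma hmx_mulr a b c (da : 'I_a -> int) (db : 'I_b -> int) (dc : 'I_c -> int)
    (M : 'M_(a, b)) (N : 'M_(b, c)) :
  homogeneous_mx db dc N -> hmx da dc (M *m N) = hmx da db M *m N.
Proof.
move=> Nh; apply/matrixP => s t; rewrite !mxE hpart_sum; apply: eq_bigr => k _.
rewrite mxE mulrC [RHS]mulrC -(hpartMl _ _ (Nh k t)).
by congr hpart; rewrite [RHS]addrC addrA subrK.
Qed.

Lemma hmx_mull a b c (da : 'I_a -> int) (db : 'I_b -> int) (dc : 'I_c -> int)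
    (M : 'M_(a, b)) (N : 'M_(b, c)) :
  homogeneous_mx da db M -> hmx da dc (M *m N) = M *m hmx db dc N.
Proof.
move=> Mh; apply/matrixP => s t; rewrite !mxE hpart_sum; apply: eq_bigr => k _.
rewrite mxE -(hpartMl _ _ (Mh s k)).
by congr hpart; rewrite addrA subrK.
Qed.

Lemma homogeneous_mx_mul a b c (da : 'I_a -> int) (db : 'I_b -> int)
    (dc : 'I_c -> int) (M : 'M_(a, b)) (N : 'M_(b, c)) :
  homogeneous_mx da db M -> homogeneous_mx db dc N ->
  homogeneous_mx da dc (M *m N).
Proof.
move=> Mh Nh; rewrite -(hmx_id Mh) -(hmx_mulr _ _ Nh); exact: hmx_homogeneous.
Qed.

End HomogeneousParts.

(** Chain maps and homotopies are chosen degree by degree, each choice depending on the previous one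
    and living in a matrix type that varies with the degree. [P] is the invariant that makes the
    next choice possible. *)
Lemma dependent_choice (T : nat -> Type) (R : forall i, T i -> T i.+1 -> Prop)
    (P : forall i, T i -> Prop) (x0 : T 0%N) : P 0%N x0 ->
  (forall i (x : T i), P i x -> exists2 y, P i.+1 y & R i x y) ->
  exists f : forall i, T i,
    [/\ f 0%N = x0, forall i, P i (f i) & forall i, R i (f i) (f i.+1)].
Proof.
move=> P0 step.
pose U i := {x : T i | P i x}.
have next i (x : U i) : {y : U i.+1 | R i (sval x) (sval y)}.
  apply: ClassicalEpsilon.constructive_indefinite_description.
  by have [y Py Rxy] := step i _ (svalP x); exists (exist _ y Py).
pose f := fix f i : U i :=
  if i is j.+1 then sval (next j (f j)) else exist _ x0 P0.
exists (fun i => sval (f i)); split=> // i; first exact: svalP.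
exact: (svalP (next i (f i))).
Qed.

Lemma row_lift (R : nzRingType) a b c (M : 'M[R]_(a, c)) (D : 'M[R]_(b, c)) :
  (forall s, exists w, row s M = w *m D) -> exists W, M = W *m D.
Proof.
move=> /fin_all_exists [W WE]; exists (\matrix_s W s).
by apply/row_matrixP => s; rewrite row_mul rowK.
Qed.

(** * Lifting chain maps and homotopies between resolutions *)

Section Comparison.

Variables (n : nat) (K : fieldType).
Local Notation A := {mpoly K[n]}.
Variable I : A -> Prop.
Hypothesis I0 : I 0.
Hypothesis ID : forall p q, I p -> I q -> I (p + q).
Hypothesis IM : forall p q, I q -> I (p * q).
Hypothesis Ih : forall e p, I p -> I (hpart e p).

Lemma ideal_sum (J : finType) (F : J -> A) :
  (forall i, I (F i)) -> I (\sum_i F i).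
Proof. by move=> IF; apply: (big_ind I). Qed.

Lemma ideal_mulmx a b c (M : 'M[A]_(a, b)) (N : 'M[A]_(b, c)) :
  (forall s t, I (N s t)) -> forall s t, I ((M *m N) s t).
Proof. by move=> IN s t; rewrite mxE; apply: ideal_sum => k; apply: IM. Qed.

Section Lifting.

Variable F : free_complex n K.
Hypothesis resF : resolves I F.

Lemma resolves_dd i : gdiff F i.+1 *m gdiff F i = 0.
Proof.
case: resF => _ _ _ ex; apply/row_matrixP => s; rewrite row_mul row0.
by apply/ex; exists (delta_mx 0 s); rewrite rowE.
Qed.

Lemma resolves_daug s : I ((gdiff F 0 *m gaug F) s 0).
Proof.
case: resF => _ _ ex _; have := (ex (row s (gdiff F 0))).2.
rewrite -row_mul mxE; apply; exists (delta_mx 0 s); by rewrite rowE.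
Qed.

Lemma lift_diff a i (M : 'M[A]_(a, grank F i.+1)) :
  M *m gdiff F i = 0 -> exists W, M = W *m gdiff F i.+1.
Proof.
case: resF => _ _ _ ex M0; apply: row_lift => s.
by apply/ex; rewrite -row_mul M0 row0.
Qed.

Lemma lift_aug a (M : 'M[A]_(a, grank F 0)) :
  (forall s, I ((M *m gaug F) s 0)) -> exists W, M = W *m gdiff F 0.
Proof.
case: resF => _ _ ex _ MI; apply: row_lift => s.
by apply/ex; rewrite -row_mul mxE.
Qed.

Lemma lift_base a (N : 'cV[A]_a) :
  exists W : 'M_(a, grank F 0), forall s, I ((W *m gaug F - N) s 0).
Proof.
case: resF => _ surj _ _.
have /fin_all_exists [W WE] : forall s : 'I_a, exists v : 'rV_(grank F 0),
  I ((v *m gaug F) 0 0 - N s 0) by move=> s; apply: surj.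
exists (\matrix_s W s) => s.
have E : row s (\matrix_s W s *m gaug F) = W s *m gaug F by rewrite row_mul rowK.
by have := WE s; rewrite -E [row _ _ _ _]mxE => IW; rewrite mxE [(- N) _ _]mxE.
Qed.

End Lifting.

Section TwoResolutions.

Variables F G : free_complex n K.
Hypotheses (resF : resolves I F) (resG : resolves I G).

(** Lifts exist by exactness of G. Replacing a lift by its degree-preserving part keeps the equation
    that it solves, since the differentials are homogeneous; at the bottom this uses homogeneity of
    I. *)
Lemma chain_map_exists : exists f : forall i, 'M[A]_(grank F i, grank G i),
  [/\ forall i, homogeneous_mx (gdeg (f := F) (i := i)) (gdeg (i := i)) (f i),
      forall s, I ((f 0%N *m gaug G - gaug F) s 0)
    & forall i, f i.+1 *m gdiff G i = gdiff F i *m f i].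
Proof.
have [[dF augF] _ _ _] := resF; have [[dG augG] _ _ _] := resG.
have [W WE] := lift_base resG (gaug F).
pose f0 := hmx (gdeg (f := F) (i := 0)) (gdeg (i := 0)) W.
have f0E s : I ((f0 *m gaug G - gaug F) s 0).
  pose d1 (_ : 'I_1) : int := 0.
  have hG : homogeneous_mx (gdeg (i := 0)) d1 (gaug G).
    by move=> t u; rewrite ord1 subr0.
  have hF : homogeneous_mx (gdeg (i := 0)) d1 (gaug F).
    by move=> t u; rewrite ord1 subr0.
  rewrite -(hmx_mulr _ _ hG) -[X in _ - X](hmx_id hF) -hmxB mxE.
  exact/Ih/WE.
(* The invariant says that the composite to be lifted next lands in the cycles of G, which at index
   0 means in I after augmentation. *)
pose P i : 'M[A]_(grank F i, grank G i) -> Prop :=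
  match i with
  | 0 => fun f => homogeneous_mx (gdeg (i := 0)) (gdeg (i := 0)) f /\
         forall s, I ((gdiff F 0 *m f *m gaug G) s 0)
  | i'.+1 => fun f => homogeneous_mx (gdeg (i := i'.+1)) (gdeg (i := i'.+1)) f /\
         gdiff F i'.+1 *m f *m gdiff G i' = 0
  end.
have [||f [f0' fP fR]] :=
    @dependent_choice _ (fun i x y => y *m gdiff G i = gdiff F i *m x) P f0.
- split=> [|s]; first exact: hmx_homogeneous.
  rewrite -mulmxA -[f0 *m gaug G](subrK (gaug F)) mulmxDr mxE.
  apply: ID (resolves_daug resF s).
  by apply: ideal_mulmx => t u; rewrite ord1.
- move=> i x Px.
  have [hx [W' W'E]] : homogeneous_mx (gdeg (i := i)) (gdeg (i := i)) x /\
      exists W', gdiff F i *m x = W' *m gdiff G i.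
    case: i x Px => [|i] x [hx xE]; split=> //; first exact: lift_aug.
    exact: lift_diff.
  pose y := hmx (gdeg (i := i.+1)) (gdeg (i := i.+1)) W'.
  have yE : y *m gdiff G i = gdiff F i *m x.
    rewrite -(hmx_mulr _ _ (dG i)) -W'E (hmx_mull _ _ (dF i)).
    by rewrite hmx_id.
  exists y => //; split; first exact: hmx_homogeneous.
  by rewrite -mulmxA yE mulmxA resolves_dd // mul0mx.
exists f; split=> // [i|s]; last by rewrite f0'.
by case: i {fR} (fP i) => [|i] [].
Qed.

End TwoResolutions.

(** An endomorphism of the resolution that induces the identity on A / I is homotopic to the
    identity; it is applied to the composite of two comparison maps. *)
Lemma homotopy_exists (F : free_complex n K)
    (h : forall i, 'M[A]_(grank F i)) : resolves I F ->
  (forall s, I ((h 0%N *m gaug F - gaug F) s 0)) ->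
  (forall i, h i.+1 *m gdiff F i = gdiff F i *m h i) ->
  exists s : forall i, 'M[A]_(grank F i, grank F i.+1),
    h 0%N - 1%:M = s 0%N *m gdiff F 0 /\
    forall i, h i.+1 - 1%:M = gdiff F i *m s i + s i.+1 *m gdiff F i.+1.
Proof.
move=> resF h0 hd.
have [s0 s0E] : exists W, h 0%N - 1%:M = W *m gdiff F 0.
  by apply: lift_aug => // s; rewrite mulmxBl mul1mx.
have [||s [s0' _ sR]] := @dependent_choice _
  (fun i x y => h i.+1 - 1%:M = gdiff F i *m x + y *m gdiff F i.+1)
  (fun i x => gdiff F i *m (h i - 1%:M - x *m gdiff F i) = 0) s0.
- by rewrite s0E subrr mulmx0.
- move=> i x xE.
  have [W WE] : exists W, h i.+1 - 1%:M - gdiff F i *m x = W *m gdiff F i.+1.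
    apply: lift_diff => //; rewrite mulmxBl mulmxBl hd mul1mx -mulmxA.
    by move: xE; rewrite !mulmxBr mulmx1.
  exists W; last by rewrite -WE [RHS]addrC subrK.
  by rewrite -WE opprB addrCA subrr addr0 mulmxA resolves_dd // mul0mx.
by exists s; rewrite s0'.
Qed.

Local Notation red := (map_mx (mcoeff 0%MM)).

Lemma red_mul a b c (M : 'M[A]_(a, b)) (N : 'M[A]_(b, c)) :
  red (M *m N) = red M *m red N.
Proof. exact: (map_mxM (mcoeff 0%MM : {rmorphism A -> K})). Qed.

Lemma red_scalar a : red (1%:M : 'M[A]_a) = 1%:M.
Proof. exact: (map_mx1 (mcoeff 0%MM : {rmorphism A -> K})). Qed.

Lemma red_sub a b (M N : 'M[A]_(a, b)) : red (M - N) = red M - red N.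
Proof. exact: (map_mxB (mcoeff 0%MM : {rmorphism A -> K})). Qed.

Lemma red_add a b (M N : 'M[A]_(a, b)) : red (M + N) = red M + red N.
Proof. exact: (map_mxD (mcoeff 0%MM : {rmorphism A -> K})). Qed.

Lemma degree_part_idem (F : free_complex n K) i j :
  degree_part F i j *m degree_part F i j = degree_part F i j.
Proof.
rewrite /degree_part mulmx_diag; congr diag_mx; apply/rowP=> s; rewrite !mxE.
by case: (_ == _); rewrite ?mul1r ?mul0r.
Qed.

Lemma sub_degree_part (F : free_complex n K) i j m (u : 'M_(m, _)) :
  (u <= degree_part F i j)%MS -> u *m degree_part F i j = u.
Proof. by case/submxP => w ->; rewrite -mulmxA degree_part_idem. Qed.

Lemma degree_part_comm (F G : free_complex n K) i j
    (f : 'M[A]_(grank F i, grank G i)) :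
  homogeneous_mx (gdeg (i := i)) (gdeg (i := i)) f ->
  degree_part F i j *m red f = red f *m degree_part G i j.
Proof.
move=> hf; apply/matrixP => s t.
rewrite mul_diag_mx mul_mx_diag !mxE.
have [<-|ne] := eqVneq (gdeg s) (gdeg t); first by rewrite mulrC.
by rewrite (homogeneous_coeff0 (hf s t)) ?mulr0 ?mul0r // subr_eq0.
Qed.

(** The rank of [Z :\: B] is the dimension of Z modulo its intersection with B. The hypotheses say
    that f maps Z to Z' and that a vector of Z sent into B' lies in B, so f is injective on these
    quotients. *)
Lemma rank_compl_le a b (Z B : 'M[K]_a) (Z' B' : 'M[K]_b) (f : 'M_(a, b)) :
  (Z *m f <= Z')%MS ->
  (forall u : 'rV_a, (u <= Z)%MS -> (u *m f <= B')%MS -> (u <= B)%MS) ->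
  (\rank (Z :\: B)%MS <= \rank (Z' :\: B')%MS)%N.
Proof.
move=> Zf inj; set C := (Z :\: B)%MS.
have CZ : (C <= Z)%MS by apply: diffmxSl.
have inj0 (u : 'rV_a) : (u <= C)%MS -> (u *m f <= B')%MS -> u = 0.
  move=> uC uB; apply/eqP; rewrite -submx0 -(capmx_diff Z B) sub_capmx.
  by rewrite uC inj // (submx_trans uC).
have rC : \rank (C *m f) = \rank C.
  rewrite -[RHS](mxrank_mul_ker C f); apply/esym/eqP.
  rewrite -[X in _ == X]addn0 eqn_add2l mxrank_eq0 -submx0.
  apply/rV_subP => u; rewrite sub_capmx => /andP[uC /sub_kermxP uf].
  by rewrite (inj0 u) ?sub0mx // uf sub0mx.
rewrite -rC -(leq_add2l (\rank (Z' :&: B')%MS)) mxrank_cap_compl.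
rewrite -mxrank_disjoint_sum.
  by apply: mxrankS; rewrite addsmx_sub capmxSl (submx_trans _ Zf) // submxMr.
apply/eqP; rewrite -submx0; apply/rV_subP => v; rewrite sub_capmx sub_capmx.
case/andP=> /andP[_ vB] /submxP [w vE].
rewrite vE mulmxA in vB *; rewrite (inj0 (w *m C)) ?submxMl //.
by rewrite mul0mx sub0mx.
Qed.

(** The comparison map f from F to G is injective on homology after reduction, because it has a left
    inverse g up to homotopy. Only f has to preserve degrees: the degree of a cycle of F is known,
    and one has to show only that it is a boundary. *)
Lemma tor_dim_le (F G : free_complex n K) i j :
  resolves I F -> resolves I G -> (tor_dim F i j <= tor_dim G i j)%N.
Proof.
move=> resF resG.
have [f [fh f0 fd]] := chain_map_exists resF resG.
have [g [_ g0 gd]] := chain_map_exists resG resF.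
have [||s [s0 sE]] := @homotopy_exists F (fun i => f i *m g i) resF.
- move=> t; rewrite -mulmxA -[g 0%N *m _](subrK (gaug G)) mulmxDr -addrA mxE.
  by apply: ID (f0 t); apply: ideal_mulmx => x y; rewrite ord1.
- by move=> k; rewrite -mulmxA gd mulmxA fd mulmxA.
apply: (@rank_compl_le _ _ _ _ _ _ (red (f i))) => [|u].
  apply/rV_subP => v /submxP [w ->]; rewrite mulmxA.
  have : (w *m (reduced_cycles F i :&: degree_part F i j) <=
    reduced_cycles F i :&: degree_part F i j)%MS by apply: submxMl.
  move: (w *m (reduced_cycles F i :&: degree_part F i j)%MS) => {w v} z.
  rewrite !sub_capmx => /andP[zZ zP]; apply/andP; split.
    case: i {fh} z zZ {zP} => [|i] z zZ /=; first exact: submx1.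
    apply/sub_kermxP; rewrite /reduced_diff -mulmxA -red_mul fd red_mul mulmxA.
    by move/sub_kermxP: zZ => ->; rewrite mul0mx.
  by rewrite -(sub_degree_part zP) -mulmxA degree_part_comm // mulmxA submxMl.
rewrite !sub_capmx => /andP[uZ uP] /andP[/submxP [y yE] _]; rewrite uP andbT.
(* The first summand is the image under g of a boundary of G; the second is a boundary by the
   homotopy, u being a cycle. *)
have -> : u = u *m red (f i *m g i) - u *m red (f i *m g i - 1%:M).
  by rewrite red_sub red_scalar mulmxBr mulmx1 opprB addrC subrK.
apply: addmx_sub.
  by rewrite red_mul mulmxA yE -mulmxA -red_mul -gd red_mul mulmxA submxMl.
rewrite eqmx_opp.
case: i u uZ {uP y yE} => [|i] u uZ.
  by rewrite s0 red_mul mulmxA submxMl.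
rewrite sE red_add mulmxDr !red_mul !mulmxA.
by move/sub_kermxP: uZ => ->; rewrite mul0mx add0r submxMl.
Qed.

Lemma tor_dim_eq (F G : free_complex n K) i j :
  resolves I F -> resolves I G -> tor_dim F i j = tor_dim G i j.
Proof. by move=> rF rG; apply/eqP; rewrite eqn_leq !tor_dim_le. Qed.

End Comparison.

(** * Tor of a minimal resolution *)

Lemma rank_degree_part n (K : fieldType) (F : free_complex n K) i j :
  \rank (degree_part F i j) = (\sum_(s < grank F i) (gdeg s == j))%N.
Proof.
set P := degree_part F i j.
have rowP s : row s P = (gdeg s == j)%:R *: delta_mx 0 s.
  apply/rowP => t; rewrite !mxE /= [t == s]eq_sym.
  by rewrite mulr_natr.
pose S := (\sum_(s | gdeg s == j) <<delta_mx 0 s : 'rV[K]_(grank F i)>>)%MS.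
have -> : \rank P = \rank S.
  apply/eqmx_rank/andP; split.
    apply/row_subP => s; rewrite rowP; have [sj|_] := boolP (gdeg s == j); last first.
      by rewrite scale0r sub0mx.
    by apply: scalemx_sub; rewrite (sumsmx_sup s) // genmxE.
  apply/sumsmx_subP => s sj; rewrite genmxE.
  by have := rowP s; rewrite sj scale1r => <-; apply: row_sub.
have /mxdirectP -> /= : mxdirect S by apply: mxdirect_delta => ? ? _ _.
rewrite big_mkcond; apply: eq_bigr => s _.
by rewrite mxrank_gen mxrank_delta; case: ifP.
Qed.

Lemma tor_dim_minimal n (K : fieldType) (F : free_complex n K) i j :
  minimal F -> tor_dim F i j = (\sum_(s < grank F i) (gdeg s == j))%N.
Proof.
move=> minF; rewrite /tor_dim (minF i) -rank_degree_part.
have cycE : (1%:M <= reduced_cycles F i)%MS.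
  case: i => [|i] /=; first exact: submx_refl.
  by apply/sub_kermxP; rewrite (minF i) mulmx0.
have <- : \rank (reduced_cycles F i :&: degree_part F i j)%MS =
          \rank (degree_part F i j).
  apply/eqmx_rank; rewrite capmxSr sub_capmx submx_refl andbT andTb.
  exact: submx_trans (submx1 _) cycE.
rewrite -[RHS](mxrank_cap_compl _ ((0 : 'M_(grank F i.+1, _)) :&: degree_part F i j)%MS).
by rewrite [X in (_ = \rank (_ :&: X) + _)%N]cap0mx capmx0 mxrank0.
Qed.

(** * Complexes given by computable matrices *)

(* The variable of index 7 a + k is phi |-> phi a k.                           *)
Definition var_index (k : nat) : 'I_(2 * 7) :=
  mxvec_index (inord (k %/ 7) : 'I_2) (inord (k %% 7) : 'I_7).

(** Vectorizing the matrix of the numbers 7 a + k inverts [var_index] without reference to how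
    [mxvec_index] numbers the entries. *)
Definition var_rank (i : 'I_(2 * 7)) : nat :=
  mxvec (\matrix_(a < 2, k < 7) (7 * a + k)%N) 0 i.

Lemma var_indexK k : (k < 14)%N -> var_rank (var_index k) = k.
Proof.
move=> k14; rewrite /var_rank mxvecE mxE !inordK ?ltn_mod //.
  by rewrite mulnC -divn_eq.
by rewrite ltn_divLR.
Qed.

Lemma var_index_entry (a : 'I_2) (k : 'I_7) : var_index (7 * a + k) = mxvec_index a k.
Proof.
have -> : (7 * a + k)%N = (a * 7 + k)%N by rewrite mulnC.
by rewrite /var_index divnMDl // divn_small // addn0 modnMDl modn_small // !inord_val.
Qed.

Section Certificates.

Variable K : fieldType.
Local Notation A := {mpoly K[2 * 7]}.

Definition xenv (k : nat) : A := 'X_(var_index k).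

Definition xmon (m : seq nat) : 'X_{1..2 * 7} :=
  (\big[+%MM/0%MM]_(i <- m) U_(var_index i))%MM.

Lemma moneval_xenv m : moneval xenv m = 'X_[xmon m].
Proof.
rewrite /moneval /xmon; elim: m => [|i m IH]; first by rewrite !big_nil mpolyX0.
by rewrite !big_cons IH mpolyXD.
Qed.

Lemma mdeg_xmon m : mdeg (xmon m) = size m.
Proof.
rewrite /xmon; elim: m => [|i m IH]; first by rewrite big_nil mdeg0.
by rewrite big_cons mdegD IH mdeg1.
Qed.

Lemma peval_xenvE p :
  peval xenv p = \sum_(t <- p) t.1%:~R *: 'X_[xmon t.2].
Proof.
apply: eq_bigr => t _; rewrite moneval_xenv -mul_mpolyC.
by rewrite -[t.1%:~R in RHS]/(_ t.1) rmorph_int.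
Qed.

Definition pdegree (d : int) (p : pol) : bool :=
  all (fun t => (size t.2)%:Z == d) p.

Lemma peval_homogeneous d p :
  pdegree d p -> homogeneous_of_degree d (peval xenv p).
Proof.
move=> /allP pd; apply: homogeneousP => m md; rewrite peval_xenvE raddf_sum /=.
rewrite big_seq big1 // => t /pd /eqP td; rewrite mcoeffZ mcoeffX.
have [tm|_] := eqVneq (xmon t.2) m; last by rewrite mulr0.
by rewrite -tm mdeg_xmon td eqxx in md.
Qed.

Lemma peval_coeff0 p : all (fun t => t.2 != [::]) p -> (peval xenv p)@_0%MM = 0.
Proof.
move=> /allP p0; rewrite peval_xenvE raddf_sum /= big_seq big1 // => t /p0 t0.
rewrite mcoeffZ mcoeffX; case: eqP => [/(congr1 (@mdeg _))|_]; last by rewrite mulr0.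
by rewrite mdeg_xmon mdeg0 => /size0nil tE; rewrite tE in t0.
Qed.

Section Weights.

Variable w : seq nat.

Definition xweight (m : 'X_{1..2 * 7}) : nat :=
  (\sum_i nth 0 w (var_rank i) * m i)%N.

Lemma xweightD m1 m2 : xweight (m1 + m2)%MM = (xweight m1 + xweight m2)%N.
Proof.
by rewrite /xweight -big_split; apply: eq_bigr => i _; rewrite mnmDE mulnDr.
Qed.

Definition pweight (m : seq nat) : nat := sumn [seq nth 0%N w i | i <- m].

Lemma xweight_xmon m : all (ltn^~ 14) m -> xweight (xmon m) = pweight m.
Proof.
rewrite /xmon; elim: m => [|i m IH] /=.
  by rewrite big_nil /xweight big1 // => i _; rewrite mnm0E muln0.
case/andP=> i14 /IH mE; rewrite big_cons xweightD mE /pweight /=; congr (_ + _)%N.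
rewrite /xweight (bigD1 (var_index i)) //= var_indexK // mnm1E eqxx muln1.
rewrite big1 ?addn0 // => j ji; rewrite mnm1E eq_sym (negbTE ji) muln0 //.
Qed.

Definition plm (p : pol) : seq nat := (head (0, [::]) p).2.

Definition plead (p : pol) : bool :=
  [&& (head (0, [::]) p).1 == 1,
      (plm p) != [::],
      all (fun t => all (ltn^~ 14) t.2) p
    & all (fun t => pweight t.2 < pweight (plm p))%N (behead p)].

Definition lead_mon (p : pol) := xmon (plm p).

Definition pcoprime (p q : pol) : bool :=
  ~~ has (mem (plm p)) (plm q).

Lemma plead_neq0 p : plead p -> lead_mon p != 0%MM.
Proof.
case/and4P=> _ p0 _ _; apply: contraNneq p0 => /(congr1 (@mdeg _)).
by rewrite mdeg_xmon mdeg0 => /size0nil ->.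
Qed.

Lemma plead_weight p : plead p ->
  weight_lt xweight (xweight (lead_mon p)) (peval xenv p - 'X_[lead_mon p]).
Proof.
case: p => [/and4P[] //|[k m] p].
case/and4P => /= /eqP -> _ /andP[m14 p14] /allP plt.
rewrite peval_xenvE big_cons scale1r addrAC /lead_mon /= subrr add0r.
apply: weight_lt_sum => t tp; apply: weight_ltZ => m'.
rewrite msuppX mem_seq1 => /eqP ->.
by rewrite !xweight_xmon ?plt // (allP p14).
Qed.

Lemma xmon_gt0 m i : xmon m i != 0%N -> exists2 k, k \in m & i = var_index k.
Proof.
rewrite /xmon; elim: m => [|k m IH]; first by rewrite big_nil mnm0E.
rewrite big_cons mnmDE mnm1E; have [<- _|_] := eqVneq (var_index k) i.
  by exists k; rewrite ?mem_head.
by rewrite add0n => /IH [l lm ->]; exists l; rewrite // inE lm orbT.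
Qed.

Lemma pcoprime_lead p q : plead p -> plead q -> pcoprime p q ->
  forall i, (lead_mon p i == 0%N) || (lead_mon q i == 0%N).
Proof.
move=> lp lq /hasPn pq i; rewrite -[_ || _]negbK negb_or; apply/negP.
case/andP=> /xmon_gt0 [k kp ->] /xmon_gt0 [l lq' kl].
have bnd r j : plead r -> j \in (plm r) -> (j < 14)%N.
  case: r => [|t r] //; case/and4P=> _ _ /= /andP[/allP t14 _] _ /t14 //.
have := congr1 var_rank kl; rewrite (var_indexK (bnd p k lp kp)) (var_indexK (bnd q l lq lq')) => klE.
by have := pq _ lq'; rewrite -klE /= kp.
Qed.

Lemma pregular (s : seq pol) :
  all plead s -> pairwise pcoprime s -> uniq s ->
  regular_mod [::] [seq peval xenv p | p <- s].
Proof.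
move=> /allP ls cs us.
pose sys := [seq (lead_mon p, peval xenv p) | p <- s].
have -> : [seq peval xenv p | p <- s] = [seq x.2 | x <- sys] by rewrite -map_comp.
have copr : {in s &, forall p q : pol, p != q -> forall i,
    (lead_mon p i == 0%N) || (lead_mon q i == 0%N)}.
  elim: s {sys us} ls cs => // p s IH ls /= /andP[/allP cp cs] q r.
  have lp := ls p (mem_head _ _).
  have {}ls : {in s, forall q, plead q} by move=> x xs; apply: ls; rewrite inE xs orbT.
  rewrite !inE => /orP[/eqP ->|qs] /orP[/eqP ->|rs]; rewrite ?eqxx // => qr i.
  - exact: (pcoprime_lead lp (ls _ rs) (cp _ rs)).
  - by rewrite orbC; apply: (pcoprime_lead lp (ls _ qs) (cp _ qs)).
  - exact: IH.
have inj : {in s &, injective lead_mon}.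
  move=> p q ps qs pq; apply/eqP; apply: contraT => /(copr _ _ ps qs) c.
  have := plead_neq0 (ls _ qs); rewrite -mdeg_eq0 mdegE big1 // => i _.
  by have := c i; rewrite pq orbb => /eqP.
apply: (@sys_regular _ _ xweight xweightD sys _ _ _ [::]) => //.
- by move=> _ /mapP[p /ls lp ->]; apply: plead_neq0.
- by move=> _ /mapP[p /ls lp ->]; apply: plead_weight.
- move=> _ _ /mapP[p ps ->] /mapP[q qs ->] pq; apply: copr => //.
  by apply: contraNneq pq => ->.
- rewrite catrevE cats0 rev_uniq map_inj_in_uniq // => p q ps qs [pq _].
  exact: inj.
Qed.

End Weights.

Section Complex.

Variables (rk : nat -> nat) (dg : nat -> nat -> nat) (pD : nat -> pmx).
Variables (c N : int) (sys : seq pol) (pS : nat -> nat -> pmx).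

Definition pcheck_complex : bool :=
  all (fun i => pmxeq c (rk i.+2) (rk i) (pmulmx (rk i.+1) (pD i.+1) (pD i)) p0mx)
      (iota 0 5).

(** The second conjunct excludes constant terms from the entries and certifies minimality. The five
    differentials tested are all those between nonzero terms. *)
Definition pcheck_degrees : bool :=
  all (fun i => all (fun s => all (fun t =>
         pdegree ((dg i.+1 s)%:Z - (dg i t)%:Z) (pD i s t)
         && all (fun l => l.2 != [::]) (pD i s t))
       (iota 0 (rk i))) (iota 0 (rk i.+1))) (iota 0 5).

(** The matrices [pS j] have integer coefficients and give a homotopy for N times the j-th element
    of [sys]; N is inverted afterwards in K. *)
Definition pcheck_homotopy : bool :=
  all (fun j => all (fun i =>
    pmxeq c (rk i.+1) (rk i.+1)
      (paddmx (pmulmx (rk i) (pD i) (pS j i))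
              (pmulmx (rk i.+2) (pS j i.+1) (pD i.+1)))
      (fun s t => if s == t then pscale N (nth [::] sys j) else [::]))
    (iota 0 5)) (iota 0 (size sys)).

Hypotheses (rk0 : rk 0 = 1%N) (rk_gt5 : forall i, (5 < i)%N -> rk i = 0%N).
Hypotheses (dg0 : dg 0 0 = 0%N) (c0 : c%:~R = 0 :> K) (N0 : N%:~R != 0 :> K).
Hypotheses (complexP : pcheck_complex) (degreesP : pcheck_degrees).
Hypotheses (homotopyP : pcheck_homotopy) (size_sys : (5 <= size sys)%N).

Definition pdiff i : 'M[A]_(rk i.+1, rk i) := mxeval xenv (rk i.+1) (rk i) (pD i).

Definition pcomplex : free_complex (2 * 7) K :=
  @FreeComplex _ _ rk (fun i s => (dg i s)%:Z) pdiff (mxeval xenv (rk 0) 1 p1mx).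

(** The coefficients are indexed by natural numbers, so that no transport along an equation for
    [rk 1] occurs. *)
Definition pideal (f : A) : Prop :=
  exists b : nat -> A, f = \sum_(k < rk 1) b k * peval xenv (pD 0 k 0).

Lemma cA0 : c%:~R = 0 :> A.
Proof. by rewrite -(rmorph_int (@mpolyC (2 * 7) K)) c0 rmorph0. Qed.

Lemma flat0 m n (P Q : 'M[A]_(m, n)) : m = 0%N -> P = Q.
Proof. by move=> m0; move: P Q; rewrite m0 => P Q; rewrite (flatmx0 P) (flatmx0 Q). Qed.

Lemma pdiff_comp i : pdiff i.+1 *m pdiff i = 0.
Proof.
have [i5|] := ltnP i 5; last by move=> i5; apply: flat0; rewrite rk_gt5 // ltnW.
rewrite mxeval_mul -(mxeval0 xenv); apply: (mxeval_eq xenv cA0).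
by have := allP complexP i; rewrite mem_iota i5 => /(_ isT).
Qed.

Lemma pdiff_null_homotopic j : (j < size sys)%N ->
  null_homotopic pdiff (peval xenv (nth [::] sys j)).
Proof.
move=> js; set a := peval _ _.
exists (fun i => ((N%:~R)^-1)%:MP *: mxeval xenv (rk i) (rk i.+1) (pS j i)) => i.
have [i5|] := ltnP i 5; last by move=> i5; apply: flat0; rewrite rk_gt5.
have NA : ((N%:~R)^-1)%:MP * N%:~R = 1 :> A.
  by rewrite -(rmorph_int (@mpolyC (2 * 7) K)) -rmorphM mulVf ?rmorph1.
rewrite -scalemxAl -scalemxAr -scalerDr !mxeval_mul mxeval_add.
have := allP homotopyP j; rewrite mem_iota js => /(_ isT)/allP/(_ i).
rewrite mem_iota i5 => /(_ isT).
move=> /(mxeval_eq xenv cA0) ->; apply/matrixP => s t; rewrite !mxE.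
have [->|st] := eqVneq s t; rewrite ?eqxx ?mulr1n.
  by rewrite peval_scale mulrA NA mul1r.
by rewrite val_eqE (negbTE st) peval_nil mulr0.
Qed.

Lemma pdiff_exact i r s : regular_mod r [seq peval xenv p | p <- s] ->
  {subset s <= sys} -> (5 <= i + size s)%N -> exact_mod pdiff i r.
Proof.
move=> reg ss i5; apply: (@exact_mod_regular _ _ _ pdiff_comp 5) reg => //.
  by rewrite size_map.
move=> _ /mapP[p /ss ps ->]; rewrite -(nth_index [::] ps).
by apply: pdiff_null_homotopic; rewrite index_mem.
Qed.

Lemma pidealP (v : 'rV[A]_(rk 0)) :
  pideal ((v *m mxeval xenv (rk 0) 1 p1mx) 0 0) <-> exists w, v = w *m pdiff 0.
Proof.
have s0 : (0 < rk 0)%N by rewrite rk0.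
have vs0 (s : 'I_(rk 0)) : s = Ordinal s0.
  by apply/val_inj => /=; move: (ltn_ord s); rewrite {2}rk0 ltnS leqn0 => /eqP.
rewrite (mul_unit_aug _ v (Ordinal s0)) //; split=> [[b vb]|[w ->]].
  exists (\row_k b k); apply/rowP => s; rewrite (vs0 s) vb mxE.
  by apply: eq_bigr => k _; rewrite !mxE.
exists (fun k => if insub k is Some i then w 0 i else 0).
by rewrite mxE; apply: eq_bigr => k _; rewrite mxE insubT //= => ?; congr (w _ _ * _); apply/val_inj.
Qed.

Lemma pdiff_resolves : regular_mod [::] [seq peval xenv p | p <- sys] ->
  resolves pideal pcomplex.
Proof.
move=> reg; split.
- split=> [i s t|s].
    rewrite mxE; apply: peval_homogeneous; have [i5|i5] := ltnP i 5; last first.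
      by move: s; rewrite /= rk_gt5 // => -[].
    have := allP degreesP i; rewrite mem_iota i5 => /(_ isT)/allP/(_ s).
rewrite mem_iota ltn_ord => /(_ isT).
    by move/allP/(_ t); rewrite mem_iota ltn_ord => /(_ isT) /andP[].
  rewrite mxE; apply: peval_homogeneous; rewrite /=.
  have -> : s = 0 :> nat by move: (ltn_ord s); rewrite {2}[grank _ _]rk0 ltnS leqn0 => /eqP.
  by rewrite dg0.
- move=> p; exists (const_mx p).
  have s0 : (0 < rk 0)%N by rewrite rk0.
  rewrite (mul_unit_aug _ _ (Ordinal s0)) // mxE subrr.
  by exists (fun _ => 0); rewrite big1 // => k _; rewrite mul0r.
- exact: pidealP.
- move=> i v; split=> [v0|[w ->]]; last by rewrite -mulmxA pdiff_comp mulmx0.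
  have ex := @pdiff_exact i [::] sys reg (fun _ => id) (leq_trans size_sys (leq_addl _ _)).
  have [|w vw] := ex v; first by move=> j; rewrite [v *m _]v0 mxE.
  exists w; apply/eqP; rewrite -subr_eq0; apply/eqP/rowP=> j.
  by rewrite [LHS]vw mxE.
Qed.

Lemma pcomplex_minimal : minimal pcomplex.
Proof.
move=> i; apply/matrixP => s t; rewrite !mxE; apply: peval_coeff0.
have [i5|i5] := ltnP i 5; last by move: s; rewrite /= rk_gt5 // => -[].
have := allP degreesP i; rewrite mem_iota i5 => /(_ isT)/allP/(_ s).
rewrite mem_iota ltn_ord => /(_ isT).
by move/allP/(_ t); rewrite mem_iota ltn_ord => /(_ isT) /andP[].
Qed.

(** The homotopies remain valid modulo a. If [sys] is still regular after a, then F/aF is exact at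
    F_1, that is, Tor_1 of A / a and the cokernel A / I of the first differential vanishes, and a
    acts injectively on A / I. *)
Lemma pideal_nonzerodivisor a f :
  regular_mod [:: a] [seq peval xenv p | p <- sys] -> GRing.lreg a ->
  pideal (a * f) -> pideal f.
Proof.
move=> reg rega.
have s0 : (0 < rk 0)%N by rewrite rk0.
have E g : g = ((const_mx g : 'rV_(rk 0)) *m mxeval xenv (rk 0) 1 p1mx) 0 0.
  by rewrite (mul_unit_aug _ _ (Ordinal s0)) // mxE.
rewrite [X in pideal X -> _](E (a * f)) [X in _ -> pideal X](E f) => /pidealP [w wE]; apply/pidealP.
apply: (nonzerodivisor_coker pdiff_comp _ rega); first exact: pdiff_exact reg _ _.
exists w; rewrite -wE; apply/rowP => j; rewrite !mxE //.
Qed.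

End Complex.

End Certificates.

(** * The resolution in characteristic different from 2 *)

(** This is the expanded determinant of [wedge3], in a form that computes; [y.+1] reconciles indices
    from 0 with the labels 1 to 7. *)
Definition wedge3_int (i j k a b c : nat) : int :=
  let d x y : int := ((x == y.+1) : nat)%:Z in
  d i a * (d j b * d k c - d j c * d k b)
  - d i b * (d j a * d k c - d j c * d k a)
  + d i c * (d j a * d k b - d j b * d k a).

Definition gamma_int (a b c : nat) : int :=
  wedge3_int 1 4 7 a b c + wedge3_int 2 4 6 a b c + wedge3_int 3 4 5 a b c
  - wedge3_int 2 3 7 a b c - wedge3_int 1 5 6 a b c.

(* The Gram matrix of the polar form of q0, and twice its inverse.             *)
Definition polar_int (i j : nat) : int :=
  if (i + j == 6)%N then nth 0 [:: 1; -1; -1; 2; -1; -1; 1] i else 0.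

Definition copolar_int (i j : nat) : int :=
  if (i + j == 6)%N then nth 0 [:: 2; -2; -2; 1; -2; -2; 2] i else 0.

Definition pint (b : nat -> nat -> int) : pmx :=
  fun i j => if b i j == 0 then [::] else [:: (b i j, [::])].

Definition pB := pint polar_int.
Definition pC := pint copolar_int.

Definition pu : pmx := fun _ k => [:: (1, [:: k])].
Definition pv : pmx := fun _ k => [:: (1, [:: (7 + k)%N])].

Definition pGam (x : pmx) : pmx := fun k l =>
  flatten [seq pscale (gamma_int k l c) (x 0%N c) | c <- iota 0 7].

Definition pscalarmx (p : pol) : pmx := fun i j => if i == j then p else [::].

(** An index of gamma0 is raised with twice the inverse of the polar form B: the vector z = y [pL]
    (x) satisfies B (z, w) = 2 gamma0 (y, w, x). In the same way [pcr x y] raises the index of the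
    column [pcd x y] of the values gamma0 (x, y, e_k). This is the product on V invariant under G,
    up to a scalar. *)
Definition pL (x : pmx) : pmx := pmulmx 7 (pGam x) pC.
Definition pbcol (x : pmx) : pmx := pmulmx 7 pB (ptrmx x).
Definition pbil (x y : pmx) : pmx := pmulmx 7 (pmulmx 7 x pB) (ptrmx y).
Definition pcd (x y : pmx) : pmx := pmulmx 7 (pGam y) (ptrmx x).
Definition pcr (x y : pmx) : pmx :=
  ptab (tabulate 1 7 (pmulmx 7 (ptrmx (pcd x y)) pC)).

Definition pblock (m n : nat) (P Q R S : pmx) : pmx :=
  pcol_mx m (prow_mx n P Q) (prow_mx n R S).

Definition pD1 : pmx :=
  pcol_mx 7 (pcd pu pv)
    (pcol_mx 1 (pbil pu pu) (pcol_mx 1 (pbil pu pv) (pbil pv pv))).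

Definition pD2 : pmx :=
  pcol_mx 8
    (pblock 1 7 pu p0mx (pL pu)
       (prow_mx 1 (pbcol pv) (prow_mx 1 (pscalemx (-1) (pbcol pu)) p0mx)))
    (pblock 1 7 pv p0mx (pL pv)
       (prow_mx 1 p0mx (prow_mx 1 (pbcol pv) (pscalemx (-1) (pbcol pu))))).

Definition psym_block (x y : pmx) : pmx :=
  pblock 1 1 (pscalemx (-2) (pbil x y)) p0mx p0mx
    (paddmx (pscalarmx (pscale 2 (pbil x y 0%N 0%N)))
       (pscalemx (-1) (paddmx (pmulmx 1 (pbcol x) y) (pmulmx 1 (pbcol y) x)))).

Definition pskew_block (x y : pmx) : pmx :=
  pblock 1 1 p0mx (pcr x y) (pscalemx (-4) (pcd x y))
    (paddmx (paddmx (pmulmx 1 (pbcol x) y)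
                    (pscalemx (-1) (pmulmx 1 (pbcol y) x)))
            (pL (pcr x y))).

(** The 2 by 2 block structure is that of Hom (E, E), which splits into scalars and traceless maps.
    The block alternating in (u, v) sits along the scalars, and the symmetric blocks at (u, u), (u,
    v), (v, v) form the traceless part, a twist of Sym^2 E. *)
Definition pD3 : pmx :=
  pblock 8 8 (paddmx (pskew_block pu pv) (pscalemx (-1) (psym_block pu pv)))
    (psym_block pu pu)
    (pscalemx (-1) (psym_block pv pv))
    (paddmx (pskew_block pu pv) (psym_block pu pv)).

Definition pD4 : pmx :=
  pcol_mx 7
    (prow_mx 8 (prow_mx 1 (pscalemx (-2) (pbcol pv)) (pL pv))
       (prow_mx 1 (pscalemx 2 (pbcol pu)) (pscalemx (-1) (pL pu))))
    (pcol_mx 1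
       (prow_mx 8 (prow_mx 1 p0mx (pscalemx 2 pu)) p0mx)
       (pcol_mx 1
          (prow_mx 8 (prow_mx 1 p0mx pv) (prow_mx 1 p0mx pu))
          (prow_mx 8 p0mx (prow_mx 1 p0mx (pscalemx 2 pv))))).

Definition pD5 : pmx :=
  prow_mx 7 (pcr pu pv)
    (prow_mx 1 (pbil pv pv) (prow_mx 1 (pscalemx (-2) (pbil pu pv)) (pbil pu pu))).

Definition table1 : seq (seq pol) := Eval vm_compute in tabulate 10 1 pD1.
Definition table2 : seq (seq pol) := Eval vm_compute in tabulate 16 10 pD2.
Definition table3 : seq (seq pol) := Eval vm_compute in tabulate 16 16 pD3.
Definition table4 : seq (seq pol) := Eval vm_compute in tabulate 10 16 pD4.
Definition table5 : seq (seq pol) := Eval vm_compute in tabulate 1 10 pD5.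

Definition resolution_diff (i : nat) : pmx :=
  ptab (nth [::] [:: table1; table2; table3; table4; table5] i).

Definition resolution_rank (i : nat) : nat := nth 0%N [:: 1; 10; 16; 16; 10; 1]%N i.

Definition resolution_deg (i s : nat) : nat := nth 0%N [:: 0; 2; 3; 5; 6; 8]%N i.

Definition entries := seq (nat * nat * int * seq nat).

Definition sparse_mx (s : entries) : pmx :=
  fun i j => [seq (t.1.2, t.2) | t <- s & t.1.1 == (i, j)].

(* The terms k, k x_a and k x_a x_b of the entry (i, j) of a matrix; N stands  *)
(* for the opposites, and U for k = 1.                                         *)
Definition T0 i j (k : int) : nat * nat * int * seq nat := (i, j, k, [::]).
Definition T1 i j (k : int) a : nat * nat * int * seq nat := (i, j, k, [:: a]).
Definition T2 i j (k : int) a b : nat * nat * int * seq nat := (i, j, k, [:: a; b]).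
Arguments T0 _ _ k%_int_scope.
Arguments T1 _ _ k%_int_scope _.
Arguments T2 _ _ k%_int_scope _ _.
Definition N0 i j k := T0 i j (- k%:Z).
Definition N1 i j k a := T1 i j (- k%:Z) a.
Definition N2 i j k a b := T2 i j (- k%:Z) a b.

(* The equations -c_1, c_2, c_3, -c_4, -c_5 with c_k = gamma0 (u, v, e_k).     *)
(* In each of them the first term leads for the weights below, and the leading *)
(* monomials are pairwise coprime and prime to u_1.                            *)
Definition leading_system : seq pol := [::
  [:: (1, [:: 4; 12]); (-1, [:: 3; 13]); (-1, [:: 5; 11]); (1, [:: 6; 10])];
  [:: (1, [:: 6; 9]); (-1, [:: 2; 13]); (1, [:: 3; 12]); (-1, [:: 5; 10])];
  [:: (1, [:: 1; 13]); (1, [:: 3; 11]); (-1, [:: 4; 10]); (-1, [:: 6; 8])];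
  [:: (1, [:: 2; 11]); (1, [:: 0; 13]); (1, [:: 1; 12]); (-1, [:: 4; 9]); (-1, [:: 5; 8]); (-1, [:: 6; 7])];
  [:: (1, [:: 5; 7]); (-1, [:: 0; 12]); (-1, [:: 2; 10]); (1, [:: 3; 9])]].

Definition homotopy_1 : seq entries := [::
  [:: N0 0 0 8];
  [:: N1 1 1 4 12; N1 1 2 4 13; T1 1 9 4 5; T1 1 10 4 6; N1 2 1 4 11;
  N1 2 3 4 13; T1 2 9 4 4; T1 2 11 4 6; N1 3 0 4 13; T1 3 1 4 10; N1 3 2 4 11;
  T1 3 3 4 12; N1 3 4 2 13; T1 3 8 4 6; N1 3 9 4 3; T1 3 10 4 4; N1 3 11 4 5;
  T1 3 12 2 6; T1 4 0 4 12; T1 4 2 4 10; T1 4 4 2 12; N1 4 8 4 5; N1 4 10 4 3;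
  N1 4 12 2 5; N1 5 0 4 11; N1 5 3 4 10; N1 5 4 2 11; T1 5 8 4 4; T1 5 11 4 3;
  T1 5 12 2 4; T1 6 0 4 10; T1 6 1 2 7; T1 6 2 2 8; T1 6 3 2 9; N1 6 5 2 11;
  N1 6 6 2 12; N1 6 7 2 13; N1 6 8 4 3; N1 6 9 2 0; N1 6 10 2 1; N1 6 11 2 2;
  T1 6 13 2 4; T1 6 14 2 5; T1 6 15 2 6; T1 7 0 8 6; N1 7 1 8 3; N1 7 2 8 4;
  T1 7 3 8 5; T1 7 4 4 6; T1 8 0 4 13; N1 8 1 4 10; N1 8 2 4 11; T1 8 3 4 12;
  T1 8 4 2 13; T1 8 8 4 6; N1 8 9 4 3; N1 8 10 4 4; T1 8 11 4 5; T1 8 12 2 6;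
  T1 9 8 8 13; N1 9 9 8 10; N1 9 10 8 11; T1 9 11 8 12; T1 9 12 4 13];
  [:: T0 0 1 1; N0 4 1 2; N0 5 2 2; T0 6 3 2; N0 7 0 2; T0 7 4 1; T0 8 9 1;
  N0 12 9 2; N0 13 10 2; T0 14 11 2; N0 15 8 2; T0 15 12 1];
  [:: T1 0 0 2 3; T1 0 1 2 4; N1 0 2 2 5; N1 0 3 1 6; N1 0 7 2 13; T1 0 8 2 6;
  N1 1 0 2 6; T1 2 0 2 5; T1 3 0 2 4; T1 4 1 4 4; N1 4 2 4 5; N1 4 3 2 6;
  N1 4 7 4 13; T1 4 8 4 6; N1 5 0 2 2; N1 5 1 4 3; N1 5 3 2 5; N1 5 4 4 6;
  T1 5 7 4 12; N1 5 8 4 5; N1 6 0 2 1; T1 6 2 4 3; T1 6 3 2 4; N1 6 5 4 6;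
  N1 6 7 4 11; T1 6 8 4 4; T1 7 0 2 0; T1 7 3 2 3; T1 7 4 4 4; T1 7 5 4 5;
  T1 7 7 4 10; N1 7 8 4 3; T1 8 0 2 10; T1 8 1 2 11; N1 8 2 2 12; N1 8 3 1 13;
  N1 8 8 2 13; T1 8 9 2 6; N1 9 0 2 13; T1 10 0 2 12; T1 11 0 2 11;
  T1 12 1 4 11; N1 12 2 4 12; N1 12 3 2 13; N1 12 8 4 13; T1 12 9 4 6;
  N1 13 0 2 9; N1 13 1 4 10; N1 13 3 2 12; N1 13 4 4 13; T1 13 8 4 12;
  N1 13 9 4 5; N1 14 0 2 8; T1 14 2 4 10; T1 14 3 2 11; N1 14 5 4 13;
  N1 14 8 4 11; T1 14 9 4 4; T1 15 0 2 7; T1 15 3 2 10; T1 15 4 4 11;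
  T1 15 5 4 12; T1 15 8 4 10; N1 15 9 4 3];
  [:: N0 6 0 4]].

Definition homotopy_2 : seq entries := [::
  [:: T0 0 1 8];
  [:: N1 0 1 4 12; N1 0 2 4 13; T1 0 9 4 5; T1 0 10 4 6; N1 2 0 4 13;
  N1 2 1 4 10; T1 2 4 2 13; T1 2 8 4 6; T1 2 9 4 3; N1 2 12 2 6; T1 3 0 4 12;
  T1 3 1 4 9; N1 3 2 4 10; N1 3 4 2 12; T1 3 5 4 13; N1 3 8 4 5; N1 3 9 4 2;
  T1 3 10 4 3; T1 3 12 2 5; N1 3 13 4 6; T1 4 2 4 9; N1 4 5 4 12; N1 4 10 4 2;
  T1 4 13 4 5; N1 5 0 4 10; T1 5 1 2 7; T1 5 2 2 8; N1 5 3 2 9; T1 5 5 2 11;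
  N1 5 6 2 12; N1 5 7 2 13; T1 5 8 4 3; N1 5 9 2 0; N1 5 10 2 1; T1 5 11 2 2;
  N1 5 13 2 4; T1 5 14 2 5; T1 5 15 2 6; T1 6 0 4 9; N1 6 4 2 9; N1 6 5 4 10;
  N1 6 8 4 2; T1 6 12 2 2; T1 6 13 4 3; T1 7 0 8 5; N1 7 1 8 2; N1 7 2 8 3;
  N1 7 4 4 5; N1 7 5 8 6; T1 8 0 4 12; N1 8 1 4 9; N1 8 2 4 10; N1 8 4 2 12;
  N1 8 5 4 13; T1 8 8 4 5; N1 8 9 4 2; N1 8 10 4 3; N1 8 12 2 5; N1 8 13 4 6;
  T1 9 8 8 12; N1 9 9 8 9; N1 9 10 8 10; N1 9 12 4 12; N1 9 13 8 13];
  [:: N0 0 2 1; N0 3 1 2; N0 4 2 2; N0 6 0 2; N0 6 4 1; N0 7 5 2; N0 8 10 1;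
  N0 11 9 2; N0 12 10 2; N0 14 8 2; N0 14 12 1; N0 15 13 2];
  [:: T1 0 0 2 2; T1 0 1 2 3; T1 0 3 1 5; T1 0 4 2 6; N1 0 7 2 12; T1 0 8 2 5;
  T1 1 1 2 6; N1 2 1 2 5; T1 3 0 4 3; T1 3 1 2 4; N1 3 2 4 5; N1 3 3 2 6;
  N1 3 7 4 13; T1 3 8 4 6; N1 4 0 4 2; N1 4 3 2 5; N1 4 4 4 6; T1 4 7 4 12;
  N1 4 8 4 5; N1 5 1 2 2; T1 6 1 2 1; T1 6 2 4 2; T1 6 3 2 3; T1 6 6 4 6;
  N1 6 7 4 10; T1 6 8 4 3; N1 7 1 2 0; T1 7 3 2 2; T1 7 4 4 3; N1 7 6 4 5;
  T1 7 7 4 9; N1 7 8 4 2; T1 8 0 2 9; T1 8 1 2 10; T1 8 3 1 12; T1 8 4 2 13;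
  N1 8 8 2 12; T1 8 9 2 5; T1 9 1 2 13; N1 10 1 2 12; T1 11 0 4 10;
  T1 11 1 2 11; N1 11 2 4 12; N1 11 3 2 13; N1 11 8 4 13; T1 11 9 4 6;
  N1 12 0 4 9; N1 12 3 2 12; N1 12 4 4 13; T1 12 8 4 12; N1 12 9 4 5;
  N1 13 1 2 9; T1 14 1 2 8; T1 14 2 4 9; T1 14 3 2 10; T1 14 6 4 13;
  N1 14 8 4 10; T1 14 9 4 3; N1 15 1 2 7; T1 15 3 2 9; T1 15 4 4 10;
  N1 15 6 4 12; T1 15 8 4 9; N1 15 9 4 2];
  [:: N0 5 0 4]].

Definition homotopy_3 : seq entries := [::
  [:: T0 0 2 8];
  [:: N1 0 1 4 11; N1 0 3 4 13; T1 0 9 4 4; T1 0 11 4 6; T1 1 0 4 13;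
  T1 1 1 4 10; N1 1 4 2 13; N1 1 8 4 6; N1 1 9 4 3; T1 1 12 2 6; T1 3 0 4 11;
  N1 3 1 4 8; N1 3 3 4 10; N1 3 4 2 11; N1 3 6 4 13; N1 3 8 4 4; T1 3 9 4 1;
  T1 3 11 4 3; T1 3 12 2 4; T1 3 14 4 6; N1 4 0 4 10; T1 4 1 2 7; N1 4 2 2 8;
  T1 4 3 2 9; N1 4 5 2 11; T1 4 6 2 12; N1 4 7 2 13; T1 4 8 4 3; N1 4 9 2 0;
  T1 4 10 2 1; N1 4 11 2 2; T1 4 13 2 4; N1 4 14 2 5; T1 4 15 2 6; T1 5 3 4 8;
  N1 5 6 4 11; N1 5 11 4 1; T1 5 14 4 4; N1 6 0 4 8; T1 6 4 2 8; T1 6 6 4 10;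
  T1 6 8 4 1; N1 6 12 2 1; N1 6 14 4 3; T1 7 0 8 4; T1 7 1 8 1; N1 7 3 8 3;
  N1 7 4 4 4; T1 7 6 8 6; T1 8 0 4 11; T1 8 1 4 8; N1 8 3 4 10; N1 8 4 2 11;
  T1 8 6 4 13; T1 8 8 4 4; T1 8 9 4 1; N1 8 11 4 3; N1 8 12 2 4; T1 8 14 4 6;
  T1 9 8 8 11; T1 9 9 8 8; N1 9 11 8 10; N1 9 12 4 11; T1 9 14 8 13];
  [:: N0 0 3 1; T0 2 1 2; N0 4 3 2; N0 5 0 2; N0 5 4 1; T0 7 6 2; N0 8 11 1;
  T0 10 9 2; N0 12 11 2; N0 13 8 2; N0 13 12 1; T0 15 14 2];
  [:: N1 0 0 2 1; T1 0 2 2 3; T1 0 3 1 4; N1 0 5 2 6; N1 0 7 2 11; T1 0 8 2 4;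
  T1 1 2 2 6; N1 2 0 4 3; N1 2 1 4 4; T1 2 2 2 5; T1 2 3 2 6; T1 2 7 4 13;
  N1 2 8 4 6; N1 3 2 2 4; T1 4 0 4 1; N1 4 3 2 4; T1 4 5 4 6; T1 4 7 4 11;
  N1 4 8 4 4; T1 5 1 4 1; T1 5 2 2 2; T1 5 3 2 3; T1 5 6 4 6; N1 5 7 4 10;
  T1 5 8 4 3; N1 6 2 2 1; N1 7 2 2 0; N1 7 3 2 1; N1 7 5 4 3; N1 7 6 4 4;
  N1 7 7 4 8; T1 7 8 4 1; N1 8 0 2 8; T1 8 2 2 10; T1 8 3 1 11; N1 8 5 2 13;
  N1 8 8 2 11; T1 8 9 2 4; T1 9 2 2 13; N1 10 0 4 10; N1 10 1 4 11;
  T1 10 2 2 12; T1 10 3 2 13; T1 10 8 4 13; N1 10 9 4 6; N1 11 2 2 11;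
  T1 12 0 4 8; N1 12 3 2 11; T1 12 5 4 13; T1 12 8 4 11; N1 12 9 4 4;
  T1 13 1 4 8; T1 13 2 2 9; T1 13 3 2 10; T1 13 6 4 13; N1 13 8 4 10;
  T1 13 9 4 3; N1 14 2 2 8; N1 15 2 2 7; N1 15 3 2 8; N1 15 5 4 10;
  N1 15 6 4 11; N1 15 8 4 8; T1 15 9 4 1];
  [:: N0 4 0 4]].

Definition homotopy_4 : seq entries := [::
  [:: N0 0 3 8];
  [:: T1 0 0 4 13; N1 0 1 4 10; T1 0 2 4 11; N1 0 3 4 12; T1 0 4 2 13;
  N1 0 8 4 6; T1 0 9 4 3; N1 0 10 4 4; T1 0 11 4 5; N1 0 12 2 6; T1 1 0 4 12;
  T1 1 1 4 9; N1 1 2 4 10; N1 1 4 2 12; T1 1 5 4 13; N1 1 8 4 5; N1 1 9 4 2;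
  T1 1 10 4 3; T1 1 12 2 5; N1 1 13 4 6; T1 2 0 4 11; N1 2 1 4 8; N1 2 3 4 10;
  N1 2 4 2 11; N1 2 6 4 13; N1 2 8 4 4; T1 2 9 4 1; T1 2 11 4 3; T1 2 12 2 4;
  T1 2 14 4 6; N1 4 0 4 9; N1 4 2 4 7; N1 4 4 2 9; N1 4 5 4 10; N1 4 7 4 12;
  T1 4 8 4 2; T1 4 10 4 0; T1 4 12 2 2; T1 4 13 4 3; T1 4 15 4 5; N1 5 0 4 8;
  T1 5 3 4 7; N1 5 4 2 8; N1 5 6 4 10; T1 5 7 4 11; T1 5 8 4 1; N1 5 11 4 0;
  T1 5 12 2 1; T1 5 14 4 3; N1 5 15 4 4; N1 6 0 4 7; T1 6 4 2 7; N1 6 5 4 8;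
  T1 6 6 4 9; N1 6 7 4 10; T1 6 8 4 0; N1 6 12 2 0; T1 6 13 4 1; N1 6 14 4 2;
  T1 6 15 4 3; T1 7 0 16 3; T1 7 1 8 0; N1 7 2 8 1; N1 7 3 8 2; T1 7 5 8 4;
  T1 7 6 8 5; N1 7 7 8 6; T1 8 0 8 10; T1 8 1 4 7; N1 8 2 4 8; N1 8 3 4 9;
  T1 8 5 4 11; T1 8 6 4 12; N1 8 7 4 13; T1 8 8 8 3; T1 8 9 4 0; N1 8 10 4 1;
  N1 8 11 4 2; T1 8 13 4 4; T1 8 14 4 5; N1 8 15 4 6; T1 9 8 16 10; T1 9 9 8 7;
  N1 9 10 8 8; N1 9 11 8 9; T1 9 13 8 11; T1 9 14 8 12; N1 9 15 8 13];
  [:: T0 0 4 1; T0 1 1 2; N0 2 2 2; N0 3 3 2; N0 4 0 4; T0 5 5 2; T0 6 6 2;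
  N0 7 7 2; T0 8 12 1; T0 9 9 2; N0 10 10 2; N0 11 11 2; N0 12 8 4; T0 13 13 2;
  T0 14 14 2; N0 15 15 2];
  [:: N1 0 0 2 0; T1 0 1 2 1; T1 0 2 2 2; N1 0 4 2 4; N1 0 5 2 5; T1 0 6 2 6;
  N1 0 7 4 10; T1 0 8 4 3; N1 1 0 4 3; N1 1 1 4 4; T1 1 2 4 5; T1 1 7 4 13;
  N1 1 8 4 6; N1 2 0 4 2; N1 2 1 4 3; N1 2 4 4 6; T1 2 7 4 12; N1 2 8 4 5;
  T1 3 0 4 1; N1 3 2 4 3; T1 3 5 4 6; T1 3 7 4 11; N1 3 8 4 4; T1 4 0 4 0;
  T1 4 1 4 1; T1 4 2 4 2; T1 4 4 4 4; T1 4 5 4 5; T1 4 6 4 6; T1 5 1 4 0;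
  N1 5 4 4 3; T1 5 6 4 5; N1 5 7 4 9; T1 5 8 4 2; N1 6 2 4 0; N1 6 5 4 3;
  N1 6 6 4 4; N1 6 7 4 8; T1 6 8 4 1; T1 7 4 4 1; N1 7 5 4 2; N1 7 6 4 3;
  N1 7 7 4 7; T1 7 8 4 0; N1 8 0 2 7; T1 8 1 2 8; T1 8 2 2 9; N1 8 4 2 11;
  N1 8 5 2 12; T1 8 6 2 13; N1 8 8 4 10; T1 8 9 4 3; N1 9 0 4 10; N1 9 1 4 11;
  T1 9 2 4 12; T1 9 8 4 13; N1 9 9 4 6; N1 10 0 4 9; N1 10 1 4 10; N1 10 4 4 13;
  T1 10 8 4 12; N1 10 9 4 5; T1 11 0 4 8; N1 11 2 4 10; T1 11 5 4 13;
  T1 11 8 4 11; N1 11 9 4 4; T1 12 0 4 7; T1 12 1 4 8; T1 12 2 4 9;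
  T1 12 4 4 11; T1 12 5 4 12; T1 12 6 4 13; T1 13 1 4 7; N1 13 4 4 10;
  T1 13 6 4 12; N1 13 8 4 9; T1 13 9 4 2; N1 14 2 4 7; N1 14 5 4 10;
  N1 14 6 4 11; N1 14 8 4 8; T1 14 9 4 1; T1 15 4 4 8; N1 15 5 4 9;
  N1 15 6 4 10; N1 15 8 4 7; T1 15 9 4 0];
  [:: N0 3 0 8]].

Definition homotopy_5 : seq entries := [::
  [:: N0 0 4 8];
  [:: N1 0 0 4 12; N1 0 2 4 10; N1 0 4 2 12; T1 0 8 4 5; T1 0 10 4 3;
  T1 0 12 2 5; T1 1 2 4 9; N1 1 5 4 12; N1 1 10 4 2; T1 1 13 4 5; N1 2 0 4 10;
  T1 2 1 2 7; N1 2 2 2 8; T1 2 3 2 9; N1 2 5 2 11; T1 2 6 2 12; N1 2 7 2 13;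
  T1 2 8 4 3; N1 2 9 2 0; T1 2 10 2 1; N1 2 11 2 2; T1 2 13 2 4; N1 2 14 2 5;
  T1 2 15 2 6; T1 3 0 4 9; T1 3 2 4 7; T1 3 4 2 9; T1 3 5 4 10; T1 3 7 4 12;
  N1 3 8 4 2; N1 3 10 4 0; N1 3 12 2 2; N1 3 13 4 3; N1 3 15 4 5; T1 5 0 4 7;
  T1 5 4 2 7; N1 5 7 4 10; N1 5 8 4 0; N1 5 12 2 0; T1 5 15 4 3; T1 6 5 4 7;
  T1 6 7 4 9; N1 6 13 4 0; N1 6 15 4 2; N1 7 0 8 2; T1 7 2 8 0; N1 7 4 4 2;
  N1 7 5 8 3; T1 7 7 8 5; N1 8 0 4 9; T1 8 2 4 7; N1 8 4 2 9; N1 8 5 4 10;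
  T1 8 7 4 12; N1 8 8 4 2; T1 8 10 4 0; N1 8 12 2 2; N1 8 13 4 3; T1 8 15 4 5;
  N1 9 8 8 9; T1 9 10 8 7; N1 9 12 4 9; N1 9 13 8 10; T1 9 15 8 12];
  [:: T0 0 5 1; T0 1 2 2; T0 3 0 2; N0 3 4 1; N0 4 5 2; T0 6 7 2; T0 8 13 1;
  T0 9 10 2; T0 11 8 2; N0 11 12 1; N0 12 13 2; T0 14 15 2];
  [:: N1 0 1 2 0; T1 0 3 1 2; T1 0 4 2 3; N1 0 6 2 5; T1 0 7 2 9; N1 0 8 2 2;
  T1 1 0 4 2; T1 1 1 4 3; T1 1 3 2 5; T1 1 4 2 6; N1 1 7 4 12; T1 1 8 4 5;
  T1 2 4 2 5; N1 3 0 4 0; N1 3 3 2 3; N1 3 4 2 4; N1 3 5 4 5; N1 3 7 4 10;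
  T1 3 8 4 3; N1 4 1 4 0; T1 4 3 2 2; N1 4 6 4 5; T1 4 7 4 9; N1 4 8 4 2;
  T1 5 4 2 2; N1 6 3 2 0; N1 6 4 2 1; T1 6 5 4 2; T1 6 6 4 3; T1 6 7 4 7;
  N1 6 8 4 0; N1 7 4 2 0; N1 8 1 2 7; T1 8 3 1 9; T1 8 4 2 10; N1 8 6 2 12;
  T1 8 8 2 9; N1 8 9 2 2; T1 9 0 4 9; T1 9 1 4 10; T1 9 3 2 12; T1 9 4 2 13;
  N1 9 8 4 12; T1 9 9 4 5; T1 10 4 2 12; N1 11 0 4 7; N1 11 3 2 10;
  N1 11 4 2 11; N1 11 5 4 12; N1 11 8 4 10; T1 11 9 4 3; N1 12 1 4 7;
  T1 12 3 2 9; N1 12 6 4 12; T1 12 8 4 9; N1 12 9 4 2; T1 13 4 2 9; N1 14 3 2 7;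
  N1 14 4 2 8; T1 14 5 4 9; T1 14 6 4 10; T1 14 8 4 7; N1 14 9 4 0;
  N1 15 4 2 7];
  [:: T0 2 0 4]].

Definition leading_weights : seq nat :=
  [:: 2; 6; 7; 0; 6; 2; 5; 6; 1; 6; 0; 7; 5; 3]%N.

(* Null homotopies of 8 times the equations of leading_system.                 *)
Definition homotopy_tables : seq (seq (seq (seq pol))) := Eval vm_compute in
  [seq [seq tabulate 16 16 (sparse_mx s) | s <- h]
     | h <- [:: homotopy_1; homotopy_2; homotopy_3; homotopy_4; homotopy_5]].

Definition resolution_homotopy (j i : nat) : pmx :=
  ptab (nth [::] (nth [::] homotopy_tables j) i).

Lemma leading_system_lead :
  all (plead leading_weights) ([:: (1, [:: 0%N])] :: leading_system).
Proof. by vm_compute. Qed.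

Lemma leading_system_coprime :
  pairwise pcoprime ([:: (1, [:: 0%N])] :: leading_system).
Proof. by vm_compute. Qed.

Lemma resolution_complex :
  pcheck_complex resolution_rank resolution_diff 0.
Proof. by vm_compute. Qed.

Lemma resolution_degrees :
  pcheck_degrees resolution_rank resolution_deg resolution_diff.
Proof. by vm_compute. Qed.

Lemma resolution_homotopyP :
  pcheck_homotopy resolution_rank resolution_diff 0 8 leading_system
    resolution_homotopy.
Proof. by vm_compute. Qed.

(** * The resolution in characteristic 2 *)

Definition U0 i j := T0 i j 1.
Definition U1 i j a := T1 i j 1 a.
Definition U2 i j a b := T2 i j 1 a b.

(* u_7 v_1 - u_2 v_6 - u_3 v_5 + u_4 v_4; up to gamma0 (u, v, e_4) it is half  *)
(* of the polar form of q0, and in characteristic 2 it replaces the latter.    *)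
Definition half_polar : pol :=
  [:: (1, [:: 6; 7]); (-1, [:: 1; 12]); (-1, [:: 2; 11]); (1, [:: 3; 10])].

Definition pq (x : nat) : pol :=
  [:: (1, [:: x; x + 6]%N); (-1, [:: x + 1; x + 5]%N);
      (-1, [:: x + 2; x + 4]%N); (1, [:: x + 3; x + 3]%N)].

(** In order: the seven c_k, q0 (u), q0 (v) and half of the polar form modulo c_4. They define the
    variety in every characteristic; when 2 is invertible they generate the same ideal as
    [table1]. *)
Definition quadrics2 : pmx := fun i _ =>
  nth [::] ([seq ptab table1 k 0%N | k <- iota 0 7]
            ++ [:: pq 0; pq 7; half_polar]) i.

Definition sparse2_2 : entries := [::
  U1 0 0 10; U1 0 1 11; U1 0 2 12; U1 0 8 6; U1 0 9 13; U1 1 0 9; U1 1 1 10;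
  U1 1 3 12; U1 1 4 13; U1 1 8 5; U1 1 9 12; U1 2 0 8; U1 2 2 10; U1 2 3 11;
  U1 2 5 13; U1 2 8 4; U1 2 9 11; U1 3 0 7; U1 3 4 11; U1 3 5 12; U1 3 8 3;
  U1 3 9 10; U1 4 0 7; U1 4 1 8; U1 4 2 9; U1 4 3 10; U1 4 4 11; U1 4 5 12;
  U1 4 6 13; U1 5 1 7; U1 5 4 10; U1 5 6 12; U1 5 8 2; U1 5 9 9; U1 6 2 7;
  U1 6 5 10; U1 6 6 11; U1 6 8 1; U1 6 9 8; U1 7 3 7; U1 7 4 8; U1 7 5 9;
  U1 7 6 10; U1 7 8 0; U1 7 9 7; U1 8 0 3; U1 8 1 4; U1 8 2 5; U1 8 3 6;
  U1 8 7 13; U1 8 9 6; U1 9 0 2; U1 9 1 3; U1 9 4 6; U1 9 7 12; U1 9 9 5;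
  U1 10 0 1; U1 10 2 3; U1 10 5 6; U1 10 7 11; U1 10 9 4; U1 11 0 0; U1 11 3 3;
  U1 11 4 4; U1 11 5 5; U1 11 7 10; U1 11 9 3; U1 12 0 0; U1 12 1 1; U1 12 2 2;
  U1 12 3 3; U1 12 4 4; U1 12 5 5; U1 12 6 6; U1 13 1 0; U1 13 3 2; U1 13 4 3;
  U1 13 6 5; U1 13 7 9; U1 13 9 2; U1 14 2 0; U1 14 3 1; U1 14 5 3; U1 14 6 4;
  U1 14 7 8; U1 14 9 1; U1 15 4 1; U1 15 5 2; U1 15 6 3; U1 15 7 7; U1 15 9 0;
  U2 16 2 0 12; U2 16 2 2 10; U2 16 2 3 9; U2 16 2 5 7; U2 16 4 1 13;
  U2 16 4 3 11; U2 16 4 4 10; U2 16 4 6 8].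

Definition sparse2_3 : entries := [::
  U1 0 0 0; U1 0 1 1; U1 0 2 2; U1 0 4 3; U1 0 5 4; U1 0 6 5; U1 0 7 6;
  U1 0 8 7; U1 0 9 8; U1 0 10 9; U1 0 12 10; U1 0 13 11; U1 0 14 12; U1 0 15 13;
  U2 1 0 3 10; U2 1 0 4 9; U2 1 0 5 8; U2 1 1 1 13; U2 1 1 3 11; U2 1 1 4 10;
  U2 1 1 6 8; U2 1 2 3 12; U2 1 2 5 10; U2 1 2 6 9; U2 1 3 4 12; U2 1 3 5 11;
  U2 1 3 6 10; U2 1 4 4 12; U2 1 4 5 11; U2 1 4 6 10; U2 1 6 5 13; U2 1 8 8 12;
  U2 1 8 9 11; U2 1 8 10 10; U2 1 10 9 13; U2 1 11 10 13; U2 1 12 10 13;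
  U2 1 14 12 13; U1 1 16 13; U2 2 0 2 10; U2 2 0 3 9; U2 2 0 5 7; U2 2 1 1 12;
  U2 2 1 2 11; U2 2 1 3 10; U2 2 1 6 7; U2 2 2 2 12; U2 2 3 2 13; U2 2 3 5 10;
  U2 2 3 6 9; U2 2 4 3 12; U2 2 5 3 13; U2 2 5 4 12; U2 2 5 5 11; U2 2 5 6 10;
  U2 2 6 5 12; U2 2 8 7 12; U2 2 9 7 13; U2 2 9 8 12; U2 2 9 9 11; U2 2 9 10 10;
  U2 2 10 9 12; U2 2 11 10 12; U2 2 12 10 12; U2 2 14 12 12; U1 2 16 12;
  U2 3 0 1 10; U2 3 0 3 8; U2 3 0 4 7; U2 3 2 1 12; U2 3 2 3 10; U2 3 2 6 7;
  U2 3 3 1 13; U2 3 3 4 10; U2 3 3 6 8; U2 3 4 3 11; U2 3 6 3 13; U2 3 6 4 12;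
  U2 3 6 6 10; U2 3 8 7 11; U2 3 10 7 13; U2 3 10 8 12; U2 3 10 10 10;
  U2 3 11 10 11; U2 3 12 10 11; U2 3 14 11 12; U1 3 16 11; U2 4 0 1 9;
  U2 4 0 2 8; U2 4 0 3 7; U2 4 2 2 10; U2 4 3 1 12; U2 4 3 2 11; U2 4 3 6 7;
  U2 4 4 1 12; U2 4 4 2 11; U2 4 4 6 7; U2 4 5 1 13; U2 4 5 3 11; U2 4 5 4 10;
  U2 4 5 6 8; U2 4 6 2 13; U2 4 6 3 12; U2 4 6 6 9; U2 4 8 7 10; U2 4 10 9 10;
  U2 4 11 7 13; U2 4 11 8 12; U2 4 11 9 11; U2 4 12 7 13; U2 4 12 8 12;
  U2 4 12 9 11; U2 4 14 10 12; U1 4 16 10; U2 5 0 1 9; U2 5 0 2 8; U2 5 0 3 7;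
  U2 5 1 0 11; U2 5 1 3 8; U2 5 1 4 7; U2 5 2 0 12; U2 5 2 3 9; U2 5 2 5 7;
  U2 5 3 0 13; U2 5 3 1 12; U2 5 3 2 11; U2 5 3 4 9; U2 5 3 5 8; U2 5 3 6 7;
  U2 5 4 1 12; U2 5 4 2 11; U2 5 4 6 7; U2 5 5 1 13; U2 5 5 3 11; U2 5 5 6 8;
  U2 5 6 2 13; U2 5 6 3 12; U2 5 6 6 9; U2 5 7 3 13; U2 5 7 4 12; U2 5 7 5 11;
  U2 5 8 7 10; U2 5 9 8 10; U2 5 10 9 10; U2 5 12 7 13; U2 5 12 8 12;
  U2 5 12 9 11; U2 5 13 10 11; U2 5 14 10 12; U2 5 15 10 13; U2 6 0 0 9;
  U2 6 1 0 10; U2 6 1 1 9; U2 6 1 2 8; U2 6 1 3 7; U2 6 2 2 9; U2 6 3 0 12;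
  U2 6 3 2 10; U2 6 3 5 7; U2 6 4 0 12; U2 6 4 2 10; U2 6 4 5 7; U2 6 5 0 13;
  U2 6 5 3 10; U2 6 5 4 9; U2 6 5 5 8; U2 6 6 5 9; U2 6 7 2 13; U2 6 7 3 12;
  U2 6 7 5 10; U2 6 7 6 9; U2 6 8 7 9; U2 6 10 9 9; U2 6 11 9 10; U2 6 12 9 10;
  U2 6 13 7 13; U2 6 13 8 12; U2 6 13 9 11; U2 6 13 10 10; U2 6 14 9 12;
  U1 6 16 9; U2 7 0 0 8; U2 7 2 0 10; U2 7 2 1 9; U2 7 2 3 7; U2 7 3 0 11;
  U2 7 3 1 10; U2 7 3 4 7; U2 7 4 0 11; U2 7 4 1 10; U2 7 4 4 7; U2 7 6 0 13;
  U2 7 6 3 10; U2 7 6 4 9; U2 7 7 1 13; U2 7 7 3 11; U2 7 7 4 10; U2 7 7 6 8;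
  U2 7 8 7 8; U2 7 10 8 9; U2 7 11 8 10; U2 7 12 8 10; U2 7 14 7 13;
  U2 7 14 9 11; U2 7 14 10 10; U1 7 16 8; U2 8 1 1 7; U2 8 3 0 10; U2 8 3 1 9;
  U2 8 3 2 8; U2 8 5 0 11; U2 8 5 1 10; U2 8 5 3 8; U2 8 6 0 12; U2 8 6 2 10;
  U2 8 6 3 9; U2 8 6 5 7; U2 8 7 1 12; U2 8 7 2 11; U2 8 7 3 10; U2 8 9 7 8;
  U2 8 11 7 10; U2 8 13 7 11; U2 8 15 8 12; U2 8 15 9 11; U2 8 15 10 10;
  U1 8 16 7; U2 9 0 1 5; U2 9 0 2 4; U2 9 0 3 3; U2 9 2 2 6; U2 9 3 3 6;
  U2 9 4 3 6; U2 9 6 5 6; U2 9 8 1 12; U2 9 8 2 11; U2 9 8 3 10; U2 9 9 1 13;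
  U2 9 9 3 11; U2 9 9 4 10; U2 9 9 6 8; U2 9 10 2 13; U2 9 10 3 12;
  U2 9 10 5 10; U2 9 11 3 13; U2 9 11 4 12; U2 9 11 5 11; U2 9 12 3 13;
  U2 9 12 4 12; U2 9 12 5 11; U2 9 14 6 12; U1 9 16 6; U2 10 0 0 5; U2 10 1 0 6;
  U2 10 1 1 5; U2 10 1 2 4; U2 10 1 3 3; U2 10 2 2 5; U2 10 3 3 5; U2 10 4 3 5;
  U2 10 6 5 5; U2 10 8 0 12; U2 10 8 2 10; U2 10 8 3 9; U2 10 9 0 13;
  U2 10 9 3 10; U2 10 9 4 9; U2 10 9 5 8; U2 10 10 5 9; U2 10 11 2 13;
  U2 10 11 3 12; U2 10 11 6 9; U2 10 12 5 10; U2 10 13 3 13; U2 10 13 4 12;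
  U2 10 13 5 11; U2 10 13 6 10; U2 10 14 5 12; U1 10 16 5; U2 11 0 0 4;
  U2 11 2 0 6; U2 11 2 1 5; U2 11 2 3 3; U2 11 3 3 4; U2 11 4 3 4; U2 11 6 4 5;
  U2 11 8 0 11; U2 11 8 1 10; U2 11 8 3 8; U2 11 10 0 13; U2 11 10 3 10;
  U2 11 10 5 8; U2 11 11 1 13; U2 11 11 3 11; U2 11 11 6 8; U2 11 12 4 10;
  U2 11 14 3 13; U2 11 14 5 11; U2 11 14 6 10; U1 11 16 4; U2 12 0 0 3;
  U2 12 2 2 3; U2 12 3 0 6; U2 12 3 1 5; U2 12 3 2 4; U2 12 4 0 6; U2 12 4 1 5;
  U2 12 4 2 4; U2 12 6 3 5; U2 12 8 0 10; U2 12 8 1 9; U2 12 8 2 8;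
  U2 12 10 3 9; U2 12 11 0 13; U2 12 11 4 9; U2 12 11 5 8; U2 12 12 0 13;
  U2 12 12 4 9; U2 12 12 5 8; U2 12 13 1 13; U2 12 13 3 11; U2 12 13 4 10;
  U2 12 13 6 8; U2 12 14 2 13; U2 12 14 5 10; U2 12 14 6 9; U1 12 16 3;
  U2 13 0 0 3; U2 13 1 1 3; U2 13 2 2 3; U2 13 4 0 6; U2 13 4 1 5; U2 13 4 2 4;
  U2 13 5 3 4; U2 13 6 3 5; U2 13 7 3 6; U2 13 8 0 10; U2 13 8 1 9; U2 13 8 2 8;
  U2 13 9 0 11; U2 13 9 1 10; U2 13 9 4 7; U2 13 10 0 12; U2 13 10 2 10;
  U2 13 10 5 7; U2 13 11 0 13; U2 13 11 1 12; U2 13 11 2 11; U2 13 11 4 9;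
  U2 13 11 5 8; U2 13 11 6 7; U2 13 12 0 13; U2 13 12 4 9; U2 13 12 5 8;
  U2 13 13 1 13; U2 13 13 4 10; U2 13 13 6 8; U2 13 14 2 13; U2 13 14 5 10;
  U2 13 14 6 9; U2 13 15 4 12; U2 13 15 5 11; U2 13 15 6 10; U2 14 1 1 2;
  U2 14 3 2 3; U2 14 5 0 6; U2 14 5 1 5; U2 14 5 3 3; U2 14 7 2 6; U2 14 9 0 10;
  U2 14 9 1 9; U2 14 9 3 7; U2 14 11 0 12; U2 14 11 3 9; U2 14 11 5 7;
  U2 14 12 0 12; U2 14 12 2 10; U2 14 12 3 9; U2 14 12 5 7; U2 14 13 1 12;
  U2 14 13 3 10; U2 14 13 6 7; U2 14 15 3 12; U2 14 15 5 10; U2 14 15 6 9;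
  U1 14 16 2; U2 15 1 1 1; U2 15 3 1 3; U2 15 5 1 4; U2 15 6 0 6; U2 15 6 1 5;
  U2 15 6 2 4; U2 15 6 3 3; U2 15 7 1 6; U2 15 9 1 8; U2 15 10 0 10;
  U2 15 10 1 9; U2 15 10 2 8; U2 15 10 3 7; U2 15 11 0 11; U2 15 11 3 8;
  U2 15 11 4 7; U2 15 12 0 11; U2 15 12 1 10; U2 15 12 3 8; U2 15 12 4 7;
  U2 15 13 1 11; U2 15 14 1 12; U2 15 14 2 11; U2 15 14 3 10; U2 15 14 6 7;
  U2 15 15 3 11; U2 15 15 4 10; U2 15 15 6 8; U1 15 16 1; U2 16 1 0 1;
  U2 16 3 0 3; U2 16 5 0 4; U2 16 7 1 5; U2 16 7 2 4; U2 16 7 3 3; U2 16 9 0 8;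
  U2 16 11 1 9; U2 16 11 2 8; U2 16 11 3 7; U2 16 13 1 10; U2 16 13 3 8;
  U2 16 13 4 7; U2 16 14 0 12; U2 16 14 2 10; U2 16 14 3 9; U2 16 14 5 7;
  U2 16 15 3 10; U2 16 15 4 9; U2 16 15 5 8; U1 16 16 0].

Definition sparse2_4 : entries := [::
  U2 0 0 8 12; U2 0 0 9 11; U1 0 1 7; U1 0 2 8; U1 0 3 9; U1 0 5 10; U1 0 6 11;
  U1 0 7 12; U1 0 8 13; U2 1 0 4 12; U2 1 0 5 11; U1 1 1 3; U1 1 2 4; U1 1 3 5;
  U1 1 4 6; U1 1 5 6; U1 1 9 10; U1 1 10 11; U1 1 11 12; U1 1 12 13; U1 1 13 13;
  U2 2 0 3 12; U2 2 0 5 10; U2 2 0 6 9; U1 2 1 2; U1 2 2 3; U1 2 4 5; U1 2 6 6;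
  U1 2 9 9; U1 2 10 10; U1 2 12 12; U1 2 14 13; U2 3 0 3 11; U2 3 0 4 10;
  U2 3 0 6 8; U1 3 1 1; U1 3 3 3; U1 3 4 4; U1 3 7 6; U1 3 9 8; U1 3 11 10;
  U1 3 12 11; U1 3 15 13; U1 4 2 1; U1 4 3 2; U1 4 4 3; U1 4 8 6; U1 4 9 7;
  U1 4 12 10; U1 4 13 10; U1 4 14 11; U1 4 15 12; U2 5 0 4 9; U2 5 0 5 8;
  U1 5 1 0; U1 5 4 3; U1 5 5 3; U1 5 6 4; U1 5 7 5; U1 5 10 8; U1 5 11 9;
  U1 5 12 10; U1 5 16 13; U2 6 0 2 10; U1 6 2 0; U1 6 4 2; U1 6 5 2; U1 6 6 3;
  U1 6 8 5; U1 6 10 7; U1 6 12 9; U1 6 13 9; U1 6 14 10; U1 6 16 12;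
  U2 7 0 1 10; U1 7 3 0; U1 7 4 1; U1 7 5 1; U1 7 7 3; U1 7 8 4; U1 7 11 7;
  U1 7 12 8; U1 7 13 8; U1 7 15 10; U1 7 16 11; U1 8 4 0; U1 8 6 1; U1 8 7 2;
  U1 8 8 3; U1 8 12 7; U1 8 14 8; U1 8 15 9; U1 8 16 10; U1 9 9 0; U1 9 10 1;
  U1 9 11 2; U1 9 13 3; U1 9 14 4; U1 9 15 5; U1 9 16 6].

Definition sparse2_5 : entries := [::
  U2 0 0 0 6; U2 0 0 1 5; U2 0 0 2 4; U2 0 0 3 3; U2 0 1 0 10; U2 0 1 1 9;
  U2 0 1 2 8; U2 0 1 3 7; U2 0 2 0 11; U2 0 2 1 10; U2 0 2 3 8; U2 0 2 4 7;
  U2 0 3 0 12; U2 0 3 2 10; U2 0 3 3 9; U2 0 3 5 7; U2 0 4 0 13; U2 0 4 3 10;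
  U2 0 4 4 9; U2 0 4 5 8; U2 0 5 1 12; U2 0 5 2 11; U2 0 5 3 10; U2 0 5 6 7;
  U2 0 6 1 13; U2 0 6 3 11; U2 0 6 4 10; U2 0 6 6 8; U2 0 7 2 13; U2 0 7 3 12;
  U2 0 7 5 10; U2 0 7 6 9; U2 0 8 3 13; U2 0 8 4 12; U2 0 8 5 11; U2 0 8 6 10;
  U2 0 9 7 13; U2 0 9 8 12; U2 0 9 9 11; U2 0 9 10 10].

Definition homotopy2_1 : seq entries := [::
  [::
    U0 0 0];
  [:: U1 1 0 5; U1 1 1 6; U1 1 8 12; U1 1 9 13; U1 2 0 4; U1 2 2 6; U1 2 8 11;
  U1 2 10 13; U1 3 0 3; U1 3 1 4; U1 3 2 5; U1 3 3 6; U1 3 8 10; U1 3 9 11;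
  U1 3 10 12; U1 3 11 13; U1 4 1 3; U1 4 3 5; U1 4 9 10; U1 4 11 12; U1 5 2 3;
  U1 5 3 4; U1 5 10 10; U1 5 11 11; U1 6 1 1; U1 6 4 3; U1 6 6 5; U1 6 9 8;
  U1 6 12 10; U1 6 14 12; U0 6 16; U1 7 8 3; U1 7 9 4; U1 7 10 5; U1 7 11 6;
  U1 8 0 10; U1 8 1 11; U1 8 2 12; U1 8 3 13; U1 9 0 3; U1 9 3 6; U1 9 9 11;
  U1 9 10 12];
  [:: U0 4 1; U0 5 2; U0 6 3; U1 7 0 10; U0 7 4; U0 7 5; U0 12 9; U0 13 10;
  U0 14 11; U1 15 0 3; U0 15 12; U0 15 13; U1 16 1 3; U1 16 3 5; U1 16 9 10;
  U1 16 11 12];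
  [:: U0 0 1; U1 4 0 6; U1 4 1 10; U1 4 2 11; U1 4 3 12; U1 4 4 13; U1 5 0 6;
  U1 5 2 11; U1 5 3 12; U1 5 4 13; U1 6 0 5; U1 6 1 9; U1 6 2 10; U1 6 5 12;
  U1 6 6 13; U1 7 0 4; U1 7 1 8; U1 7 3 10; U1 7 5 11; U1 7 7 13; U1 8 0 3;
  U1 8 4 10; U1 8 6 11; U1 8 7 12; U1 12 1 3; U1 12 2 4; U1 12 3 5; U1 12 5 6;
  U1 12 9 13; U1 13 2 4; U1 13 3 5; U1 13 5 6; U1 13 9 13; U1 14 2 3; U1 14 4 5;
  U1 14 6 6; U1 14 9 12; U1 15 3 3; U1 15 4 4; U1 15 7 6; U1 15 9 11; U1 16 5 3;
  U1 16 6 4; U1 16 7 5; U1 16 9 10];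
  [::
    U0 8 0]].

Definition homotopy2_2 : seq entries := [::
  [::
    U0 0 1];
  [:: U1 0 0 5; U1 0 1 6; U1 0 8 12; U1 0 9 13; U1 2 0 3; U1 2 3 6; U1 2 4 6;
  U1 2 8 10; U1 2 11 13; U1 2 12 13; U1 3 0 2; U1 3 1 3; U1 3 3 5; U1 3 4 5;
  U1 3 5 6; U1 3 8 9; U1 3 9 10; U1 3 11 12; U1 3 12 12; U1 3 13 13; U1 4 1 2;
  U1 4 5 5; U1 4 9 9; U1 4 13 12; U1 5 1 1; U1 5 2 2; U1 5 5 4; U1 5 6 5;
  U1 5 9 8; U1 5 10 9; U1 5 13 11; U1 5 14 12; U0 5 16; U1 6 3 2; U1 6 4 2;
  U1 6 5 3; U1 6 11 9; U1 6 12 9; U1 6 13 10; U1 7 8 2; U1 7 9 3; U1 7 11 5;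
  U1 7 12 5; U1 7 13 6; U1 8 0 9; U1 8 1 10; U1 8 3 12; U1 8 4 12; U1 8 5 13;
  U1 9 0 2; U1 9 5 6; U1 9 9 10; U1 9 11 12; U1 9 12 12];
  [:: U0 2 1; U0 3 2; U0 4 2; U0 6 4; U0 7 6; U0 10 9; U0 11 10; U0 12 10;
  U0 14 12; U1 15 0 2; U0 15 14; U1 16 1 2; U1 16 4 5; U1 16 9 9; U1 16 12 12];
  [:: U0 0 2; U1 3 0 6; U1 3 1 10; U1 3 2 11; U1 3 3 12; U1 3 4 13; U1 5 0 5;
  U1 5 1 9; U1 5 5 12; U1 5 6 13; U1 7 0 3; U1 7 2 8; U1 7 3 9; U1 7 5 10;
  U1 7 8 13; U1 8 0 2; U1 8 4 9; U1 8 6 10; U1 8 8 12; U1 11 1 3; U1 11 2 4;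
  U1 11 3 5; U1 11 5 6; U1 11 9 13; U1 13 1 2; U1 13 4 5; U1 13 6 6; U1 13 9 12;
  U1 14 2 2; U1 15 3 2; U1 15 4 3; U1 15 8 6; U1 15 9 10; U1 16 5 2; U1 16 6 3;
  U1 16 8 5; U1 16 9 9];
  [::
    U0 7 0]].

Definition homotopy2_3 : seq entries := [::
  [::
    U0 0 2];
  [:: U1 0 0 4; U1 0 2 6; U1 0 8 11; U1 0 10 13; U1 1 0 3; U1 1 3 6; U1 1 4 6;
  U1 1 8 10; U1 1 11 13; U1 1 12 13; U1 3 0 1; U1 3 2 3; U1 3 3 4; U1 3 4 4;
  U1 3 6 6; U1 3 8 8; U1 3 10 10; U1 3 11 11; U1 3 12 11; U1 3 14 13; U0 4 16;
  U1 5 2 1; U1 5 6 4; U1 5 10 8; U1 5 14 11; U1 6 3 1; U1 6 4 1; U1 6 6 3;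
  U1 6 11 8; U1 6 12 8; U1 6 14 10; U1 7 8 1; U1 7 10 3; U1 7 11 4; U1 7 12 4;
  U1 7 14 6; U1 8 0 8; U1 8 2 10; U1 8 3 11; U1 8 4 11; U1 8 6 13; U1 9 0 1;
  U1 9 6 6; U1 9 10 10; U1 9 11 11; U1 9 12 11];
  [:: U0 1 1; U0 3 3; U0 4 3; U0 5 4; U0 7 7; U0 9 9; U0 11 11; U0 12 11;
  U0 13 12; U1 15 0 1; U0 15 15];
  [:: U0 0 3; U1 2 0 6; U1 2 1 10; U1 2 2 11; U1 2 3 12; U1 2 4 13; U1 5 0 4;
  U1 5 1 8; U1 5 5 11; U1 5 7 13; U1 6 0 3; U1 6 2 8; U1 6 3 9; U1 6 5 10;
  U1 6 8 13; U1 8 0 1; U1 8 4 8; U1 8 7 10; U1 8 8 11; U1 10 1 3; U1 10 2 4;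
  U1 10 3 5; U1 10 5 6; U1 10 9 13; U1 13 1 1; U1 13 4 4; U1 13 7 6; U1 13 9 11;
  U1 14 2 1; U1 14 4 3; U1 14 8 6; U1 14 9 10; U1 15 3 1; U1 16 5 1; U1 16 7 3;
  U1 16 8 4; U1 16 9 8];
  [::
    U0 6 0]].

Definition homotopy2_4 : seq entries := [::
  [::
    U0 0 3];
  [:: U1 0 0 3; U1 0 1 4; U1 0 2 5; U1 0 3 6; U1 0 8 10; U1 0 9 11; U1 0 10 12;
  U1 0 11 13; U1 1 0 2; U1 1 1 3; U1 1 3 5; U1 1 4 5; U1 1 5 6; U1 1 8 9;
  U1 1 9 10; U1 1 11 12; U1 1 12 12; U1 1 13 13; U1 2 0 1; U1 2 2 3; U1 2 3 4;
  U1 2 4 4; U1 2 6 6; U1 2 8 8; U1 2 10 10; U1 2 11 11; U1 2 12 11; U1 2 14 13;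
  U1 4 1 0; U1 4 3 2; U1 4 5 3; U1 4 7 5; U1 4 9 7; U1 4 11 9; U1 4 13 10;
  U1 4 15 12; U1 5 2 0; U1 5 3 1; U1 5 6 3; U1 5 7 4; U1 5 10 7; U1 5 11 8;
  U1 5 14 10; U1 5 15 11; U1 6 3 0; U1 6 4 0; U1 6 5 1; U1 6 6 2; U1 6 7 3;
  U1 6 11 7; U1 6 12 7; U1 6 13 8; U1 6 14 9; U1 6 15 10; U1 7 8 0; U1 7 9 1;
  U1 7 10 2; U1 7 12 3; U1 7 13 4; U1 7 14 5; U1 7 15 6; U1 8 0 7; U1 8 1 8;
  U1 8 2 9; U1 8 4 10; U1 8 5 11; U1 8 6 12; U1 8 7 13; U1 9 0 0; U1 9 1 1;
  U1 9 6 5; U1 9 7 6; U1 9 10 9; U1 9 12 10; U1 9 13 11; U0 9 16];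
  [:: U0 0 1; U1 1 0 12; U0 1 2; U1 2 0 11; U0 2 3; U1 3 0 10; U0 3 4; U0 3 5;
  U0 4 5; U0 5 6; U0 6 7; U0 7 8; U1 8 0 6; U0 8 9; U0 9 10; U0 10 11; U0 11 12;
  U0 11 13; U0 12 13; U0 13 14; U0 14 15; U1 15 0 0; U0 15 16; U2 16 0 1 12;
  U1 16 1 0; U1 16 2 1; U1 16 7 5; U1 16 8 6; U1 16 11 9; U1 16 13 10;
  U1 16 14 11];
  [:: U0 0 4; U0 0 5; U1 1 0 6; U1 1 1 10; U1 1 2 11; U1 1 3 12; U1 2 0 5;
  U1 2 1 9; U1 2 2 10; U1 2 4 12; U1 2 5 12; U1 2 6 13; U1 3 0 4; U1 3 1 8;
  U1 3 3 10; U1 3 4 11; U1 3 5 11; U1 3 7 13; U1 4 0 3; U1 4 2 8; U1 4 3 9;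
  U1 4 4 10; U1 4 5 10; U1 4 8 13; U1 5 1 7; U1 5 2 8; U1 5 3 9; U1 5 6 11;
  U1 5 7 12; U1 5 8 13; U1 6 0 2; U1 6 2 7; U1 6 6 10; U1 6 8 12; U1 7 0 1;
  U1 7 3 7; U1 7 7 10; U1 7 8 11; U1 8 0 0; U1 8 6 8; U1 8 7 9; U1 8 8 10;
  U1 9 1 3; U1 9 2 4; U1 9 3 5; U1 9 4 6; U1 9 5 6; U1 9 9 13; U1 10 1 2;
  U1 10 2 3; U1 10 6 6; U1 10 9 12; U1 11 1 1; U1 11 3 3; U1 11 7 6; U1 11 9 11;
  U1 12 2 1; U1 12 3 2; U1 12 8 6; U1 12 9 10; U1 13 1 0; U1 13 2 1; U1 13 3 2;
  U1 13 6 4; U1 13 7 5; U1 13 8 6; U1 14 2 0; U1 14 6 3; U1 14 8 5; U1 14 9 9;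
  U1 15 3 0; U1 15 7 3; U1 15 8 4; U1 15 9 8; U1 16 4 0; U1 16 5 0; U1 16 6 1;
  U1 16 7 2; U1 16 8 3; U1 16 9 7];
  [:: U0 4 0; U0 5 0]].

Definition homotopy2_5 : seq entries := [::
  [::
    U0 0 4];
  [:: U1 0 1 3; U1 0 3 5; U1 0 9 10; U1 0 11 12; U1 1 1 2; U1 1 5 5; U1 1 9 9;
  U1 1 13 12; U0 2 16; U1 3 1 0; U1 3 3 2; U1 3 5 3; U1 3 7 5; U1 3 9 7;
  U1 3 11 9; U1 3 13 10; U1 3 15 12; U1 5 3 0; U1 5 7 3; U1 5 11 7; U1 5 15 10;
  U1 6 5 0; U1 6 7 2; U1 6 13 7; U1 6 15 9; U1 7 9 0; U1 7 11 2; U1 7 13 3;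
  U1 7 15 5; U1 8 1 7; U1 8 3 9; U1 8 5 10; U1 8 7 12; U1 9 3 2; U1 9 5 3;
  U1 9 9 7; U1 9 15 12];
  [:: U1 0 0 12; U0 0 2; U0 2 4; U0 2 5; U1 4 0 9; U0 4 6; U0 6 8; U1 8 0 5;
  U0 8 10; U0 10 12; U0 10 13; U0 12 14; U0 14 16];
  [:: U0 0 6; U1 1 0 5; U1 1 1 9; U1 1 2 10; U1 1 5 12; U1 2 6 12; U1 3 0 3;
  U1 3 1 7; U1 3 4 10; U1 3 7 12; U1 4 0 2; U1 4 2 7; U1 4 4 9; U1 4 8 12;
  U1 5 0 2; U1 5 2 7; U1 5 4 9; U1 5 8 12; U1 6 6 9; U1 7 0 0; U1 7 5 7;
  U1 7 7 9; U1 7 8 10; U1 9 1 2; U1 9 2 3; U1 9 4 5; U1 9 9 12; U1 10 6 5;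
  U1 11 1 0; U1 11 5 3; U1 11 7 5; U1 11 9 10; U1 12 2 0; U1 12 5 2; U1 12 8 5;
  U1 12 9 9; U1 13 2 0; U1 13 5 2; U1 13 8 5; U1 13 9 9; U1 15 4 0; U1 15 6 1;
  U1 15 7 2; U1 15 8 3; U1 15 9 7];
  [::
    U0 3 0]].
Definition resolution2_tables : seq (seq (seq pol)) := Eval vm_compute in
  tabulate 10 1 quadrics2 ::
  [seq tabulate 17 17 (sparse_mx s)
     | s <- [:: sparse2_2; sparse2_3; sparse2_4; sparse2_5]].

Definition resolution2_diff (i : nat) : pmx := ptab (nth [::] resolution2_tables i).

Definition resolution2_rank (i : nat) : nat := nth 0%N [:: 1; 10; 17; 17; 10; 1]%N i.

(** The additional generators have degree 4: the last one of F_2 and the first one of F_3. The entry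
    of the differential between them has degree 0 and is zero, which is why they survive in Tor. *)
Definition resolution2_deg (i s : nat) : nat :=
  nth 0%N (nth [::] [:: [:: 0]; nseq 10 2; rcons (nseq 16 3) 4; 4 :: nseq 16 5;
                        nseq 10 6; [:: 8]]%N i) s.

Definition homotopy2_tables : seq (seq (seq (seq pol))) := Eval vm_compute in
  [seq [seq tabulate 17 17 (sparse_mx s) | s <- h]
     | h <- [:: homotopy2_1; homotopy2_2; homotopy2_3; homotopy2_4; homotopy2_5]].

Definition resolution2_homotopy (j i : nat) : pmx :=
  ptab (nth [::] (nth [::] homotopy2_tables j) i).

Lemma resolution2_complex :
  pcheck_complex resolution2_rank resolution2_diff 2.
Proof. by vm_compute. Qed.

Lemma resolution2_degrees :
  pcheck_degrees resolution2_rank resolution2_deg resolution2_diff.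
Proof. by vm_compute. Qed.

Lemma resolution2_homotopyP :
  pcheck_homotopy resolution2_rank resolution2_diff 2 1 leading_system
    resolution2_homotopy.
Proof. by vm_compute. Qed.

(** * The equations of the variety *)

Lemma det_mx3 (R : comNzRingType) (f : nat -> nat -> R) :
  \det (\matrix_(r < 3, s < 3) f r s) =
    f 0 0 * (f 1 1 * f 2 2 - f 1 2 * f 2 1)
    - f 0 1 * (f 1 0 * f 2 2 - f 1 2 * f 2 0)
    + f 0 2 * (f 1 0 * f 2 1 - f 1 1 * f 2 0) :> R.
Proof.
rewrite (expand_det_row _ ord0) !big_ord_recl big_ord0 /cofactor.
rewrite !(@expand_det_row _ 2 _ ord0) !big_ord_recl !big_ord0 /cofactor.
rewrite !det_mx11 !mxE /= /bump /=.
by rewrite !expr0 !expr1; ring.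
Qed.

Lemma wedge3E (R : comUnitRingType) i j k (a b c : 'I_7) :
  wedge3 R i j k a b c = (wedge3_int i j k a b c)%:~R.
Proof.
pose f r s : R := (nth 0%N [:: i; j; k] r == (nth 0%N [:: a : nat; b : nat; c : nat] s).+1)%:R.
rewrite /wedge3 (_ : \matrix_(_, _) _ = \matrix_(r < 3, s < 3) f r s); last first.
  by apply/matrixP => r s; rewrite !mxE; case: s => -[|[|[|]]].
rewrite det_mx3 /wedge3_int /f /= !(intrD, mulrNz, intrM) /=.
by rewrite !pmulrn.
Qed.

Lemma gamma0E (R : comUnitRingType) (a b c : 'I_7) :
  gamma0 R a b c = (gamma_int a b c)%:~R.
Proof. by rewrite /gamma0 !wedge3E /gamma_int !(intrD, mulrNz). Qed.

Definition env (S : Type) (X : 'M[S]_(2, 7)) (k : nat) : S :=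
  X (inord (k %/ 7)) (inord (k %% 7)).

(* The indices 14, ..., 17 stand for the entries of g.                         *)
Definition env2 (S : Type) (X : 'M[S]_(2, 7)) (g : 'M[S]_2) (k : nat) : S :=
  if (k < 14)%N then env X k
  else g (inord ((k - 14) %/ 2)) (inord ((k - 14) %% 2)).

(** Coordinate k of g X in terms of the entries of X and g. The row of g used starts at variable 14
    for the first row of g X and at 16 for the second. *)
Definition psigma (k : nat) : pol :=
  let r := if (k %/ 7 == 1)%N then 16%N else 14%N in
  [:: (1, [:: r; k %% 7]%N); (1, [:: r + 1; 7 + k %% 7]%N)].

Lemma env_rows (S : Type) (X : 'M[S]_(2, 7)) (k : nat) : (k < 7)%N ->
  env X k = X 0 (inord k) /\ env X (7 + k) = X 1 (inord k).
Proof.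
move=> k7; rewrite /env divn_small // modn_small //.
have -> : ((7 + k) %/ 7 = 1)%N by rewrite -{1}[7%N]mul1n divnMDl // divn_small.
rewrite modnDl modn_small //.
by split; congr (X _ _); apply/val_inj; rewrite /= inordK.
Qed.

Lemma env_mul (S : comNzRingType) (X : 'M[S]_(2, 7)) (g : 'M[S]_2) :
  env (g *m X) =1 fun k => peval (env2 X g) (psigma k).
Proof.
move=> k; rewrite /env mxE !big_ord_recl big_ord0 addr0.
rewrite /psigma !peval_cons peval_nil addr0 !mul1r /moneval !big_cons !big_nil !mulr1.
have k7 : (k %% 7 < 7)%N by rewrite ltn_mod.
have [Xk0 Xk1] := env_rows X k7.
have -> : env2 X g (k %% 7) = X 0 (inord (k %% 7)).
  by rewrite /env2 (leq_trans k7) // Xk0.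
have -> : env2 X g (7 + k %% 7) = X 1 (inord (k %% 7)).
  by rewrite /env2 -[14%N]/(7 + 7)%N ltn_add2l k7 Xk1.
have -> : lift ord0 ord0 = 1 :> 'I_2 by apply/val_inj.
have -> : (inord (k %/ 7) : 'I_2) = if (k %/ 7 == 1)%N then 1 else 0.
  apply/val_inj; rewrite /= /inord /insubd; case: insubP => [i lt_i ->|].
    by move: lt_i; case: (k %/ 7)%N => [|[|]].
  by case: (k %/ 7)%N => [|[|]].
by case: ifP => _; congr (_ * _ + _ * _); congr (g _ _); apply/val_inj; rewrite /= ?inordK.
Qed.

Lemma env_morph (S S' : Type) (f : S -> S') (X : 'M[S]_(2, 7)) :
  f \o env X =1 env (map_mx f X).
Proof. by move=> k; rewrite /= /env mxE. Qed.

Definition generic_mx (R : nzRingType) : 'M[{mpoly R[2 * 7]}]_(2, 7) :=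
  \matrix_(a, k) 'X_(mxvec_index a k).

Lemma xenvE (K : fieldType) : xenv K =1 env (generic_mx K).
Proof. by move=> k; rewrite /env mxE. Qed.

Lemma eval_at_peval (K : fieldType) (L : comNzRingType) (iota : {rmorphism K -> L})
    (phi : 'M[L]_(2, 7)) p :
  eval_at iota (peval (xenv K) p) phi = peval (env phi) p.
Proof.
rewrite /eval_at (peval_morph (map_mpoly iota)).
rewrite (peval_morph (mpoly.meval (mxvec phi 0))); apply: eq_peval => k.
by rewrite /= /xenv map_mpolyX mevalXU mxvecE.
Qed.

Section EvalAt.

Variables (K : fieldType) (L : comNzRingType) (iota : {rmorphism K -> L}).
Variable phi : 'M[L]_(2, 7).

Lemma eval_at0 : eval_at iota 0 phi = 0.
Proof. by rewrite /eval_at rmorph0 meval0. Qed.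

Lemma eval_atD f g : eval_at iota (f + g) phi = eval_at iota f phi + eval_at iota g phi.
Proof. by rewrite /eval_at rmorphD mevalD. Qed.

Lemma eval_atM f g : eval_at iota (f * g) phi = eval_at iota f phi * eval_at iota g phi.
Proof. by rewrite /eval_at rmorphM mevalM. Qed.

End EvalAt.

(* Coefficients of the quadrics at g X in terms of the quadrics at X.          *)
Definition quadrics_gl : pmx := fun i j =>
  if (i < 7)%N then
    if i == j then [:: (1, [:: 14; 17]); (-1, [:: 15; 16])] else [::]
  else nth [::] (nth [::] [::
    [:: [:: (-1, [:: 14; 15])]; [:: (1, [:: 14; 14])]; [:: (1, [:: 15; 15])];
        [:: (2, [:: 14; 15])]];
    [:: [:: (-1, [:: 16; 17])]; [:: (1, [:: 16; 16])]; [:: (1, [:: 17; 17])];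
        [:: (2, [:: 16; 17])]];
    [:: [:: (-1, [:: 15; 16])]; [:: (1, [:: 14; 16])]; [:: (1, [:: 15; 17])];
        [:: (1, [:: 14; 17]); (1, [:: 15; 16])]]] (i - 7))
   (if j == 3%N then 0%N else if (j < 7)%N then 4%N else (j - 6)%N).

Lemma quadrics_glP :
  pmxeq 0 10 1 (psubstmx psigma quadrics2) (pmulmx 10 quadrics_gl quadrics2).
Proof. by vm_compute. Qed.

Definition sparse_null_u : entries := [::
  T1 0 4 1 1; N1 0 5 1 2; N1 0 6 1 3; N1 1 2 1 0; N1 1 3 1 1; N1 1 5 1 3;
  N1 1 6 1 4; T1 2 1 1 0; N1 2 3 1 2; N1 2 4 1 3; T1 2 6 1 5; N1 3 0 1 0;
  N1 3 3 1 3; N1 3 4 1 4; N1 3 5 1 5; N1 4 0 1 1; T1 4 2 1 3; N1 4 5 1 6;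
  T1 5 0 1 2; T1 5 1 1 3; T1 5 4 1 6; T1 6 0 1 3; T1 6 1 1 4; N1 6 2 1 5;
  N1 6 3 1 6].

Definition sparse_null_v : entries := [::
  N1 0 3 1 7; N1 0 4 1 8; T1 0 5 1 9; T1 0 6 1 10; T1 1 2 1 7; T1 1 5 1 10;
  T1 1 6 1 11; N1 2 1 1 7; T1 2 4 1 10; N1 2 6 1 12; T1 3 0 1 7; T1 3 4 1 11;
  T1 3 5 1 12; T1 4 0 1 8; N1 4 2 1 10; N1 4 3 1 11; T1 4 5 1 13; N1 5 0 1 9;
  N1 5 1 1 10; N1 5 3 1 12; N1 5 4 1 13; N1 6 0 1 10; N1 6 1 1 11; T1 6 2 1 12].

Definition sparse_chart : entries := [::
  N2 0 3 1 0 3; N2 0 4 1 0 4; N2 0 4 1 1 3; N2 0 5 1 0 5; T2 0 5 1 2 3;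
  N2 0 6 1 0 6; T2 0 6 1 1 5; T2 0 6 1 2 4; N2 0 7 1 1 9; T2 0 7 1 2 8;
  T2 1 3 1 0 2; T2 1 4 1 0 3; T2 1 4 1 1 2; N2 1 5 1 2 2; N2 1 6 1 0 5;
  N2 1 6 1 2 3; T2 1 7 1 0 9; N2 1 7 1 2 7; N2 2 3 1 0 1; N2 2 4 1 1 1;
  N2 2 5 1 0 3; T2 2 5 1 1 2; N2 2 6 1 0 4; T2 2 6 1 1 3; N2 2 7 1 0 8;
  T2 2 7 1 1 7].

(** The vector q0 (u) v - h u, with h half the polar form modulo c_4, has coordinates in the ideal
    of the c_k. When these vanish and u, v are independent, q0 (u) and h vanish. [null_vP] exchanges
    the roles of u and v and gives q0 (v). *)
Lemma null_uP : pmxeq 0 7 1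
  (fun i _ => pmul [:: (1, [:: (7 + i)%N])] (quadrics2 7 0)
              ++ pmul [:: (-1, [:: i])] (quadrics2 9 0))
  (pmulmx 7 (sparse_mx sparse_null_u) quadrics2).
Proof. by vm_compute. Qed.

Lemma null_vP : pmxeq 0 7 1
  (fun i _ => pmul [:: (1, [:: i])] (quadrics2 8 0)
              ++ pmul [:: (-1, [:: (7 + i)%N])] (quadrics2 9 0))
  (pmulmx 7 (sparse_mx sparse_null_v) quadrics2).
Proof. by vm_compute. Qed.

(** Where u_1 is invertible, c_1, c_2 and c_3 follow from the five equations c_4, ..., c_7 and q0
    (u) that define the chart. *)
Lemma chartP : pmxeq 0 3 1
  (fun i _ => pmul [:: (1, [:: 0; 0]%N)] (quadrics2 i 0))
  (pmulmx 8 (sparse_mx sparse_chart) quadrics2).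
Proof. by vm_compute. Qed.

Definition pgamma_eval (k : nat) : pol :=
  flatten [seq flatten [seq pscale (gamma_int a b k) [:: (1, [:: a; (7 + b)%N])]
    | b <- iota 0 7] | a <- iota 0 7].

Lemma pgamma_evalP :
  pmxeq 0 7 1 (fun k _ => pgamma_eval k) quadrics2.
Proof. by vm_compute. Qed.

Definition zero_locus (S : comNzRingType) (phi : 'M[S]_(2, 7)) : Prop :=
  mxeval (env phi) 10 1 quadrics2 = 0.

Lemma zero_locusP (S : comNzRingType) (phi : 'M[S]_(2, 7)) :
  zero_locus phi <-> forall i, (i < 10)%N -> peval (env phi) (quadrics2 i 0) = 0.
Proof.
split=> [z i i10|z]; last by apply/matrixP => i j; rewrite !mxE ord1 z.
by have /matrixP/(_ (Ordinal i10) 0) := z; rewrite !mxE.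
Qed.

Lemma peval_env2 (S : comNzRingType) (X : 'M[S]_(2, 7)) (g : 'M[S]_2) p :
  all (fun t => all (ltn^~ 14) t.2) p -> peval (env2 X g) p = peval (env X) p.
Proof.
move=> /allP p14; apply: eq_big_seq => t /p14 /allP t14; congr (_ * _).
by apply: eq_big_seq => k /t14 /= k14; rewrite /env2 k14.
Qed.

Lemma mxeval_gl (S : comNzRingType) (X : 'M[S]_(2, 7)) (g : 'M[S]_2) :
  mxeval (env (g *m X)) 10 1 quadrics2 =
  mxeval (env2 X g) 10 10 quadrics_gl *m mxeval (env X) 10 1 quadrics2.
Proof.
have -> : mxeval (env (g *m X)) 10 1 quadrics2 =
          mxeval (env2 X g) 10 1 (psubstmx psigma quadrics2).
  rewrite mxeval_subst; apply/matrixP => i j; rewrite !mxE.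
  by apply: eq_peval; apply: env_mul.
rewrite (mxeval_eq (c := 0) (env2 X g) _ quadrics_glP) // -mxeval_mul.
congr (_ *m _); apply/matrixP => i j; rewrite !mxE; apply: peval_env2.
have /allP/(_ (i : nat)) : all (fun i => all (fun t => all (ltn^~ 14) t.2) (quadrics2 i 0))
  (iota 0 10) by vm_compute.
by rewrite mem_iota ltn_ord /quadrics2 => /(_ isT).
Qed.

Lemma zero_locus_gl (S : comNzRingType) (X : 'M[S]_(2, 7)) (g : 'M[S]_2) :
  zero_locus X -> zero_locus (g *m X).
Proof. by move=> z; rewrite /zero_locus mxeval_gl z mulmx0. Qed.

(** * Isotropic subspaces and the ten quadrics over a field *)

Section FieldPoints.

Variables (L : fieldType) (gam : trilinear L).
Hypothesis gamE : forall a b c, gam a b c = (gamma_int a b c)%:~R.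

Lemma trilin_eval_quadric (X : 'M[L]_(2, 7)) (k : 'I_7) :
  trilin_eval gam (row 0 X) (row 1 X) (delta_mx 0 k) =
  peval (env X) (quadrics2 k 0).
Proof.
transitivity (peval (env X) (pgamma_eval k)); last first.
  have := mxeval_eq (c := 0) (env X) erefl pgamma_evalP.
  by move/matrixP/(_ k 0); rewrite !mxE.
rewrite /trilin_eval /pgamma_eval peval_flatten big_map.
have -> : iota 0 7 = index_iota 0 7 by [].
rewrite big_mkord; apply: eq_bigr => a _.
rewrite peval_flatten big_map big_mkord; apply: eq_bigr => b _.
rewrite (bigD1 k) //= big1 ?addr0 => [|c ck]; last first.
  by rewrite !mxE (negbTE ck) andbF mulr0.
rewrite peval_scale gamE !mxE !eqxx mulr1 peval_cons peval_nil addr0 mul1r.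
have [Xa _] := env_rows X (ltn_ord a); have [_ Xb] := env_rows X (ltn_ord b).
by rewrite /moneval !big_cons big_nil mulr1 Xa Xb !inord_val mulrA.
Qed.

Lemma trilin_eval_sum (u v w : 'rV[L]_7) :
  trilin_eval gam u v w = \sum_k w 0 k * trilin_eval gam u v (delta_mx 0 k).
Proof.
rewrite /trilin_eval; under [RHS]eq_bigr do rewrite mulr_sumr.
rewrite [RHS]exchange_big; apply: eq_bigr => a _.
under [RHS]eq_bigr do rewrite mulr_sumr.
rewrite [RHS]exchange_big; apply: eq_bigr => b _.
apply: eq_bigr => c _; rewrite (bigD1 c) //= big1 ?addr0 => [|d dc]; last first.
  by rewrite !mxE (negbTE dc) andbF mulr0.
by rewrite !mxE !eqxx mulr1 mulrC.
Qed.

(** Two vectors of the row space of X are the rows of g X for some 2 by 2 matrix g, and passing from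
    X to g X multiplies each c_k by the determinant of g. *)
Lemma gamma_null_quadrics (X : 'M[L]_(2, 7)) : gamma_null gam X <->
  forall k, (k < 7)%N -> peval (env X) (quadrics2 k 0) = 0.
Proof.
split=> [null k k7|z w w' v].
  by rewrite -(trilin_eval_quadric X (Ordinal k7)) null // row_sub.
case/submxP => a -> /submxP [b ->].
have [r0 r1] : row 0 (col_mx a b *m X) = a *m X /\ row 1 (col_mx a b *m X) = b *m X.
  rewrite !row_mul; split; congr (_ *m _); apply/rowP => k; rewrite !mxE;
    by case: splitP => j; rewrite (ord1 j).
rewrite -r0 -r1 trilin_eval_sum big1 // => k _; rewrite trilin_eval_quadric.
have k10 : (k < 10)%N by rewrite (leq_trans (ltn_ord k)).
have /matrixP/(_ (Ordinal k10) 0) := mxeval_gl X (col_mx a b).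
rewrite [in X in X -> _]mxE => ->; rewrite mxE big1 ?mulr0 // => l _.
rewrite [X in X * _]mxE /quadrics_gl /= ltn_ord.
case: eqP => [/= kl|_]; last by rewrite peval_nil mul0r.
by rewrite [X in _ * X]mxE -kl z ?mulr0.
Qed.

Lemma row_free2 (X : 'M[L]_(2, 7)) (a b : L) : \rank X = 2%N ->
  a *: row 0 X + b *: row 1 X = 0 -> a = 0 /\ b = 0.
Proof.
move=> rX ab0.
have /(row_free_inj (n := 2)) inj : row_free X by rewrite /row_free rX.
have : (\row_(i < 2) if i == 0 then a else b) *m X = 0 *m X.
  rewrite mul0mx -ab0; apply/rowP => k; rewrite !mxE !big_ord_recl big_ord0 addr0 !mxE /=.
  by congr (_ * _ + _ * X _ _); apply/val_inj.
move/inj/rowP => ab; have := ab 0; have := ab 1; rewrite !mxE /=.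
by split.
Qed.

Lemma gamma_null_zero_locus (X : 'M[L]_(2, 7)) :
  \rank X = 2%N -> gamma_null gam X -> zero_locus X.
Proof.
move=> rX /gamma_null_quadrics z; apply/zero_locusP.
have z7 : mxeval (env X) 7 1 quadrics2 = 0.
  by apply/matrixP => i j; rewrite !mxE ord1 z.
have entry (k : 'I_7) : X 0 k = env X k /\ X 1 k = env X (7 + k).
  by have [-> ->] := env_rows X (ltn_ord k); rewrite inord_val.
have [|u9 u7] := @row_free2 X (- peval (env X) (quadrics2 9 0)) (peval (env X) (quadrics2 7 0)) rX.
  have := mxeval_eq (c := 0) (env X) erefl null_uP.
  rewrite -mxeval_mul z7 mulmx0 => /matrixP E; apply/rowP => k.
  have := E k 0; rewrite !mxE peval_cat !peval_mul peval_var.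
  rewrite -[[:: (-1, _)]]/(pscale (-1) [:: (1, [:: (k : nat)])]) peval_scale peval_var.
  have [-> ->] := entry k => <-; ring.
have [|v8 _] := @row_free2 X (peval (env X) (quadrics2 8 0)) (- peval (env X) (quadrics2 9 0)) rX.
  have := mxeval_eq (c := 0) (env X) erefl null_vP.
  rewrite -mxeval_mul z7 mulmx0 => /matrixP E; apply/rowP => k.
  have := E k 0; rewrite !mxE peval_cat !peval_mul peval_var.
  rewrite -[[:: (-1, _)]]/(pscale (-1) [:: (1, [:: (7 + k)%N])]) peval_scale peval_var.
  have [-> ->] := entry k => <-; ring.
have {}u9 : peval (env X) (quadrics2 9 0) = 0 by rewrite -[LHS]opprK u9 oppr0.
by case=> [|[|[|[|[|[|[|[|[|[|]]]]]]]]]] // ?; rewrite ?u9 ?u7 ?v8 ?z.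
Qed.

Lemma zero_locus0 : zero_locus (0 : 'M[L]_(2, 7)).
Proof.
apply/zero_locusP => i i10.
have h (p : pol) : all (fun t => t.2 != [::]) p -> peval (env (0 : 'M[L]_(2, 7))) p = 0.
  move=> /allP p0; rewrite /peval big_seq big1 // => t /p0.
  case: t => k [|j m] //= _; rewrite /moneval big_cons /env mxE.
  by rewrite mul0r mulr0.
by apply: h; move: i i10; do 10 (case=> [//|]).
Qed.

(** A map of rank 1 is g Y, where the rows of Y span a null plane containing its image and g may be
    singular; the zero locus is stable under every 2 by 2 matrix. *)
Lemma isotropic_zero_locus (X : 'M[L]_(2, 7)) : isotropic gam X -> zero_locus X.
Proof.
case=> [[rX null]|[rX [W [rW null XW]]]|/eqP]; last 1 first.
- by rewrite mxrank_eq0 => /eqP ->; apply: zero_locus0.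
- exact: gamma_null_zero_locus.
have [Y YW] : exists Y : 'M[L]_(2, 7), (Y :=: W)%MS.
  by move: (row_base W) (eq_row_base W); rewrite rW => Y; exists Y.
have /submxP [g ->] : (X <= Y)%MS by rewrite YW.
apply/zero_locus_gl/gamma_null_zero_locus; first by rewrite YW.
by move=> w w' v; rewrite !YW; apply: null.
Qed.

End FieldPoints.

(** * The ideal of the variety *)

Section Chart.

Variables (L : fieldType) (x : nat -> L).
Hypothesis x0 : x 0 != 0.

(* On the chart u_1 <> 0 the coordinates u_7, v_4, v_5, v_6, v_7 are functions *)
(* of the other ones, by the equations q0 (u), c_7, c_6, c_5, c_4.             *)
Let u7 : L := (x 1 * x 5 + x 2 * x 4 - x 3 * x 3) / x 0.
Let v4 : L := (x 3 * x 7 + x 1 * x 9 - x 2 * x 8) / x 0.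
Let v5 : L := (x 4 * x 7 + x 1 * v4 - x 3 * x 8) / x 0.
Let v6 : L := (x 5 * x 7 - x 2 * v4 + x 3 * x 9) / x 0.
Let v7 : L := (u7 * x 7 - x 1 * v6 + x 5 * x 8 - x 2 * v5 + x 4 * x 9) / x 0.

Definition chart_coord : seq L :=
  [:: x 0; x 1; x 2; x 3; x 4; x 5; u7; x 7; x 8; x 9; v4; v5; v6; v7].

Definition chart_point : 'M[L]_(2, 7) := \matrix_(a, k) chart_coord`_(7 * a + k).

Lemma env_chart_point k : (k < 14)%N -> env chart_point k = chart_coord`_k.
Proof.
move=> k14; rewrite /env mxE !inordK ?ltn_mod ?ltn_divLR //.
by congr (nth _ _ _); rewrite [RHS](divn_eq k 7) mulnC.
Qed.

Lemma chart_point_quadrics i : (3 <= i < 8)%N ->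
  peval (env chart_point) (quadrics2 i 0) = 0.
Proof.
have u7E : x 0 * u7 = x 1 * x 5 + x 2 * x 4 - x 3 * x 3 by rewrite mulrC divfK.
have v4E : x 0 * v4 = x 3 * x 7 + x 1 * x 9 - x 2 * x 8 by rewrite mulrC divfK.
have v5E : x 0 * v5 = x 4 * x 7 + x 1 * v4 - x 3 * x 8 by rewrite mulrC divfK.
have v6E : x 0 * v6 = x 5 * x 7 - x 2 * v4 + x 3 * x 9 by rewrite mulrC divfK.
have v7E : x 0 * v7 = u7 * x 7 - x 1 * v6 + x 5 * x 8 - x 2 * v5 + x 4 * x 9.
  by rewrite mulrC divfK.
case: i => [|[|[|[|[|[|[|[|i]]]]]]]] // _.
all: rewrite /quadrics2 /= !peval_cons peval_nil /moneval !big_cons !big_nil.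
all: rewrite !env_chart_point //= !mulr1 !addr0 ?mul1r ?mulN1r ?u7E ?v4E ?v5E ?v6E ?v7E.
all: by ring.
Qed.

Lemma chart_point_zero_c i : (i < 8)%N ->
  peval (env chart_point) (quadrics2 i 0) = 0.
Proof.
move=> i8; have [i3|i3] := leqP 3 i; first by rewrite chart_point_quadrics // i3.
have /matrixP/(_ (Ordinal i3) 0) := mxeval_eq (c := 0) (env chart_point) erefl chartP.
rewrite -mxeval_mul mxE [RHS]mxE big1 => [|k _]; last first.
  rewrite [X in _ * X]mxE; have [k3|k3] := leqP 3 k.
    by rewrite chart_point_quadrics ?mulr0 // k3 ltn_ord.
  rewrite [X in X * _]mxE (_ : sparse_mx _ _ _ = [::]) ?peval_nil ?mul0r //.
  by case: k k3 => -[|[|[|]]] //= ? _; case: i {i8} i3 => [|[|[|]]].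
rewrite peval_mul => /eqP; rewrite mulf_eq0 => /orP[|/eqP //].
rewrite peval_cons peval_nil /moneval !big_cons big_nil mul1r mulr1 addr0.
by rewrite env_chart_point // mulf_eq0 orbb (negbTE x0).
Qed.

(** The assumption is that the minor of the first two columns does not vanish; it gives rank 2, and
    the vanishing of the c_k gives nullity. *)
Lemma chart_point_isotropic (gam : trilinear L) :
  (forall a b c, gam a b c = (gamma_int a b c)%:~R) ->
  x 0 * x 8 - x 1 * x 7 != 0 -> isotropic gam chart_point.
Proof.
move=> gamE minor; have r2 : \rank chart_point = 2%N.
  apply/eqP; rewrite -[_ == _]/(row_free chart_point) -kermx_eq0.
  apply/rowV0P => w /sub_kermxP /rowP wX.
  have entry (k : 'I_7) : w 0 0 * chart_coord`_k + w 0 1 * chart_coord`_(7 + k) = 0.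
    have := wX k; rewrite !mxE !big_ord_recl big_ord0 addr0 !mxE.
    by rewrite (_ : lift ord0 ord0 = 1) //; apply/val_inj.
  have e0 : w 0 0 * x 0 + w 0 1 * x 7 = 0 by have := entry (inord 0); rewrite inordK.
  have e1 : w 0 0 * x 1 + w 0 1 * x 8 = 0 by have := entry (inord 1); rewrite inordK.
  have w0 : w 0 0 * (x 0 * x 8 - x 1 * x 7) = 0.
    rewrite (_ : _ * _ = x 8 * (w 0 0 * x 0 + w 0 1 * x 7)
                         - x 7 * (w 0 0 * x 1 + w 0 1 * x 8)); last by ring.
    by rewrite e0 e1 !mulr0 subr0.
  have w1 : w 0 1 * (x 0 * x 8 - x 1 * x 7) = 0.
    rewrite (_ : _ * _ = x 0 * (w 0 0 * x 1 + w 0 1 * x 8)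
                         - x 1 * (w 0 0 * x 0 + w 0 1 * x 7)); last by ring.
    by rewrite e0 e1 !mulr0 subr0.
  move/eqP: w0; rewrite mulf_eq0 (negbTE minor) orbF => /eqP w0.
  move/eqP: w1; rewrite mulf_eq0 (negbTE minor) orbF => /eqP w1.
  apply/rowP => k; rewrite mxE; case: k => -[|[|]] // k2.
    by rewrite -[RHS]w0; congr (w _ _); apply/val_inj.
  by rewrite -[RHS]w1; congr (w _ _); apply/val_inj.
apply: Or31; split=> //; apply/(gamma_null_quadrics gamE) => k k7.
by rewrite chart_point_zero_c // ltnW.
Qed.

End Chart.

Section VanishingIdeal.

Variable K : fieldType.
Local Notation A := {mpoly K[2 * 7]}.
Local Notation x := (xenv K).

Variable J : A -> Prop.
Hypothesis J0 : J 0.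
Hypothesis JD : forall f g, J f -> J g -> J (f + g).
Hypothesis JM : forall f g, J g -> J (f * g).
Hypothesis Jquadrics : forall i, (3 <= i < 8)%N -> J (peval x (quadrics2 i 0)).
Hypothesis J_zero_locus : forall (L : fieldType) (iota : {rmorphism K -> L})
  (phi : 'M[L]_(2, 7)) f, zero_locus phi -> J f -> eval_at iota f phi = 0.
Hypothesis J_nonzerodivisor : forall f, J (x 0 * f) -> J f.

(** The test point is generic: its free coordinates are the corresponding variables of A, in the
    fraction field. Evaluation [sigma] at this point therefore fixes the polynomials in the free
    coordinates, so that such a polynomial is zero when it vanishes there. *)
Let L : fieldType := {fraction A}.
Let iota : {rmorphism K -> L} := (@tofrac A \o @mpolyC (2 * 7) K)%FUN.
Let y k : L := tofrac (x k).
Let sigma (f : A) : L := eval_at iota f (chart_point y).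

Let sigmaD f g : sigma (f + g) = sigma f + sigma g.
Proof. by rewrite /sigma /eval_at !rmorphD. Qed.

Let sigmaM f g : sigma (f * g) = sigma f * sigma g.
Proof. by rewrite /sigma /eval_at !rmorphM. Qed.

Let sigma_var k : (k < 14)%N -> sigma (x k) = (chart_coord y)`_k.
Proof.
move=> k14; rewrite -env_chart_point // -[RHS]peval_var -(eval_at_peval iota).
by rewrite peval_var.
Qed.

Let y0 : y 0 != 0.
Proof.
rewrite tofrac_eq0; apply/eqP => /(congr1 (mcoeff U_(var_index 0))).
by rewrite mcoeffX eqxx mcoeff0 => /eqP; rewrite oner_eq0.
Qed.

Let minor_neq0 : y 0 * y 8 - y 1 * y 7 != 0.
Proof.
rewrite /y -!tofracM -tofracB tofrac_eq0; apply/eqP.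
move=> /(congr1 (mcoeff (U_(var_index 0) + U_(var_index 8))%MM)).
rewrite /xenv -!mpolyXD mcoeffB !mcoeffX eqxx mcoeff0.
case: eqP => [/mnmP/(_ (var_index 0))|_].
  rewrite !mnmDE !mnm1E eqxx.
  by do 3 (case: eqP => [/(congr1 var_rank)|_]; first by rewrite !var_indexK).
by rewrite subr0 => /eqP; rewrite oner_eq0.
Qed.

(* f agrees on the chart with a polynomial in the coordinates of the chart.    *)
Let S f := exists N g, sigma g = tofrac g /\ J (x 0 ^+ N * f - g).

Let SD f g : S f -> S g -> S (f + g).
Proof.
move=> [N [f' [f'E Jf]]] [M [g' [g'E Jg]]].
exists (N + M)%N, (x 0 ^+ M * f' + x 0 ^+ N * g'); split.
  have sX k : sigma (x 0 ^+ k) = tofrac (x 0 ^+ k).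
    elim: k => [|k IH]; first by rewrite expr0 /sigma /eval_at !rmorph1.
    by rewrite exprS sigmaM sigma_var // IH tofracM.
  by rewrite sigmaD !sigmaM f'E g'E !sX tofracD !tofracM.
rewrite (_ : _ - _ = x 0 ^+ M * (x 0 ^+ N * f - f') + x 0 ^+ N * (x 0 ^+ M * g - g')).
  by apply: JD; apply: JM.
by rewrite exprD; ring.
Qed.

Let SM f g : S f -> S g -> S (f * g).
Proof.
move=> [N [f' [f'E Jf]]] [M [g' [g'E Jg]]].
exists (N + M)%N, (f' * g'); split; first by rewrite sigmaM f'E g'E tofracM.
rewrite (_ : _ - _ = (x 0 ^+ M * g) * (x 0 ^+ N * f - f') + f' * (x 0 ^+ M * g - g')).
  by apply: JD; apply: JM.
by rewrite exprD; ring.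
Qed.

Let SC c : S c%:MP.
Proof.
exists 0%N, c%:MP; rewrite mul1r subrr; split=> //.
by rewrite /sigma /eval_at map_mpolyC mevalC.
Qed.

Let Sfree k : (k < 14)%N -> (chart_coord y)`_k = y k -> S (x k).
Proof.
move=> k14 kE; exists 0%N, (x k); rewrite mul1r subrr; split=> //.
by rewrite sigma_var.
Qed.

Let Sdiv f h : J (x 0 * f - h) -> S h -> S f.
Proof.
move=> Jf [N [g [gE Jh]]]; exists N.+1, g; split=> //.
rewrite (_ : _ - _ = x 0 ^+ N * (x 0 * f - h) + (x 0 ^+ N * h - g)).
  by apply: JD => //; apply: JM.
by rewrite exprS; ring.
Qed.

Let SN f : S f -> S (- f).
Proof.
by move=> Sf; rewrite -mulN1r -(rmorphN1 (@mpolyC (2 * 7) K)); apply: SM (SC _) Sf.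
Qed.

Let Svar k : (k < 14)%N -> S (x k).
Proof.
have Jq i c f : (3 <= i < 8)%N -> f = c%:~R * peval x (quadrics2 i 0) -> J f.
  by move=> i8 ->; apply/JM/Jquadrics.
have eqs := (peval_cons, peval_nil, big_cons, big_nil).
have free i : (i < 6)%N || (6 < i < 10)%N -> S (x i).
  by move: i; do 10 (case=> [|]; first by [|move=> _; apply: Sfree]).
(* The remaining coordinates come in the order u_7, v_4, v_5, v_6, v_7. Each is multiplied by u_1,
   up to sign, in one of the five equations, whose other terms involve only coordinates already
   treated. *)
have S6 : S (x 6).
  apply: (@Sdiv _ (x 1 * x 5 + x 2 * x 4 - x 3 * x 3)).
    by apply: (Jq 7 1) => //; rewrite /quadrics2 /= !eqs /moneval /= !eqs ?add0n; ring.
  by repeat first [assumption | by apply: free | apply: SD | apply: SN | apply: SM].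
have S10 : S (x 10).
  apply: (@Sdiv _ (x 3 * x 7 + x 1 * x 9 - x 2 * x 8)).
    by apply: (Jq 6 1) => //; rewrite /quadrics2 /= !eqs /moneval /= !eqs ?add0n; ring.
  by repeat first [assumption | by apply: free | apply: SD | apply: SN | apply: SM].
have S11 : S (x 11).
  apply: (@Sdiv _ (x 4 * x 7 + x 1 * x 10 - x 3 * x 8)).
    by apply: (Jq 5 (-1)) => //; rewrite /quadrics2 /= !eqs /moneval /= !eqs ?add0n; ring.
  by repeat first [assumption | by apply: free | apply: SD | apply: SN | apply: SM].
have S12 : S (x 12).
  apply: (@Sdiv _ (x 5 * x 7 - x 2 * x 10 + x 3 * x 9)).
    by apply: (Jq 4 1) => //; rewrite /quadrics2 /= !eqs /moneval /= !eqs ?add0n; ring.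
  by repeat first [assumption | by apply: free | apply: SD | apply: SN | apply: SM].
have S13 : S (x 13).
  apply: (@Sdiv _ (x 6 * x 7 - x 1 * x 12 + x 5 * x 8 - x 2 * x 11 + x 4 * x 9)).
    by apply: (Jq 3 (-1)) => //; rewrite /quadrics2 /= !eqs /moneval /= !eqs ?add0n; ring.
  by repeat first [assumption | by apply: free | apply: SD | apply: SN | apply: SM].
by move: k; do 14 (case=> [|]; first by [|move=> _; apply: free]).
Qed.

Let Sall f : S f.
Proof.
elim/mpolyind: f => [|c m f _ _ Sf].
  by rewrite -(rmorph0 (@mpolyC (2 * 7) K)); apply: SC.
apply: SD => //; rewrite -mul_mpolyC; apply: SM; first exact: SC.
have S1 : S 1 by rewrite -(rmorph1 (@mpolyC (2 * 7) K)); apply: SC.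
rewrite mpolyXE_id; apply: (big_ind S) => // i _.
elim: (m i) => [|k IH]; first by rewrite expr0.
rewrite exprS; apply: SM => //; case/mxvec_indexP: i {IH} => a j.
rewrite -var_index_entry; apply: Svar.
by case: a j => -[|[|]] //= _ [j j7] /=; rewrite ?muln0 ?muln1 ?ltn_add2l // (leq_trans j7).
Qed.

Lemma vanishing_ideal f : ideal_Y2 (gamma0 K) f <-> J f.
Proof.
split=> [If|Jf L' iota' phi iso]; last first.
  apply: J_zero_locus Jf; apply: isotropic_zero_locus iso => a b c.
  by rewrite /gamma_map gamma0E rmorph_int.
have [N [g [gE Jg]]] := Sall f.
have iso : isotropic (gamma_map iota (gamma0 K)) (chart_point y).
  apply: chart_point_isotropic => // a b c.
  by rewrite /gamma_map gamma0E rmorph_int.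
have zl : zero_locus (chart_point y).
  apply: isotropic_zero_locus iso => a b c.
  by rewrite /gamma_map gamma0E rmorph_int.
(* Both f and the elements of J vanish at the generic isotropic point, hence so does g, whose value
   there is g itself. It then remains to cancel a power of u_1 modulo J. *)
have g0 : g = 0.
  apply/eqP; rewrite -tofrac_eq0 -gE.
  have sf : sigma (x 0 ^+ N * f) = 0 by rewrite sigmaM [sigma f](If _ _ _ iso) mulr0.
  have : sigma (x 0 ^+ N * f - g) = 0 by exact: J_zero_locus zl Jg.
  by rewrite sigmaD sf add0r /sigma /eval_at !rmorphN => /eqP; rewrite oppr_eq0.
move: Jg; rewrite g0 subr0; elim: N => [|N IH]; first by rewrite expr0 mul1r.
by rewrite exprS -mulrA => /J_nonzerodivisor.
Qed.

End VanishingIdeal.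

(** * From computed certificates to minimal resolutions *)

Section CertifiedIdeal.

Variable K : fieldType.
Local Notation A := {mpoly K[2 * 7]}.
Variables (rk : nat -> nat) (dg : nat -> nat -> nat) (pD : nat -> pmx).
Variables (c N : int) (pS : nat -> nat -> pmx) (P Q : pmx) (M : int).

Hypotheses (rk0 : rk 0 = 1%N) (rk1 : rk 1 = 10%N).
Hypotheses (rk_gt5 : forall i, (5 < i)%N -> rk i = 0%N).
Hypotheses (dg0 : dg 0 0 = 0%N) (c0 : c%:~R = 0 :> K).
Hypotheses (N0 : N%:~R != 0 :> K) (M0 : M%:~R != 0 :> K).
Hypotheses (complexP : pcheck_complex rk pD c) (degreesP : pcheck_degrees rk dg pD).
Hypotheses (homotopyP : pcheck_homotopy rk pD c N leading_system pS).
Hypotheses (PE : pmxeq 0 10 1 (pD 0) (pmulmx 10 P quadrics2)).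
Hypotheses (QE : pmxeq 0 10 1 (pscalemx M quadrics2) (pmulmx 10 Q (pD 0))).

Lemma leading_system_regular :
  regular_mod [::] [seq peval (xenv K) p | p <- leading_system] /\
  regular_mod [:: xenv K 0] [seq peval (xenv K) p | p <- leading_system].
Proof.
split; first by apply: (@pregular K leading_weights).
have := @pregular K leading_weights _ leading_system_lead leading_system_coprime isT.
by rewrite map_cons peval_var => -[].
Qed.

Lemma certified_ideal f : pideal rk pD f <-> ideal_Y2 (gamma0 K) f.
Proof.
have [reg reg_u] := leading_system_regular.
apply: iff_sym; apply: vanishing_ideal.
- by exists (fun=> 0); rewrite big1 // => k _; rewrite mul0r.
- move=> _ _ [b ->] [b' ->]; exists (fun k => b k + b' k).
  by rewrite -big_split; apply: eq_bigr => k _; rewrite mulrDl.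
- move=> g _ [b ->]; exists (fun k => g * b k).
  by rewrite mulr_sumr; apply: eq_bigr => k _; rewrite mulrA.
- move=> i /andP[_ i8]; have i10 : (i < 10)%N by rewrite (leq_trans i8).
  have := mxeval_eq (c := 0) (xenv K) erefl QE.
  move/matrixP/(_ (Ordinal i10) 0); rewrite -mxeval_scale -mxeval_mul.
  rewrite mxE [mxeval _ _ _ _ _ _]mxE /= mxE => E.
  exists (fun k => (M%:~R^-1)%:MP * peval (xenv K) (Q i k)); rewrite rk1.
  under eq_bigr do rewrite -mulrA.
  rewrite -mulr_sumr.
  transitivity ((M%:~R^-1)%:MP * (M%:~R * peval (xenv K) (quadrics2 i 0))).
    rewrite mulrA -(rmorph_int (@mpolyC (2 * 7) K)) -rmorphM mulVf //.
    by rewrite rmorph1 mul1r.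
  by rewrite E; congr (_ * _); apply: eq_bigr => k _; rewrite !mxE.
- move=> L iota phi _ z [b ->]; rewrite rk1.
  apply: (big_ind (fun h => eval_at iota h phi = 0)) => [|h h' hE h'E|k _].
  + exact: eval_at0.
  + by rewrite eval_atD hE h'E addr0.
  rewrite eval_atM eval_at_peval.
  have := mxeval_eq (c := 0) (env phi) erefl PE.
  move/matrixP/(_ k 0); rewrite -mxeval_mul [mxeval _ 10 1 quadrics2]z mulmx0 !mxE => ->.
  by rewrite mulr0.
- move=> g; apply: (pideal_nonzerodivisor rk0 rk_gt5 c0 N0 complexP homotopyP) => //.
  apply/lregP; apply/eqP => /(congr1 (mcoeff U_(var_index 0))).
  by rewrite mcoeffX eqxx mcoeff0 => /eqP; rewrite oner_eq0.
Qed.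

Lemma certified_resolves : resolves (ideal_Y2 (gamma0 K)) (pcomplex K rk dg pD).
Proof.
have [reg _] := leading_system_regular.
have [hom surj ex0 ex] := pdiff_resolves rk0 rk_gt5 dg0 c0 N0 complexP degreesP homotopyP isT reg.
split=> // [p|v].
  by have [v /certified_ideal vp] := surj p; exists v.
by rewrite -certified_ideal; apply: ex0.
Qed.

Lemma certified_minimal : minimal (pcomplex K rk dg pD).
Proof. by apply: pcomplex_minimal. Qed.

End CertifiedIdeal.

(** The conversion rests on two facts: the polar form at (u, u) is 2 q0 (u), and the polar form at
    (u, v) is twice [half_polar] minus c_4. Inverting it costs a factor 2. *)
Definition to_quadrics : pmx := sparse_mx
  ([seq T0 i i 2 | i <- iota 0 7]
   ++ [:: T0 7 7 1; T0 8 9 1; T0 9 8 1; T0 9 3 1]).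

Definition of_quadrics : pmx := sparse_mx
  ([seq T0 i i 1 | i <- iota 0 7]
   ++ [:: T0 7 7 2; T0 8 9 2; N0 8 3 1; T0 9 8 2]).

Lemma of_quadricsP :
  pmxeq 0 10 1 (resolution_diff 0) (pmulmx 10 of_quadrics quadrics2).
Proof. by vm_compute. Qed.

Lemma to_quadricsP :
  pmxeq 0 10 1 (pscalemx 2 quadrics2) (pmulmx 10 to_quadrics (resolution_diff 0)).
Proof. by vm_compute. Qed.

Lemma of_quadrics2P :
  pmxeq 0 10 1 (resolution2_diff 0) (pmulmx 10 p1mx quadrics2).
Proof. by vm_compute. Qed.

Lemma to_quadrics2P :
  pmxeq 0 10 1 (pscalemx 1 quadrics2) (pmulmx 10 p1mx (resolution2_diff 0)).
Proof. by vm_compute. Qed.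

(** Ranks and degrees are given only up to pointwise equality, so that the statement also applies
    when the ranks are dimensions of representations. *)
Lemma resolution_resolves (K : fieldType) (rk : nat -> nat) (dg : nat -> nat -> nat) :
  2%N \notin [pchar K] -> rk =1 resolution_rank ->
  (forall i, dg i =1 resolution_deg i) ->
  resolves (ideal_Y2 (gamma0 K)) (pcomplex K rk dg resolution_diff) /\
  minimal (pcomplex K rk dg resolution_diff).
Proof.
move=> ch2 rkE dgE.
have two0 : 2%:~R != 0 :> K.
  by apply: contra ch2 => two0; rewrite inE /=.
have rk_gt5 i : (5 < i)%N -> rk i = 0%N.
  by rewrite rkE /resolution_rank => i5; rewrite nth_default.
have complexP : pcheck_complex rk resolution_diff 0.
  by apply: etrans resolution_complex; apply: eq_all => i; rewrite !rkE.
have degreesP : pcheck_degrees rk dg resolution_diff.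
  apply: etrans resolution_degrees; apply: eq_all => i; rewrite !rkE.
  by apply: eq_all => s; apply: eq_all => t; rewrite !dgE.
have homotopyP : pcheck_homotopy rk resolution_diff 0 8 leading_system resolution_homotopy.
  by apply: etrans resolution_homotopyP; apply: eq_all => j; apply: eq_all => i; rewrite !rkE.
have eight0 : 8%:~R != 0 :> K.
  by rewrite (_ : 8 = 2 * 2 * 2) // !intrM !mulf_neq0.
split; last exact: (certified_minimal K rk_gt5 degreesP).
by apply: (@certified_resolves K rk dg _ 0 8 _ _ _ 2 _ _ rk_gt5 _ _ eight0 two0 complexP degreesP
  homotopyP of_quadricsP to_quadricsP); rewrite ?rkE ?dgE.
Qed.

Lemma resolution2_resolves (K : fieldType) : 2%N \in [pchar K] ->
  resolves (ideal_Y2 (gamma0 K))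
           (pcomplex K resolution2_rank resolution2_deg resolution2_diff) /\
  minimal (pcomplex K resolution2_rank resolution2_deg resolution2_diff).
Proof.
move=> ch2.
have two0 : 2%:~R = 0 :> K by exact: (pcharf0 ch2).
have rk_gt5 i : (5 < i)%N -> resolution2_rank i = 0%N.
  by rewrite /resolution2_rank => i5; rewrite nth_default.
have one0 : 1%:~R != 0 :> K by rewrite oner_eq0.
split; last exact: (certified_minimal K rk_gt5 resolution2_degrees).
by apply: (@certified_resolves K _ _ _ 2 1 _ _ _ 1 _ _ rk_gt5 _ two0 one0 one0 resolution2_complex
  resolution2_degrees resolution2_homotopyP of_quadrics2P to_quadrics2P).
Qed.

(** * Change of coordinates *)

Section TransportResolution.

Variables (n : nat) (K : fieldType).
Local Notation A := {mpoly K[n]}.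
Variables (I I' : A -> Prop) (F : free_complex n K).
Variables tau tau' : {rmorphism A -> A}.
Hypotheses (tauK : cancel tau tau') (tau'K : cancel tau' tau).
Hypothesis tau_homogeneous : forall d p,
  homogeneous_of_degree d p -> homogeneous_of_degree d (tau p).
Hypothesis tau_coeff0 : forall p, (tau p)@_0%MM = p@_0%MM.
Hypothesis II' : forall p, I' p <-> I (tau' p).
Variables T T' : forall i, 'M[A]_(grank F i).
Hypotheses (TT' : forall i, T i *m T' i = 1%:M) (T'T : forall i, T' i *m T i = 1%:M).
Hypothesis T_homogeneous : forall i, homogeneous_mx (gdeg (i := i)) (gdeg (i := i)) (T i).
Hypothesis T'_homogeneous : forall i, homogeneous_mx (gdeg (i := i)) (gdeg (i := i)) (T' i).

(** The ring automorphism [tau] moves the ideal I to I', and [T] changes the basis of each term. For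
    the Betti numbers T is the identity; for equivariance it is the action of the matrix P on the
    representations. *)
Definition transport_complex : free_complex n K :=
  @FreeComplex n K (grank F) (gdeg (f := F))
    (fun i => T i.+1 *m map_mx tau (gdiff F i) *m T' i)
    (T 0 *m map_mx tau (gaug F)).

Let mapK a b (M : 'M[A]_(a, b)) : map_mx tau (map_mx tau' M) = M.
Proof. by apply/matrixP => s t; rewrite !mxE tau'K. Qed.

Let mapK' a b (M : 'M[A]_(a, b)) : map_mx tau' (map_mx tau M) = M.
Proof. by apply/matrixP => s t; rewrite !mxE tauK. Qed.

Let tau_homogeneous_mx a b (da : 'I_a -> int) (db : 'I_b -> int) M :
  homogeneous_mx da db M -> homogeneous_mx da db (map_mx tau M).
Proof. by move=> Mh s t; rewrite mxE; apply: tau_homogeneous. Qed.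

Lemma transport_resolves : resolves I F -> resolves I' transport_complex.
Proof.
move=> [[dh ah] surj ex0 ex].
have imE m i (u : 'M_(m, _)) : (exists w, map_mx tau' (u *m T i) = w *m gdiff F i) <->
    exists w, u = w *m gdiff transport_complex i.
  split=> [[w wE]|[w ->]].
    exists (map_mx tau w *m T' i.+1) => /=.
    rewrite -!mulmxA (mulmxA (T' _)) T'T mul1mx mulmxA -map_mxM -wE mapK.
    by rewrite -mulmxA TT' mulmx1.
  exists (map_mx tau' (w *m T i.+1)) => /=.
  by rewrite -!mulmxA T'T mulmx1 mulmxA map_mxM mapK'.
split=> /=.
- split=> [i s t|s].
    have := homogeneous_mx_mul (homogeneous_mx_mul (@T_homogeneous i.+1)
      (tau_homogeneous_mx (dh i))) (@T'_homogeneous i).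
    exact.
  pose d1 (_ : 'I_1) : int := 0.
  have hF : homogeneous_mx (gdeg (i := 0)) d1 (gaug F).
    by move=> t u; rewrite ord1 subr0.
  have := homogeneous_mx_mul (@T_homogeneous 0) (tau_homogeneous_mx hF) s 0.
  by rewrite subr0.
- move=> p; have [v vp] := surj (tau' p); exists (map_mx tau v *m T' 0).
  apply/II'; rewrite -mulmxA (mulmxA (T' 0)) T'T mul1mx -map_mxM mxE.
  by rewrite rmorphB /= tauK.
- move=> v; rewrite II' -imE -ex0 mulmxA.
  have -> : v *m T 0 *m map_mx tau (gaug F) =
            map_mx tau (map_mx tau' (v *m T 0) *m gaug F) by rewrite map_mxM mapK.
  by rewrite [map_mx tau _ 0 0]mxE tauK.
- move=> i v; rewrite -imE -ex.
  have -> : v *m (T i.+1 *m map_mx tau (gdiff F i) *m T' i) =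
            map_mx tau (map_mx tau' (v *m T i.+1) *m gdiff F i) *m T' i.
    by rewrite map_mxM mapK !mulmxA.
  split=> [vd|->]; last by rewrite map_mx0 mul0mx.
  rewrite -[LHS]mapK' -[RHS]mapK' map_mx0; congr (map_mx _ _).
  by have := congr1 (mulmx^~ (T i)) vd; rewrite /= -mulmxA T'T mulmx1 mul0mx.
Qed.

Lemma transport_minimal : minimal F -> minimal transport_complex.
Proof.
move=> minF i; rewrite /reduced_diff /= !red_mul.
have -> : map_mx (mcoeff 0%MM) (map_mx tau (gdiff F i)) = 0.
  by apply/matrixP => s t; have /matrixP/(_ s t) := minF i; rewrite !mxE tau_coeff0.
by rewrite mulmx0 mul0mx.
Qed.

End TransportResolution.

Lemma mpoly_rmorph_ext n (R : comNzRingType) (S : comNzRingType)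
    (f g : {rmorphism {mpoly R[n]} -> S}) :
  (forall c, f c%:MP = g c%:MP) -> (forall i, f 'X_i = g 'X_i) -> f =1 g.
Proof.
move=> fgC fgX p; elim/mpolyind: p => [|c m p _ _ IH]; first by rewrite !rmorph0.
rewrite !rmorphD IH -!mul_mpolyC !rmorphM fgC mpolyXE_id !rmorph_prod.
by congr (_ * _ + _); apply: eq_bigr => i _; rewrite !rmorphXn fgX.
Qed.

(** * Linear substitutions in the coordinate ring *)

Section LinearSubstitution.

Variable R : comNzRingType.
Local Notation A := {mpoly R[2 * 7]}.
Local Notation C := (map_mx (@mpolyC (2 * 7) R)).

(** As a function on maps the result is phi |-> f (g phi h), so that [poly_act g h] is
    [linear_subst g (invmx h)]. Writing h and not its inverse keeps this defined for every
    matrix. *)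
Definition linear_subst (g : 'M[R]_2) (h : 'M[R]_7) : A -> A :=
  comp_mpoly [tuple (mxvec (C g *m generic_mx R *m C h)) 0 i | i < 2 * 7].
HB.instance Definition _ g h := GRing.RMorphism.on (linear_subst g h).

Lemma linear_subst_generic g h :
  map_mx (linear_subst g h) (generic_mx R) = C g *m generic_mx R *m C h.
Proof.
apply/matrixP => a k; rewrite [LHS]mxE [in LHS]mxE /linear_subst comp_mpolyXU.
by rewrite -tnth_nth tnth_mktuple mxvecE.
Qed.

Lemma linear_substC g h c : linear_subst g h c%:MP = c%:MP.
Proof. exact: comp_mpolyC. Qed.

Lemma map_linear_substC g h m n (M : 'M[R]_(m, n)) :
  map_mx (linear_subst g h) (C M) = C M.
Proof. by apply/matrixP => a k; rewrite !mxE linear_substC. Qed.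

Lemma linear_substX g h a k : linear_subst g h 'X_(mxvec_index a k) =
  (C g *m generic_mx R *m C h) a k.
Proof. by rewrite -linear_subst_generic !mxE. Qed.

Lemma linear_subst_comp g h g' h' f :
  linear_subst g h (linear_subst g' h' f) = linear_subst (g' *m g) (h *m h') f.
Proof.
apply: (@mpoly_rmorph_ext _ _ _ (linear_subst g h \o linear_subst g' h')%FUN
  (linear_subst (g' *m g) (h *m h'))) => [c|i] /=.
  by rewrite !linear_substC.
case/mxvec_indexP: i => a k; rewrite !linear_substX.
have := congr1 (fun M : 'M__ => M a k) (map_mxM (linear_subst g h)
  (C g' *m generic_mx R) (C h')).
rewrite /= [LHS]mxE => ->.
rewrite map_mxM !map_linear_substC linear_subst_generic !map_mxM !mulmxA //.
Qed.

Lemma linear_subst1 f : linear_subst 1%:M 1%:M f = f.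
Proof.
apply: (@mpoly_rmorph_ext _ _ _ (linear_subst 1%:M 1%:M) idfun) => [c|i] /=.
  exact: linear_substC.
case/mxvec_indexP: i => a k; rewrite linear_substX.
by rewrite !map_mx1 mul1mx mulmx1 mxE.
Qed.

Lemma eval_at_linear_subst (g : 'M[R]_2) (h : 'M[R]_7) (L : comNzRingType)
    (iota : {rmorphism R -> L}) phi f :
  eval_at iota (linear_subst g h f) phi =
  eval_at iota f (map_mx iota g *m phi *m map_mx iota h).
Proof.
apply: (@mpoly_rmorph_ext _ _ _
  (mpoly.meval (mxvec phi 0) \o map_mpoly iota \o linear_subst g h)%FUN
  (mpoly.meval (mxvec (map_mx iota g *m phi *m map_mx iota h) 0)
   \o map_mpoly iota)%FUN) => [c|i] /=.
  by rewrite linear_substC !map_mpolyC !mevalC.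
case/mxvec_indexP: i => a k; rewrite linear_substX.
rewrite map_mpolyX mevalXU mxvecE.
transitivity ((map_mx (mpoly.meval (mxvec phi 0) \o map_mpoly iota)%FUN
  (C g *m generic_mx R *m C h)) a k); first by rewrite [RHS]mxE.
rewrite !map_mxM; congr ((_ *m _ *m _) a k); apply/matrixP => i j.
- by rewrite !mxE /= map_mpolyC mevalC.
- by rewrite !mxE /= map_mpolyX mevalXU mxvecE.
- by rewrite !mxE /= map_mpolyC mevalC.
Qed.

Lemma linear_subst_coeff0 g h f : (linear_subst g h f)@_0%MM = f@_0%MM.
Proof.
apply: (@mpoly_rmorph_ext _ _ _ (mcoeff 0%MM \o linear_subst g h)%FUN
  (mcoeff 0%MM)) => [c|i] /=; first by rewrite linear_substC.
case/mxvec_indexP: i => a k; rewrite linear_substX.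
transitivity ((map_mx (mcoeff 0%MM) (C g *m generic_mx R *m C h)) a k).
  by rewrite [RHS]mxE.
rewrite !(map_mxM (mcoeff 0%MM : {rmorphism A -> R})).
have -> : map_mx (mcoeff 0%MM) (generic_mx R) = 0 :> 'M[R]_(2, 7).
  by apply/matrixP => i j; rewrite !mxE mcoeffX mnm1_eq0.
by rewrite mulmx0 mul0mx mxE mcoeffX mnm1_eq0.
Qed.

End LinearSubstitution.

Lemma linear_subst_homogeneous (K : fieldType) g h d (p : {mpoly K[2 * 7]}) :
  homogeneous_of_degree d p -> homogeneous_of_degree d (linear_subst g h p).
Proof.
case: d => [d|d] /=; last by move=> ->; rewrite rmorph0.
move=> pd; rewrite [p]mpolyE rmorph_sum /= big_seq; apply: rpred_sum => m mp.
rewrite -mul_mpolyC rmorphM /= linear_substC mul_mpolyC; apply: rpredZ.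
have md := dhomog_mf pd mp; rewrite -md {md}.
have lin i : linear_subst g h 'X_i \is 1.-homog.
  case/mxvec_indexP: i => a k; rewrite linear_substX mxE; apply: rpred_sum => j _.
  rewrite [X in _ * X]mxE mulrC mul_mpolyC; apply: rpredZ.
  rewrite mxE; apply: rpred_sum => l _; rewrite [X in X * _]mxE mul_mpolyC.
  by apply: rpredZ; rewrite mxE dhomogX; apply/eqP/mdeg1.
rewrite mpolyXE_id rmorph_prod /=. rewrite mdegE.
elim/big_rec2: _ => [|i p' e _ ep']; first exact: dhomog1.
apply: dhomogM => //; by have := dhomogMn (m i) (lin i); rewrite mul1n rmorphXn.
Qed.

(** The ideal is the image under the augmentation of the boundaries in F_0, and both maps are
    homogeneous. This supplies the homogeneity needed to compare resolutions. *)
Lemma resolves_ideal_homogeneous n (K : fieldType) (I : {mpoly K[n]} -> Prop)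
    (F : free_complex n K) e p : resolves I F ->
  (forall p, exists v : 'rV_(grank F 0), (v *m gaug F) 0 0 = p) -> I p -> I (hpart e p).
Proof.
move=> [[dF augF] _ ex0 _] surj; have [v <-] := surj p => /ex0 [w ->].
pose d0 (_ : 'I_1) : int := 0; pose de (_ : 'I_1) : int := e.
have hF : homogeneous_mx (gdeg (i := 0)) d0 (gaug F).
  by move=> s u; rewrite ord1 subr0.
have -> : hpart e ((w *m gdiff F 0 *m gaug F) 0 0) =
    hmx de d0 (w *m gdiff F 0 *m gaug F) 0 0 by rewrite [RHS]mxE /d0 subr0.
rewrite (hmx_mulr _ _ hF) (hmx_mulr _ _ (dF 0)).
by apply/ex0; exists (hmx de (gdeg (i := 1)) w).
Qed.

Lemma minimal_betti_table n (K : fieldType) (I : {mpoly K[n]} -> Prop)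
    (F : free_complex n K) (tbl : seq (nat * nat * nat)) :
  I 0 -> (forall p q, I p -> I q -> I (p + q)) -> (forall p q, I q -> I (p * q)) ->
  resolves I F -> minimal F -> (forall p, exists v : 'rV_(grank F 0), (v *m gaug F) 0 0 = p) ->
  (forall i j, (\sum_(s < grank F i) (gdeg s == j))%N =
     (\sum_(t <- tbl | (t.1.1 == i) && (t.1.2%:Z == j)) t.2)%N) ->
  betti_table I tbl.
Proof.
move=> I0 ID IM resF minF surj tblE i j; split=> [|G resG]; first by exists F.
have Ih e p := @resolves_ideal_homogeneous n K I F e p resF surj.
by rewrite (tor_dim_eq I0 ID IM Ih i j resG resF) tor_dim_minimal.
Qed.

(** * Pullback of forms, isotropic subspaces and the ideal *)

Section TrilinearForms.

Variable R : comUnitRingType.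
Implicit Types (gam : trilinear R) (u v w : 'rV[R]_7).

Lemma eq_trilin_eval gam gam' u v w : (forall a b c, gam a b c = gam' a b c) ->
  trilin_eval gam u v w = trilin_eval gam' u v w.
Proof. by move=> E; do 3 (apply: eq_bigr => ? _); rewrite E. Qed.

Lemma trilin_evalE gam u v w : trilin_eval gam u v w =
  \sum_a u 0 a * (\sum_b v 0 b * (\sum_c w 0 c * gam a b c)).
Proof.
apply: eq_bigr => a _; rewrite mulr_sumr; apply: eq_bigr => b _.
rewrite mulr_sumr mulr_sumr; apply: eq_bigr => c _; ring.
Qed.

Lemma trilin_eval_pull (P : 'M[R]_7) gam u v w :
  trilin_eval (gamma_pull P gam) u v w =
  trilin_eval gam (u *m P) (v *m P) (w *m P).
Proof.
have lin (x : 'rV[R]_7) (F : 'I_7 -> R) :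
    \sum_c (x *m P) 0 c * F c = \sum_c x 0 c * (\sum_k P c k * F k).
  under eq_bigr do rewrite mxE mulr_suml.
  rewrite exchange_big; apply: eq_bigr => c _.
  by rewrite mulr_sumr; apply: eq_bigr => k _; rewrite mulrA.
rewrite [RHS]trilin_evalE lin trilin_evalE; apply: eq_bigr => a _; congr (_ * _).
under [RHS]eq_bigr do rewrite lin mulr_sumr.
rewrite exchange_big; apply: eq_bigr => b _.
under [RHS]eq_bigr do rewrite mulrCA.
rewrite -mulr_sumr; congr (_ * _).
under [RHS]eq_bigr do (under eq_bigr do rewrite lin mulr_sumr).
under [RHS]eq_bigr do rewrite mulr_sumr.
under [RHS]eq_bigr do (under eq_bigr do rewrite mulr_sumr).
under [RHS]eq_bigr do rewrite exchange_big.
rewrite [RHS]exchange_big; apply: eq_bigr => c _ /=.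
rewrite /gamma_pull trilin_evalE mulr_sumr; apply: eq_bigr => k _.
rewrite mxE !mulr_sumr; apply: eq_bigr => l _.
rewrite mxE !mulr_sumr; apply: eq_bigr => m _; rewrite mxE; ring.
Qed.

End TrilinearForms.

Section IsotropicTransport.

Variables (L : fieldType) (P : 'M[L]_7) (gam gam' : trilinear L).
Hypothesis uP : P \in unitmx.
Hypothesis gamE : forall u v w,
  trilin_eval gam u v w = trilin_eval gam' (u *m P) (v *m P) (w *m P).

Lemma gamma_null_pull m (W : 'M[L]_(m, 7)) : gamma_null gam W -> gamma_null gam' (W *m P).
Proof.
move=> nW w w' v /submxP [a ->] /submxP [b ->]; rewrite !mulmxA -[v](mulmxKV uP).
by rewrite -gamE nW ?submxMl.
Qed.

Lemma isotropic_pull m (W : 'M[L]_(m, 7)) : isotropic gam W -> isotropic gam' (W *m P).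
Proof.
have rP k (M : 'M[L]_(k, 7)) : \rank (M *m P) = \rank M.
  by rewrite mxrankMfree // row_free_unit.
case=> [[rW nW]|[rW [W' [rW' nW' WW']]]|rW]; last by apply: Or33; rewrite rP.
  by apply: Or31; rewrite rP; split=> //; apply: gamma_null_pull.
apply: Or32; rewrite rP; split=> //; exists (W' *m P).
by rewrite rP; split=> //; [apply: gamma_null_pull | apply: submxMr].
Qed.

End IsotropicTransport.

Section IdealTransport.

Variables (K : fieldType) (gamma : trilinear K) (P : 'M[K]_7).
Hypothesis uP : P \in unitmx.
Hypothesis gammaE : forall a b c, gamma a b c = gamma_pull P (gamma0 K) a b c.

Lemma gamma_map_pull (L : comUnitRingType) (iota : {rmorphism K -> L}) (u v w : 'rV[L]_7) :
  trilin_eval (gamma_map iota gamma) u v w =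
  trilin_eval (gamma0 L) (u *m map_mx iota P) (v *m map_mx iota P) (w *m map_mx iota P).
Proof.
rewrite -trilin_eval_pull; apply: eq_trilin_eval => a b c.
rewrite /gamma_map gammaE /gamma_pull /trilin_eval !rmorph_sum.
apply: eq_bigr => i _; rewrite rmorph_sum; apply: eq_bigr => j _.
rewrite rmorph_sum; apply: eq_bigr => k _.
by rewrite !rmorphM !gamma0E rmorph_int !mxE.
Qed.

(** Multiplication by P sends gamma-isotropic subspaces to gamma0-isotropic ones, and its inverse
    sends them back, over every extension of K. *)
Lemma ideal_Y2_transport f :
  ideal_Y2 gamma f <-> ideal_Y2 (gamma0 K) (linear_subst 1%:M (invmx P) f).
Proof.
have uPL (L : fieldType) (iota : {rmorphism K -> L}) : map_mx iota P \in unitmx.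
  by rewrite map_unitmx.
have gE (L : fieldType) (iota : {rmorphism K -> L}) (u v w : 'rV[L]_7) :
    trilin_eval (gamma_map iota (gamma0 K)) u v w = trilin_eval (gamma0 L) u v w.
  by apply: eq_trilin_eval => a b c; rewrite /gamma_map !gamma0E rmorph_int.
split=> If L iota phi iso.
  rewrite eval_at_linear_subst map_mx1 mul1mx map_invmx; apply: If.
  apply: (isotropic_pull (gam := gamma_map iota (gamma0 K))) iso.
    by rewrite unitmx_inv uPL.
  by move=> u v w; rewrite gE gamma_map_pull !mulmxKV ?uPL.
have := If L iota (phi *m map_mx iota P).
rewrite eval_at_linear_subst map_mx1 mul1mx map_invmx mulmxK ?uPL //; apply.
apply: (isotropic_pull (gam := gamma_map iota gamma)) iso => [|u v w]; first exact: uPL.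
by rewrite gE gamma_map_pull.
Qed.

End IdealTransport.

Lemma ideal_Y2_ideal (K : fieldType) (gamma : trilinear K) :
  [/\ ideal_Y2 gamma 0,
      forall p q, ideal_Y2 gamma p -> ideal_Y2 gamma q -> ideal_Y2 gamma (p + q)
    & forall p q, ideal_Y2 gamma q -> ideal_Y2 gamma (p * q)].
Proof.
split=> [L iota phi _|p q Ip Iq L iota phi iso|p q Iq L iota phi iso].
- exact: eval_at0.
- by rewrite eval_atD Ip ?Iq ?addr0.
- by rewrite eval_atM Iq ?mulr0.
Qed.

(** * Resolutions and Betti tables for a general pair *)

Section TransportedResolution.

Variables (K : fieldType) (gamma : trilinear K) (P : 'M[K]_7).
Hypothesis uP : P \in unitmx.
Hypothesis gammaE : forall a b c, gamma a b c = gamma_pull P (gamma0 K) a b c.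
Variables (rk : nat -> nat) (dg : nat -> nat -> nat) (pD : nat -> pmx).
Hypothesis rk0 : rk 0 = 1%N.

Local Notation A := {mpoly K[2 * 7]}.
Local Notation F := (pcomplex K rk dg pD).

Variables T T' : forall i, 'M[A]_(rk i).
Hypotheses (TT' : forall i, T i *m T' i = 1%:M) (T'T : forall i, T' i *m T i = 1%:M).
Hypothesis T_homogeneous : forall i,
  homogeneous_mx (gdeg (f := F) (i := i)) (gdeg (f := F) (i := i)) (T i).
Hypothesis T'_homogeneous : forall i,
  homogeneous_mx (gdeg (f := F) (i := i)) (gdeg (f := F) (i := i)) (T' i).

Definition transported_complex : free_complex (2 * 7) K :=
  @transport_complex _ _ F (linear_subst 1%:M P) T T'.

Lemma transported_resolves : resolves (ideal_Y2 (gamma0 K)) F ->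
  resolves (ideal_Y2 gamma) transported_complex.
Proof.
apply: (@transport_resolves _ _ _ _ _ (linear_subst 1%:M P) (linear_subst 1%:M (invmx P))).
- by move=> f; rewrite /= linear_subst_comp mulmx1 mulVmx // linear_subst1.
- by move=> f; rewrite /= linear_subst_comp mulmx1 mulmxV // linear_subst1.
- by move=> d p; apply: linear_subst_homogeneous.
- by move=> p; rewrite (ideal_Y2_transport uP gammaE).
- exact: TT'.
- exact: T'T.
- exact: T_homogeneous.
- exact: T'_homogeneous.
Qed.

Lemma transported_minimal : minimal F -> minimal transported_complex.
Proof. by apply: transport_minimal => p; apply: linear_subst_coeff0. Qed.

Lemma transported_aug_surj p :
  exists v : 'rV_(rk 0), (v *m gaug transported_complex) 0 0 = p.
Proof.
exists (const_mx p *m T' 0) => /=; rewrite -mulmxA (mulmxA (T' 0)) T'T mul1mx.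
have s0 : (0 < rk 0)%N by rewrite rk0.
by rewrite mxeval_morph (mul_unit_aug _ _ (Ordinal s0)) // mxE.
Qed.

End TransportedResolution.

Lemma transported_betti_table (K : fieldType) (gamma : trilinear K) (P : 'M[K]_7)
    rk dg pD (tbl : seq (nat * nat * nat)) :
  P \in unitmx -> (forall a b c, gamma a b c = gamma_pull P (gamma0 K) a b c) ->
  rk 0 = 1%N -> resolves (ideal_Y2 (gamma0 K)) (pcomplex K rk dg pD) ->
  minimal (pcomplex K rk dg pD) ->
  (forall i j, (\sum_(s < rk i) ((dg i s)%:Z == j))%N =
     (\sum_(t <- tbl | (t.1.1 == i) && (t.1.2%:Z == j)) t.2)%N) ->
  betti_table (ideal_Y2 gamma) tbl.
Proof.
move=> uP gammaE rk0 resF minF tblE; have [I0 ID IM] := ideal_Y2_ideal gamma.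
pose T i : 'M[{mpoly K[2 * 7]}]_(rk i) := 1%:M.
have TT i : T i *m T i = 1%:M by rewrite mulmx1.
have Th i : homogeneous_mx (fun s => (dg i s)%:Z) (fun s => (dg i s)%:Z) (T i).
  move=> s t; rewrite mxE; have [->|_] := eqVneq s t; last first.
    by apply: homogeneousP => m _; rewrite mcoeff0.
  by rewrite subrr; apply: dhomog1.
have := transported_resolves uP gammaE TT TT Th Th resF.
move/(minimal_betti_table I0 ID IM); apply => //.
- exact: transported_minimal.
- exact: transported_aug_surj.
Qed.

Lemma resolution_betti i (j : int) :
  (\sum_(s < resolution_rank i) ((resolution_deg i s)%:Z == j))%N =
  (\sum_(t <- [:: (0, 0, 1); (1, 2, 10); (2, 3, 16);
              (3, 5, 16); (4, 6, 10); (5, 8, 1)]%N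
     | (t.1.1 == i) && (t.1.2%:Z == j)) t.2)%N.
Proof.
do 6 (case: i => [|i];
  first by rewrite !big_cons big_nil /= !big_ord_recl big_ord0 /=; case: (_ == j)).
by rewrite !big_cons big_nil /= /resolution_rank nth_default // big_ord0.
Qed.

Lemma resolution2_betti i (j : int) :
  (\sum_(s < resolution2_rank i) ((resolution2_deg i s)%:Z == j))%N =
  (\sum_(t <- [:: (0, 0, 1); (1, 2, 10); (2, 3, 16); (2, 4, 1);
              (3, 4, 1); (3, 5, 16); (4, 6, 10); (5, 8, 1)]%N
     | (t.1.1 == i) && (t.1.2%:Z == j)) t.2)%N.
Proof.
do 6 (case: i => [|i];
  first by rewrite !big_cons big_nil /= !big_ord_recl big_ord0 /=; do 2 ?case: (_ == j)).
by rewrite !big_cons big_nil /= /resolution2_rank nth_default // big_ord0.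
Qed.

(** * Equivariance *)

Section Formulas.

Variable S : comNzRingType.
Implicit Types (x y u v : 'rV[S]_7) (h : 'M[S]_7).

Definition gam_mx x : 'M[S]_7 :=
  \matrix_(k < 7, l < 7) \sum_(c < 7) (gamma_int k l c)%:~R * x 0 c.
Definition polar_mx : 'M[S]_7 := \matrix_(i < 7, j < 7) (polar_int i j)%:~R.
Definition copolar_mx : 'M[S]_7 := \matrix_(i < 7, j < 7) (copolar_int i j)%:~R.

Definition cross_mx x : 'M[S]_7 := gam_mx x *m copolar_mx.
Definition polar_col x : 'cV[S]_7 := polar_mx *m x^T.
Definition polar_form x y : 'M[S]_1 := x *m polar_mx *m y^T.
Definition gam_col x y : 'cV[S]_7 := gam_mx y *m x^T.
Definition cross_row x y : 'rV[S]_7 := (gam_col x y)^T *m copolar_mx.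

(** The five formulas are the matrices [pD1] to [pD5] over an arbitrary ring, in block form, so that
    equivariance can be proved block by block from the behaviour of the forms. *)
Definition formula1 u v : 'M[S]_(7 + (1 + (1 + 1)), 1) :=
  col_mx (gam_col u v)
    (col_mx (polar_form u u) (col_mx (polar_form u v) (polar_form v v))).

Definition formula2 u v : 'M[S]_((1 + 7) + (1 + 7), 7 + (1 + (1 + 1))) :=
  col_mx
    (block_mx u 0 (cross_mx u)
       (row_mx (polar_col v) (row_mx (- polar_col u) 0)))
    (block_mx v 0 (cross_mx v)
       (row_mx 0 (row_mx (polar_col v) (- polar_col u)))).

Definition sym_block x y : 'M[S]_(1 + 7) :=
  block_mx (- 2%:~R *: polar_form x y) 0 0
    ((2%:~R * polar_form x y 0 0)%:M
     - (polar_col x *m y + polar_col y *m x)).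

Definition skew_block x y : 'M[S]_(1 + 7) :=
  block_mx 0 (cross_row x y) (- 4%:~R *: gam_col x y)
    (polar_col x *m y - polar_col y *m x + cross_mx (cross_row x y)).

Definition formula3 u v : 'M[S]_((1 + 7) + (1 + 7)) :=
  block_mx (skew_block u v - sym_block u v) (sym_block u u)
    (- sym_block v v) (skew_block u v + sym_block u v).

Definition formula4 u v : 'M[S]_(7 + (1 + (1 + 1)), (1 + 7) + (1 + 7)) :=
  col_mx
    (row_mx (row_mx (- 2%:~R *: polar_col v) (cross_mx v))
            (row_mx (2%:~R *: polar_col u) (- cross_mx u)))
    (col_mx (row_mx (row_mx 0 (2%:~R *: u)) 0)
       (col_mx (row_mx (row_mx 0 v) (row_mx 0 u))
               (row_mx 0 (row_mx 0 (2%:~R *: v))))).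

Definition formula5 u v : 'M[S]_(1, 7 + (1 + (1 + 1))) :=
  row_mx (cross_row u v)
    (row_mx (polar_form v v) (row_mx (- 2%:~R *: polar_form u v) (polar_form u u))).

Section Evaluation.

Variable e : nat -> S.

Lemma mxeval_pint m n b :
  mxeval e m n (pint b) = \matrix_(i < m, j < n) (b i j)%:~R.
Proof.
apply/matrixP => i j; rewrite !mxE /pint.
by case: eqP => [->|_]; rewrite ?peval_nil // peval_const.
Qed.

Lemma mxeval_pGam P : mxeval e 7 7 (pGam P) = gam_mx (mxeval e 1 7 P).
Proof.
apply/matrixP => k l; rewrite !mxE /pGam peval_flatten big_map.
have -> : iota 0 7 = index_iota 0 7 by [].
by rewrite big_mkord; apply: eq_bigr => c _; rewrite peval_scale mxE.
Qed.

Lemma mxeval_scalar n p : mxeval e n n (pscalarmx p) = (peval e p)%:M.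
Proof.
apply/matrixP => i j; rewrite !mxE /pscalarmx -val_eqE /=.
by case: (_ == _); rewrite ?peval_nil.
Qed.

Lemma mxeval_block m1 m2 n1 n2 P Q R T :
  mxeval e (m1 + m2) (n1 + n2) (pblock m1 n1 P Q R T) =
  block_mx (mxeval e m1 n1 P) (mxeval e m1 n2 Q)
           (mxeval e m2 n1 R) (mxeval e m2 n2 T).
Proof. by rewrite /pblock -mxeval_col -!mxeval_row. Qed.

Lemma mxeval_pL P : mxeval e 7 7 (pL P) = cross_mx (mxeval e 1 7 P).
Proof. by rewrite /pL -(mxeval_mul _ 7 7) mxeval_pGam mxeval_pint. Qed.

Lemma mxeval_pbcol P : mxeval e 7 1 (pbcol P) = polar_col (mxeval e 1 7 P).
Proof. by rewrite /pbcol -(mxeval_mul _ 7 7) mxeval_pint -mxeval_tr. Qed.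

Lemma mxeval_pbil P Q :
  mxeval e 1 1 (pbil P Q) = polar_form (mxeval e 1 7 P) (mxeval e 1 7 Q).
Proof. by rewrite /pbil -(mxeval_mul _ 1 7) -(mxeval_mul _ 1 7) mxeval_pint -mxeval_tr. Qed.

Lemma mxeval_pcd P Q :
  mxeval e 7 1 (pcd P Q) = gam_col (mxeval e 1 7 P) (mxeval e 1 7 Q).
Proof. by rewrite /pcd -(mxeval_mul _ 7 7) mxeval_pGam -mxeval_tr. Qed.

Lemma mxeval_pcr P Q :
  mxeval e 1 7 (pcr P Q) = cross_row (mxeval e 1 7 P) (mxeval e 1 7 Q).
Proof.
by rewrite /pcr mxeval_tab -(mxeval_mul _ 1 7) mxeval_pint -mxeval_tr mxeval_pcd.
Qed.

Let mxevalF := (mxeval_pL, mxeval_pbcol, mxeval_pbil, mxeval_pcd, mxeval_pcr).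

Local Notation U := (mxeval e 1 7 pu).
Local Notation V := (mxeval e 1 7 pv).

(** The tables were recorded as evaluated constants; these equations tie them again to the
    expressions from which they were computed. *)
Let tableE : [/\ table1 = tabulate 10 1 pD1, table2 = tabulate 16 10 pD2,
  table3 = tabulate 16 16 pD3, table4 = tabulate 10 16 pD4
  & table5 = tabulate 1 10 pD5].
Proof. by split; vm_compute. Qed.

Lemma mxeval_formula1 : mxeval e 10 1 (resolution_diff 0) = formula1 U V.
Proof.
rewrite /resolution_diff /=; have [-> _ _ _ _] := tableE.
rewrite mxeval_tab /pD1 -(mxeval_col _ 7 3) -(mxeval_col _ 1 2).
by rewrite -(mxeval_col _ 1 1) !mxevalF.
Qed.

Lemma mxeval_formula2 : mxeval e 16 10 (resolution_diff 1) = formula2 U V.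
Proof.
rewrite /resolution_diff /=; have [_ -> _ _ _] := tableE.
rewrite mxeval_tab /pD2 -(mxeval_col _ 8 8).
rewrite !(mxeval_block 1 7 7 3) -!(mxeval_row _ 7 1 2) -!(mxeval_row _ 7 1 1).
by rewrite -!mxeval_opp !mxevalF !mxeval0.
Qed.

Lemma mxeval_psym P Q : mxeval e 8 8 (psym_block P Q) =
  sym_block (mxeval e 1 7 P) (mxeval e 1 7 Q).
Proof.
rewrite /psym_block (mxeval_block 1 7 1 7) -mxeval_scale -mxeval_add mxeval_scalar.
rewrite -mxeval_opp -mxeval_add -!(mxeval_mul _ 7 1) !mxevalF !mxeval0 peval_scale.
have -> : peval e (pbil P Q 0%N 0%N) =
    polar_form (mxeval e 1 7 P) (mxeval e 1 7 Q) 0 0 by rewrite -mxeval_pbil mxE.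
by rewrite /sym_block mulrNz.
Qed.

Lemma mxeval_pskew P Q : mxeval e 8 8 (pskew_block P Q) =
  skew_block (mxeval e 1 7 P) (mxeval e 1 7 Q).
Proof.
rewrite /skew_block -mxeval_pcr -mxeval_pcd -!mxeval_pbcol -mxeval_pL !mxeval_mul.
rewrite mxeval_opp !mxeval_add -mulrNz mxeval_scale.
by rewrite -(mxeval0 e 1 1) -mxeval_block.
Qed.

Lemma mxeval_formula3 : mxeval e 16 16 (resolution_diff 2) = formula3 U V.
Proof.
rewrite /resolution_diff /=; have [_ _ -> _ _] := tableE.
rewrite mxeval_tab /pD3 (mxeval_block 8 8 8 8) -!mxeval_add.
by rewrite -!mxeval_opp !mxeval_psym !mxeval_pskew.
Qed.

Lemma mxeval_formula4 : mxeval e 10 16 (resolution_diff 3) = formula4 U V.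
Proof.
rewrite /resolution_diff /=; have [_ _ _ -> _] := tableE.
rewrite mxeval_tab /pD4 -(mxeval_col _ 7 3) -(mxeval_col _ 1 2).
rewrite -(mxeval_col _ 1 1) -!(mxeval_row _ _ 8 8) -!(mxeval_row _ _ 1 7).
rewrite -!mxeval_scale !mxevalF !mxeval0 /formula4.
by rewrite !mulrNz !scaleN1r.
Qed.

Lemma mxeval_formula5 : mxeval e 1 10 (resolution_diff 4) = formula5 U V.
Proof.
rewrite /resolution_diff /=; have [_ _ _ _ ->] := tableE.
rewrite mxeval_tab /pD5 -(mxeval_row _ _ 7 3) -(mxeval_row _ _ 1 2).
by rewrite -(mxeval_row _ _ 1 1) -!mxeval_scale !mxevalF mulrNz.
Qed.

End Evaluation.

Section Automorphism.

Variable h : 'M[S]_7.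
Hypothesis h_gam : forall x, h *m gam_mx (x *m h) *m h^T = gam_mx x.
Hypothesis h_polar : h *m polar_mx *m h^T = polar_mx.
Hypothesis h_copolar : h^T *m copolar_mx *m h = copolar_mx.

Lemma cross_mx_aut x : h *m cross_mx (x *m h) = cross_mx x *m h.
Proof.
rewrite /cross_mx -[in RHS](h_gam x) -!mulmxA; congr (_ *m (_ *m _)).
by rewrite mulmxA h_copolar.
Qed.

Lemma polar_col_aut x : h *m polar_col (x *m h) = polar_col x.
Proof. by rewrite /polar_col trmx_mul !mulmxA h_polar. Qed.

Lemma polar_outer_aut x y :
  h *m (polar_col (x *m h) *m (y *m h)) = polar_col x *m y *m h.
Proof. by rewrite mulmxA polar_col_aut mulmxA. Qed.

Lemma polar_form_aut x y : polar_form (x *m h) (y *m h) = polar_form x y.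
Proof. by rewrite /polar_form trmx_mul !mulmxA -2!(mulmxA x) h_polar. Qed.

Lemma gam_col_aut x y : h *m gam_col (x *m h) (y *m h) = gam_col x y.
Proof. by rewrite /gam_col trmx_mul !mulmxA h_gam. Qed.

Lemma cross_row_aut x y : cross_row (x *m h) (y *m h) = cross_row x y *m h.
Proof.
by rewrite /cross_row -[in RHS]gam_col_aut [in RHS]trmx_mul -!mulmxA (mulmxA h^T) h_copolar.
Qed.

(** [aut8], [aut16] and [aut10] are the actions of h on K ⊕ V, on E ⊗ (K ⊕ V) and on V ⊕ Sym^2 E,
    the twists by det E being invisible to h. *)
Definition aut8 : 'M[S]_(1 + 7) := block_mx 1%:M 0 0 h.
Definition aut16 : 'M[S]_((1 + 7) + (1 + 7)) := block_mx aut8 0 0 aut8.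
Definition aut10 : 'M[S]_(7 + (1 + (1 + 1))) := block_mx h 0 0 1%:M.

Lemma aut8_block n1 n2 (A : 'M_(1, n1)) (B : 'M_(1, n2)) C D :
  aut8 *m block_mx A B C D = block_mx A B (h *m C) (h *m D).
Proof. by rewrite mulmx_block !mul0mx !mul1mx !addr0 !add0r. Qed.

Lemma block_aut8 m1 m2 (A : 'M_(m1, 1)) B (C : 'M_(m2, 1)) D :
  block_mx A B C D *m aut8 = block_mx A (B *m h) C (D *m h).
Proof. by rewrite mulmx_block !mulmx0 !mulmx1 !addr0 !add0r. Qed.

Lemma block_aut10 m1 m2 (A : 'M_(m1, 7)) B (C : 'M_(m2, 7)) D :
  block_mx A B C D *m aut10 = block_mx (A *m h) B (C *m h) D.
Proof. by rewrite mulmx_block !mulmx0 !mulmx1 !addr0 !add0r. Qed.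

Lemma aut10_col n (A : 'M_(7, n)) B : aut10 *m col_mx A B = col_mx (h *m A) B.
Proof. by rewrite mul_block_col !mul0mx mul1mx addr0 add0r. Qed.

Lemma row_aut10 n (A : 'M_(n, 7)) B : row_mx A B *m aut10 = row_mx (A *m h) B.
Proof. by rewrite mul_row_block !mulmx0 mulmx1 addr0 add0r. Qed.

Lemma row_aut8 n (A : 'M_(n, 1)) B : row_mx A B *m aut8 = row_mx A (B *m h).
Proof. by rewrite mul_row_block !mulmx0 mulmx1 addr0 add0r. Qed.

Lemma row_aut16 n (A : 'M_(n, 1 + 7)) B :
  row_mx A B *m aut16 = row_mx (A *m aut8) (B *m aut8).
Proof. by rewrite mul_row_block !mulmx0 addr0 add0r. Qed.

Lemma aut16_col n (A : 'M_(1 + 7, n)) B :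
  aut16 *m col_mx A B = col_mx (aut8 *m A) (aut8 *m B).
Proof. by rewrite mul_block_col !mul0mx addr0 add0r. Qed.

Lemma aut16_block (A B C D : 'M_(1 + 7)) :
  aut16 *m block_mx A B C D = block_mx (aut8 *m A) (aut8 *m B) (aut8 *m C) (aut8 *m D).
Proof. by rewrite mulmx_block !mul0mx !addr0 !add0r. Qed.

Lemma block_aut16 (A B C D : 'M_(1 + 7)) :
  block_mx A B C D *m aut16 = block_mx (A *m aut8) (B *m aut8) (C *m aut8) (D *m aut8).
Proof. by rewrite mulmx_block !mulmx0 !addr0 !add0r. Qed.

Lemma formula1_aut u v : aut10 *m formula1 (u *m h) (v *m h) = formula1 u v.
Proof. by rewrite aut10_col gam_col_aut !polar_form_aut. Qed.

Lemma formula2_aut u v :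
  aut16 *m formula2 (u *m h) (v *m h) = formula2 u v *m aut10.
Proof.
rewrite aut16_col !aut8_block [RHS]mul_col_mx !block_aut10.
by rewrite !mul_mx_row !mulmxN !mulmx0 !polar_col_aut !cross_mx_aut.
Qed.

Lemma sym_block_aut x y : aut8 *m sym_block (x *m h) (y *m h) = sym_block x y *m aut8.
Proof.
rewrite aut8_block block_aut8 !mul0mx !mulmx0 polar_form_aut; congr block_mx.
by rewrite mulmxBr mulmxDr !polar_outer_aut mulmxBl mulmxDl scalar_mxC.
Qed.

Lemma skew_block_aut x y : aut8 *m skew_block (x *m h) (y *m h) = skew_block x y *m aut8.
Proof.
rewrite aut8_block block_aut8 cross_row_aut -scalemxAr gam_col_aut; congr block_mx.
by rewrite mulmxDr mulmxBr !polar_outer_aut cross_mx_aut mulmxDl mulmxBl.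
Qed.

Lemma formula3_aut u v :
  aut16 *m formula3 (u *m h) (v *m h) = formula3 u v *m aut16.
Proof.
have sym := sym_block_aut; have skew := skew_block_aut.
rewrite aut16_block block_aut16; congr block_mx => //.
- by rewrite mulmxBr mulmxBl sym skew.
- by rewrite mulmxN mulNmx sym.
- by rewrite mulmxDr mulmxDl sym skew.
Qed.

Lemma formula4_aut u v :
  aut10 *m formula4 (u *m h) (v *m h) = formula4 u v *m aut16.
Proof.
rewrite aut10_col [RHS]mul_col_mx [in RHS]mul_col_mx [in RHS]mul_col_mx.
rewrite !row_aut16 !row_aut8 !mul0mx !mul_mx_row.
by rewrite mulmxN mulNmx -!scalemxAr -!scalemxAl !polar_col_aut !cross_mx_aut.
Qed.

Lemma formula5_aut u v : formula5 (u *m h) (v *m h) = formula5 u v *m aut10.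
Proof. by rewrite /formula5 row_aut10 cross_row_aut !polar_form_aut. Qed.

End Automorphism.

End Formulas.

(** A [rep] is a bare family of matrices. These are the laws that make it a representation
    compatible with base change; multiplicativity is used to split (g, h) into (g, 1) and (1, h) and
    to conjugate by P. *)
Record natural_rep (U : rep) : Prop := NaturalRep {
  natural_rep1 : forall R : comUnitRingType,
    ract U (1%:M : 'M[R]_2) 1%:M = 1%:M;
  natural_repM : forall (R : comUnitRingType) (g g' : 'M[R]_2) (h h' : 'M[R]_7),
    ract U (g *m g') (h *m h') = ract U g h *m ract U g' h';
  natural_rep_map : forall (R R' : comUnitRingType) (f : {rmorphism R -> R'})
    (g : 'M[R]_2) (h : 'M[R]_7),
    map_mx f (ract U g h) = ract U (map_mx f g) (map_mx f h)
}.

Lemma natural_rep0 : natural_rep rep0.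
Proof. by split=> *; apply/matrixP => -[]. Qed.

Lemma natural_repK : natural_rep repK.
Proof. by split=> * //=; rewrite ?mulmx1 ?map_mx1. Qed.

Lemma natural_repE : natural_rep repE. Proof. by []. Qed.

Lemma natural_repV : natural_rep repV. Proof. by []. Qed.

Lemma natural_repdetE : natural_rep repdetE.
Proof.
split=> * /=; first by rewrite det1.
  by rewrite det_mulmx scalar_mxM.
by rewrite map_scalar_mx det_map_mx.
Qed.

Lemma natural_rep_sum U W : natural_rep U -> natural_rep W -> natural_rep (U \oplus W).
Proof.
move=> nU nW; split=> * /=.
- by rewrite !natural_rep1 // -scalar_mx_block.
- by rewrite !natural_repM // mulmx_block !mulmx0 !mul0mx !addr0 !add0r.
- by rewrite map_block_mx !map_mx0 !natural_rep_map.
Qed.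

Lemma natural_rep_tensor U W :
  natural_rep U -> natural_rep W -> natural_rep (U \otimes W).
Proof.
move=> nU nW; split=> * /=.
- rewrite !natural_rep1 //; apply/matrixP => i j.
  case: (mxtens_indexP i) => i1 i2; case: (mxtens_indexP j) => j1 j2.
  rewrite tensmxE !mxE (inj_eq (can_inj (@mxtens_indexK _ _))) xpair_eqE.
  by case: (_ == _); case: (_ == _); rewrite ?mulr1 ?mulr0.
- by rewrite !natural_repM // tensmx_mul.
- by rewrite map_mxT !natural_rep_map.
Qed.

Lemma sym2_mxE (R : comUnitRingType) (g : 'M[R]_2) :
  let a := g 0 0 in let b := g 0 1 in let c := g 1 0 in let d := g 1 1 in
  sym2_mx g = \matrix_(r < 3, s < 3) nth 0 (nth [::]
    [:: [:: a * a; a * b *+ 2; b * b]; [:: a * c; a * d + b * c; b * d];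
        [:: c * c; c * d *+ 2; d * d]] r) s.
Proof.
have max1 : ord_max = 1 :> 'I_2 by apply/val_inj.
move=> a b c d; apply/matrixP => r s; rewrite !mxE.
case: r => -[|[|[|]]] //= ?; case: s => -[|[|[|]]] //= ?;
  rewrite /sym2_basis /tnth /= ?max1 //=; by rewrite -/a -/b -/c -/d; ring.
Qed.

Lemma natural_repSym2E : natural_rep repSym2E.
Proof.
split=> * /=; rewrite !sym2_mxE.
- apply/matrixP => r s; rewrite !mxE.
  by case: r => -[|[|[|]]] //= ?; case: s => -[|[|[|]]] //= ?; ring.
- apply/matrixP => r s; rewrite !mxE !big_ord_recl !big_ord0 !mxE.
  rewrite (_ : lift ord0 ord0 = 1 :> 'I_2); last exact/val_inj.
  by case: r => -[|[|[|]]] //= ?; case: s => -[|[|[|]]] //= ?; ring.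
- apply/matrixP => r s; rewrite !mxE.
  by case: r => -[|[|[|]]] //= ?; case: s => -[|[|[|]]] //= ?;
    rewrite ?rmorphMn ?rmorphD !rmorphM.
Qed.

(** The sizes agree only propositionally for a variable n, hence the cast; at the concrete sizes
    used below it disappears by [castmx_id]. *)
Lemma tens1l (R : comPzRingType) n (M : 'M[R]_n) (e : (1 * n)%N = n) :
  castmx (e, e) ((1%:M : 'M_1) *t M) = M.
Proof.
apply/matrixP => i j; rewrite castmxE mxE !mxE !ord1 eqxx mul1r.
by congr (M _ _); apply/val_inj; rewrite /= modn_small.
Qed.

Lemma tens2l (R : comPzRingType) n (M : 'M[R]_n) (e : (2 * n)%N = (n + n)%N) :
  castmx (e, e) ((1%:M : 'M_2) *t M) = block_mx M 0 0 M.
Proof.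
have ul k : mxtens_unindex (cast_ord (esym e) (lshift n k)) = (0 : 'I_2, k).
  by rewrite -[RHS]mxtens_indexK; congr mxtens_unindex; apply/val_inj.
have ur k : mxtens_unindex (cast_ord (esym e) (rshift n k)) = (1 : 'I_2, k).
  rewrite -[RHS]mxtens_indexK; congr mxtens_unindex; apply/val_inj.
  by rewrite /= mul1n.
apply/matrixP => i j; rewrite castmxE mxE.
case: (split_ordP i) => k ->; case: (split_ordP j) => l ->.
all: rewrite ?block_mxEul ?block_mxEur ?block_mxEdl ?block_mxEdr ?ul ?ur !mxE /=.
all: by rewrite ?mul1r ?mul0r.
Qed.

Definition pdet : pol := [:: (1, [:: 14; 17]); (-1, [:: 15; 16])].
Definition pgl : pmx := fun a b => [:: (1, [:: 14 + 2 * a + b]%N)].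
Definition psym2 : pmx := fun r s => nth [::] (nth [::]
  [:: [:: [:: (1, [:: 14; 14])]; [:: (2, [:: 14; 15])]; [:: (1, [:: 15; 15])]];
      [:: [:: (1, [:: 14; 16])]; [:: (1, [:: 14; 17]); (1, [:: 15; 16])];
          [:: (1, [:: 15; 17])]];
      [:: [:: (1, [:: 16; 16])]; [:: (2, [:: 16; 17])]; [:: (1, [:: 17; 17])]]] r) s.
Definition ptens (m n : nat) (P Q : pmx) : pmx :=
  fun i j => pmul (P (i %/ m)%N (j %/ n)%N) (Q (i %% m)%N (j %% n)%N).

Section RepEvaluation.

Variables (R : comUnitRingType) (X : 'M[R]_(2, 7)) (g : 'M[R]_2).
Local Notation e := (env2 X g).

Lemma env2_gl a b : (a < 2)%N -> (b < 2)%N ->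
  e (14 + 2 * a + b) = g (inord a) (inord b).
Proof.
move=> a2 b2; rewrite /env2 -addnA ltnNge leq_addr addKn /=; congr (g (inord _) (inord _)).
  by rewrite mulnC divnMDl // divn_small // addn0.
by rewrite mulnC modnMDl modn_small.
Qed.

Lemma mxeval_pgl : mxeval e 2 2 pgl = g.
Proof.
apply/matrixP => a b; rewrite mxE /pgl peval_var env2_gl //.
by rewrite !inord_val.
Qed.

Let i0 : inord 0 = 0 :> 'I_2. Proof. by apply/val_inj; rewrite /= inordK. Qed.
Let i1 : inord 1 = 1 :> 'I_2. Proof. by apply/val_inj; rewrite /= inordK. Qed.
Let g00 : e 14 = g 0 0. Proof. by rewrite -[14%N]/(14 + 2 * 0 + 0)%N env2_gl // !i0. Qed.
Let g01 : e 15 = g 0 1. Proof. by rewrite -[15%N]/(14 + 2 * 0 + 1)%N env2_gl // i0 i1. Qed.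
Let g10 : e 16 = g 1 0. Proof. by rewrite -[16%N]/(14 + 2 * 1 + 0)%N env2_gl // i0 i1. Qed.
Let g11 : e 17 = g 1 1. Proof. by rewrite -[17%N]/(14 + 2 * 1 + 1)%N env2_gl // !i1. Qed.

Lemma peval_pdet : peval e pdet = \det g.
Proof.
rewrite (expand_det_row _ 0) !big_ord_recl big_ord0 /cofactor !det_mx11 !mxE /=.
rewrite /pdet !peval_cons peval_nil /moneval !big_cons !big_nil g00 g01 g10 g11.
have -> : lift 0 0 = 1 :> 'I_2 by apply/val_inj.
have -> : lift 1 0 = 0 :> 'I_2 by apply/val_inj.
by rewrite /bump /= expr0 expr1; ring.
Qed.

Lemma mxeval_psym2 : mxeval e 3 3 psym2 = sym2_mx g.
Proof.
rewrite sym2_mxE; apply/matrixP => r s; rewrite !mxE.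
case: r => -[|[|[|]]] //= ?; case: s => -[|[|[|]]] //= ?;
  rewrite !peval_cons peval_nil /moneval !big_cons !big_nil ?g00 ?g01 ?g10 ?g11; by ring.
Qed.

Lemma mxeval_ptens m1 n1 m2 n2 P Q :
  mxeval e (m1 * m2) (n1 * n2) (ptens m2 n2 P Q) =
  mxeval e m1 n1 P *t mxeval e m2 n2 Q.
Proof. by apply/matrixP => i j; rewrite !mxE peval_mul. Qed.

End RepEvaluation.

Definition equivariant_terms : seq (rep * nat) :=
  [:: (repK, 0);
      (repdetE \otimes repV \oplus repSym2E, 2);
      (repdetE \otimes repE \otimes (repK \oplus repV), 3);
      (repdetE \otimes repdetE \otimes repE \otimes (repK \oplus repV), 5);
      (repdetE \otimes repdetE \otimes repdetE \otimes repV
         \oplus repdetE \otimes repdetE \otimes repSym2E, 6);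
      (repdetE \otimes repdetE \otimes repdetE \otimes repdetE, 8)]%N.

Definition term_rep (i : nat) : rep := (nth (rep0, 0%N) equivariant_terms i).1.
Definition term_deg (i : nat) : nat := (nth (rep0, 0%N) equivariant_terms i).2.

Lemma term_rep_natural i : natural_rep (term_rep i).
Proof.
have [i6|i6] := leqP 6 i; first by rewrite /term_rep nth_default //; apply: natural_rep0.
case: i i6 => [|[|[|[|[|[|]]]]]] // _; rewrite /term_rep /=;
  by repeat first [apply: natural_rep_sum | apply: natural_rep_tensor
    | apply: natural_repK | apply: natural_repE | apply: natural_repV
    | apply: natural_repdetE | apply: natural_repSym2E].
Qed.

Lemma term_rank i : rdim (term_rep i) = resolution_rank i.
Proof.
have [i6|i6] := leqP 6 i; last by case: i i6 => [|[|[|[|[|[|]]]]]].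
by rewrite /term_rep /resolution_rank !nth_default.
Qed.

Lemma term_degE i s : term_deg i = resolution_deg i s.
Proof.
have [i6|i6] := leqP 6 i; last by case: i i6 => [|[|[|[|[|[|]]]]]].
by rewrite /term_deg /resolution_deg !nth_default.
Qed.

Definition pdetmx : pmx := fun _ _ => pdet.

(** The action of GL(E) on the i-th term, as a matrix of polynomials in the variables 14 to 17 that
    stand for the entries of g. *)
Definition pterm_gl (i : nat) : pmx :=
  let d2 := ptens 1 1 pdetmx pdetmx in
  let d3 := ptens 1 1 d2 pdetmx in
  let kv := pblock 1 1 p1mx p0mx p0mx p1mx in
  nth p0mx
    [:: p1mx;
        pblock 7 7 (ptens 7 7 pdetmx p1mx) p0mx p0mx psym2;
        ptens 8 8 (ptens 2 2 pdetmx pgl) kv;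
        ptens 8 8 (ptens 2 2 d2 pgl) kv;
        pblock 7 7 (ptens 7 7 d3 p1mx) p0mx p0mx (ptens 3 3 d2 psym2);
        ptens 1 1 d3 pdetmx] i.

(** GL(E)-equivariance of the differentials is a polynomial identity in the 14 entries of X and the
    4 entries of g, so one computation covers all g over all rings. *)
Lemma term_glP : all (fun i =>
    pmxeq 0 (resolution_rank i.+1) (resolution_rank i)
      (pmulmx (resolution_rank i.+1) (pterm_gl i.+1) (resolution_diff i))
      (pmulmx (resolution_rank i) (psubstmx psigma (resolution_diff i)) (pterm_gl i)))
  (iota 0 5).
Proof. by vm_compute. Qed.

Lemma pterm_gl_vars : all (fun i => all (fun s => all (fun t =>
    all (fun m => all (leq 14) m.2) (pterm_gl i s t))
  (iota 0 (resolution_rank i))) (iota 0 (resolution_rank i))) (iota 0 6).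
Proof. by vm_compute. Qed.

Lemma ract_term_gl (R : comUnitRingType) (X : 'M[R]_(2, 7)) (g : 'M[R]_2) i : (i < 6)%N ->
  ract (term_rep i) g 1%:M = mxeval (env2 X g) _ _ (pterm_gl i).
Proof.
have dE : (\det g)%:M = mxeval (env2 X g) 1 1 pdetmx :> 'M_1.
  by apply/matrixP => a b; rewrite !mxE !ord1 eqxx mulr1n peval_pdet.
have kvE : block_mx 1%:M 0 0 1%:M =
    mxeval (env2 X g) (1 + 7) (1 + 7) (pblock 1 1 p1mx p0mx p0mx p1mx).
  by rewrite mxeval_block !mxeval1 !mxeval0.
have tensE := mxeval_ptens X g.
case: i => [|[|[|[|[|[|]]]]]] // _; rewrite /term_rep /=.
- by rewrite mxeval1.
- rewrite -[7%N in X in _ = mxeval _ X _ _]/(1 * 7)%N.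
  rewrite (mxeval_block _ 7 3 7 3) (tensE 1 1 7 7)%N -dE mxeval1 !mxeval0.
  by rewrite mxeval_psym2.
- rewrite (tensE 2 2 8 8)%N (tensE 1 1 2 2)%N -dE mxeval_pgl.
  by rewrite kvE.
- rewrite (tensE 2 2 8 8)%N (tensE 1 1 2 2)%N (tensE 1 1 1 1)%N -dE mxeval_pgl.
  by rewrite kvE.
- rewrite (mxeval_block _ 7 3 7 3) (tensE 1 1 7 7)%N (tensE 1 1 3 3)%N.
  rewrite !(tensE 1 1 1 1)%N -dE mxeval1 !mxeval0.
  by rewrite mxeval_psym2.
- by rewrite !(tensE 1 1 1 1)%N -dE.
Qed.

Section TermV.

Variables (R : comUnitRingType) (h : 'M[R]_7).
Local Notation one := (1%:M : 'M[R]_1).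

Let tens1 : one *t one = one.
Proof. by have := tens1l one erefl; rewrite castmx_id. Qed.

Let tens3 : (one *t one *t one : 'M_1) = one.
Proof. by rewrite tens1; apply: tens1. Qed.

Let sym2_1 : sym2_mx (1%:M : 'M[R]_2) = 1%:M := natural_rep1 natural_repSym2E R.

Lemma ract_term_V1 : ract (term_rep 1) 1%:M h = aut10 h.
Proof.
rewrite /term_rep /= det1 sym2_1.
have := tens1l h erefl; rewrite castmx_id => ->.
by rewrite /aut10; congr block_mx.
Qed.

Lemma ract_term_V2 : ract (term_rep 2) 1%:M h = aut16 h.
Proof.
rewrite /term_rep /= det1.
have := tens1l (1%:M : 'M[R]_2) erefl; rewrite castmx_id => ->.
by have := tens2l (aut8 h) erefl; rewrite castmx_id => ->.
Qed.

Lemma ract_term_V3 : ract (term_rep 3) 1%:M h = aut16 h.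
Proof.
rewrite /term_rep /= det1 tens1.
have := tens1l (1%:M : 'M[R]_2) erefl; rewrite castmx_id => ->.
by have := tens2l (aut8 h) erefl; rewrite castmx_id => ->.
Qed.

Lemma ract_term_V4 : ract (term_rep 4) 1%:M h = aut10 h.
Proof.
rewrite /term_rep /= det1 sym2_1 tens3 tens1.
have := tens1l h erefl; rewrite castmx_id => ->.
have := tens1l (1%:M : 'M[R]_3) erefl; rewrite castmx_id => ->.
by rewrite /aut10; congr block_mx.
Qed.

Lemma ract_term_V5 : ract (term_rep 5) 1%:M h = 1%:M.
Proof. by rewrite /term_rep /= det1 tens3; apply: tens1. Qed.

End TermV.

Lemma resolution_diff_vars : all (fun i => all (fun s => all (fun t =>
    all (fun m => all (ltn^~ 14) m.2) (resolution_diff i s t))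
  (iota 0 (resolution_rank i))) (iota 0 (resolution_rank i.+1))) (iota 0 5).
Proof. by vm_compute. Qed.

Section TermEquivariance.

Variables (R : comUnitRingType) (S : comNzRingType) (f : {rmorphism R -> S}).
Local Notation C := (map_mx f).
Local Notation diff_at Y i :=
  (mxeval (env Y) (rdim (term_rep i.+1)) (rdim (term_rep i)) (resolution_diff i)).

Lemma mxeval_env_pu (Y : 'M[S]_(2, 7)) : mxeval (env Y) 1 7 pu = row 0 Y.
Proof.
apply/rowP => k; rewrite !mxE /pu peval_var.
by have [-> _] := env_rows Y (ltn_ord k); rewrite inord_val.
Qed.

Lemma mxeval_env_pv (Y : 'M[S]_(2, 7)) : mxeval (env Y) 1 7 pv = row 1 Y.
Proof.
apply/rowP => k; rewrite !mxE /pv peval_var.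
by have [_ ->] := env_rows Y (ltn_ord k); rewrite inord_val.
Qed.

Let map_aut8 h : C (aut8 h) = aut8 (C h).
Proof. by rewrite map_block_mx map_mx1 !map_mx0. Qed.

Let map_aut16 h : C (aut16 h) = aut16 (C h).
Proof. by rewrite map_block_mx map_aut8 !map_mx0. Qed.

Let map_aut10 h : C (aut10 h) = aut10 (C h).
Proof. by rewrite map_block_mx map_mx1 !map_mx0. Qed.

Lemma term_equivariant_V i (h : 'M[R]_7) (Y : 'M[S]_(2, 7)) :
  (forall x, C h *m gam_mx (x *m C h) *m (C h)^T = gam_mx x) ->
  C h *m polar_mx S *m (C h)^T = polar_mx S ->
  (C h)^T *m copolar_mx S *m C h = copolar_mx S ->
  C (ract (term_rep i.+1) 1%:M h) *m diff_at (Y *m C h) i =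
  diff_at Y i *m C (ract (term_rep i) 1%:M h).
Proof.
move=> h_gam h_polar h_copolar; have [i5|] := leqP 5 i.
  have r0 : rdim (term_rep i.+1) = 0%N by rewrite /term_rep nth_default.
  by apply/matrixP => -[s s0]; exfalso; move: s0; rewrite r0.
case: i => [|[|[|[|[|]]]]] // _.
- rewrite ract_term_V1 map_aut10 !mxeval_formula1 !mxeval_env_pu !mxeval_env_pv !row_mul.
  by rewrite formula1_aut // map_mx1 mulmx1.
- rewrite ract_term_V1 ract_term_V2 map_aut10 map_aut16 !mxeval_formula2.
  by rewrite !mxeval_env_pu !mxeval_env_pv !row_mul formula2_aut.
- rewrite ract_term_V3 ract_term_V2 !map_aut16 !mxeval_formula3.
  by rewrite !mxeval_env_pu !mxeval_env_pv !row_mul formula3_aut.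
- rewrite ract_term_V3 ract_term_V4 map_aut16 map_aut10 !mxeval_formula4.
  by rewrite !mxeval_env_pu !mxeval_env_pv !row_mul formula4_aut.
- rewrite ract_term_V4 ract_term_V5 map_aut10 !mxeval_formula5.
  by rewrite !mxeval_env_pu !mxeval_env_pv !row_mul formula5_aut // map_mx1 mul1mx.
Qed.

Lemma mxeval_term_gl i (g : 'M[R]_2) (Y : 'M[S]_(2, 7)) : (i < 6)%N ->
  mxeval (env2 Y (C g)) (rdim (term_rep i)) (rdim (term_rep i)) (pterm_gl i) =
  C (ract (term_rep i) g 1%:M).
Proof.
move=> i6; rewrite (ract_term_gl 0 g i6) mxeval_morph; apply/matrixP => s t.
rewrite !mxE; apply: eq_big_seq => m mP; congr (_ * _).
apply: eq_big_seq => k km /=.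
have /allP/(_ i) := pterm_gl_vars; rewrite mem_iota => /(_ i6).
move/allP/(_ s); rewrite mem_iota -term_rank => /(_ (ltn_ord s)).
move/allP/(_ t); rewrite mem_iota => /(_ (ltn_ord t)).
move/allP/(_ m mP)/allP/(_ k km) => k14.
by rewrite /env2 ltnNge k14 /= mxE.
Qed.

Lemma term_equivariant_E i (g : 'M[R]_2) (Y : 'M[S]_(2, 7)) :
  C (ract (term_rep i.+1) g 1%:M) *m diff_at Y i =
  diff_at (C g *m Y) i *m C (ract (term_rep i) g 1%:M).
Proof.
have [i5|i5] := leqP 5 i.
  have r0 : rdim (term_rep i.+1) = 0%N by rewrite /term_rep nth_default.
  by apply/matrixP => -[s s0]; exfalso; move: s0; rewrite r0.
rewrite -!(mxeval_term_gl g Y) //; last exact: ltnW.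
have -> : diff_at (C g *m Y) i = mxeval (env2 Y (C g)) _ _
    (psubstmx psigma (resolution_diff i)).
  rewrite mxeval_subst; apply/matrixP => s t; rewrite !mxE.
  by apply: eq_peval; apply: env_mul.
have -> : diff_at Y i = mxeval (env2 Y (C g)) _ _ (resolution_diff i).
  apply/matrixP => s t; rewrite !mxE peval_env2 //.
  have /allP/(_ i) := resolution_diff_vars; rewrite mem_iota => /(_ i5).
  move/allP/(_ s); rewrite mem_iota -term_rank => /(_ (ltn_ord s)).
  by move/allP/(_ t); rewrite mem_iota -term_rank => /(_ (ltn_ord t)).
have /allP/(_ i) := term_glP; rewrite mem_iota => /(_ i5).
rewrite -!term_rank => /(mxeval_eq (c := 0) (env2 Y (C g)) erefl).
by rewrite -!mxeval_mul.
Qed.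

End TermEquivariance.

Lemma trilin_eval_row1 (R : comUnitRingType) (gam : trilinear R) a b c :
  trilin_eval gam (row a 1%:M) (row b 1%:M) (row c 1%:M) = gam a b c.
Proof.
have lin (k : 'I_7) (F : 'I_7 -> R) : \sum_l (row k 1%:M : 'rV_7) 0 l * F l = F k.
  rewrite (bigD1 k) //= big1 ?addr0 => [|l lk]; first by rewrite !mxE eqxx mul1r.
  by rewrite !mxE eq_sym (negbTE lk) mul0r.
by rewrite trilin_evalE !lin.
Qed.

(** * Forms preserved by an automorphism, in standard coordinates *)

Section QuadraticForms.

Variable R : comUnitRingType.
Implicit Types (x y : 'rV[R]_7) (h : 'M[R]_7).

Lemma quad_pull_eval h q x : (quad_pull h q).@[x 0] = q.@[(x *m h) 0].
Proof.
rewrite /quad_pull comp_mpoly_meval; apply: meval_eq => k.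
rewrite tnth_mktuple raddf_sum /= mxE; apply: eq_bigr => a _.
by rewrite mevalZ mevalXU mulrC.
Qed.

Lemma q0_eval x : (q0 R).@[x 0] =
  x 0 (inord 0) * x 0 (inord 6) - x 0 (inord 1) * x 0 (inord 5)
  - x 0 (inord 2) * x 0 (inord 4) + x 0 (inord 3) ^+ 2.
Proof. by rewrite /q0 /= !expr2 !(mevalD, mevalN, mevalM) !mevalXU. Qed.

Lemma polar_mxE x y : (x *m polar_mx R *m y^T) 0 0 =
  (q0 R).@[(x + y) 0] - (q0 R).@[x 0] - (q0 R).@[y 0].
Proof.
pose X (k : nat) := x 0 (inord k); pose Y (k : nat) := y 0 (inord k).
have -> : (x *m polar_mx R *m y^T) 0 0 =
    \sum_(j < 7) (\sum_(i < 7) X i * (polar_int i j)%:~R) * Y j.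
  rewrite mxE; apply: eq_bigr => j _; rewrite !mxE /Y inord_val; congr (_ * _).
  by apply: eq_bigr => i _; rewrite !mxE /X inord_val.
rewrite !q0_eval !mxE !big_ord_recl !big_ord0 /bump /polar_int /= /X /Y.
ring.
Qed.

End QuadraticForms.

Lemma copolar_polarP : pmxeq 0 7 7 (pmulmx 7 pC pB) (pscalarmx [:: (2, [::])]) &&
  pmxeq 0 7 7 (pmulmx 7 pB pC) (pscalarmx [:: (2, [::])]).
Proof. by vm_compute. Qed.

Lemma copolar_polar (R : comNzRingType) : copolar_mx R *m polar_mx R = 2%:M.
Proof.
have /andP[/(mxeval_eq (c := 0) (fun _ => 0 : R) erefl) + _] := copolar_polarP.
by rewrite -(mxeval_mul _ 7 7) !mxeval_pint mxeval_scalar peval_const.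
Qed.

Lemma polar_copolar (R : comNzRingType) : polar_mx R *m copolar_mx R = 2%:M.
Proof.
have /andP[_ /(mxeval_eq (c := 0) (fun _ => 0 : R) erefl)] := copolar_polarP.
by rewrite -(mxeval_mul _ 7 7) !mxeval_pint mxeval_scalar peval_const.
Qed.

Section FormsOfAutomorphisms.

Variables (K : fieldType) (gamma : trilinear K) (q : quadratic K) (P : 'M[K]_7).
Hypothesis uP : P \in unitmx.
Hypothesis gammaE : forall a b c, gamma a b c = gamma_pull P (gamma0 K) a b c.
Hypothesis qE : q = quad_pull P (q0 K).
Variables (R : comUnitRingType) (iota : {rmorphism K -> R}) (h : 'M[R]_7).
Hypothesis hG : in_G iota gamma q h.
Local Notation PR := (map_mx iota P).
Local Notation h0 := (invmx PR *m h *m PR).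

Let uPR : PR \in unitmx. Proof. by rewrite map_unitmx. Qed.

(** Since gamma is the pullback of gamma0 along P, an automorphism h of gamma becomes an
    automorphism of gamma0 after conjugation by P. *)
Lemma standard_form_gamma a b c : gamma_pull h0 (gamma0 R) a b c = gamma0 R a b c.
Proof.
have [_ h_gamma _] := hG.
have rowE k : row k h0 = row k (invmx PR) *m h *m PR by rewrite !row_mul.
rewrite /gamma_pull !rowE -!(gamma_map_pull gammaE) -trilin_eval_pull.
rewrite (eq_trilin_eval _ _ _ h_gamma) -(trilin_eval_row1 (gamma0 R)).
by rewrite (gamma_map_pull gammaE) -!row_mul mulVmx.
Qed.

Let mapqE (x : 'rV[R]_7) : (map_mpoly iota q).@[x 0] = (q0 R).@[(x *m PR) 0].
Proof.
have map_q0 : map_mpoly iota (q0 K) = q0 R.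
  rewrite /q0 /= rmorphD rmorphXn !rmorphB !rmorphM /=.
  by rewrite !map_mpolyX.
rewrite qE -map_q0.
apply: (@mpoly_rmorph_ext _ _ _
  (meval (x 0) \o map_mpoly iota \o comp_mpoly [tuple \sum_a P a k *: 'X_a | k < 7])%FUN
  (meval ((x *m PR) 0) \o map_mpoly iota)%FUN) => [c|k] /=.
  by rewrite comp_mpolyC !map_mpolyC !mevalC.
rewrite comp_mpolyXU -tnth_nth tnth_mktuple map_mpolyX mevalXU mxE.
rewrite (raddf_sum (map_mpoly iota)) raddf_sum; apply: eq_bigr => a _.
by rewrite /= map_mpolyZ mevalZ map_mpolyX mevalXU mxE mulrC.
Qed.

Lemma standard_form_q0 (x : 'rV[R]_7) : (q0 R).@[(x *m h0) 0] = (q0 R).@[x 0].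
Proof.
have [_ _ h_q] := hG.
rewrite !mulmxA -mapqE -quad_pull_eval h_q mapqE.
by rewrite mulmxKV.
Qed.

Lemma standard_form_polar : h0 *m polar_mx R *m h0^T = polar_mx R.
Proof.
apply/matrixP => a b.
have rowE (M : 'M[R]_7) : (M *m polar_mx R *m M^T) a b =
    (row a M *m polar_mx R *m (row b M)^T) 0 0.
  by rewrite -row_mul tr_row !mxE; apply: eq_bigr => k _; rewrite !mxE.
have row1 k : row k h0 = row k 1%:M *m h0 by rewrite -row_mul mul1mx.
rewrite rowE polar_mxE !row1 -mulmxDl !standard_form_q0.
by rewrite -polar_mxE -rowE mul1mx trmx1 mulmx1.
Qed.

Hypothesis char2 : 2 \notin [pchar K].

(** The inverse of a preserved bilinear form is preserved by the transpose. Here [copolar_mx] is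
    twice the inverse of the polar matrix, and 2 is a unit of R because it is one in K. *)
Lemma standard_form_copolar : h0^T *m copolar_mx R *m h0 = copolar_mx R.
Proof.
have [uh _ _] := hG.
have uh0 : h0^T \in unitmx by rewrite unitmx_tr !unitmx_mul unitmx_inv uPR uh.
have := standard_form_polar; move: h0 uh0 => H uH hB.
set M := H^T *m copolar_mx R *m H.
have MB : M *m polar_mx R = copolar_mx R *m polar_mx R.
  apply: (can_inj (mulmxK uH)); rewrite /M -!mulmxA (mulmxA H) hB.
  by rewrite [RHS]mulmxA copolar_polar mul_mx_scalar mul_scalar_mx.
have two : 2%:R \in @GRing.unit R.
  rewrite -(rmorph_nat iota) rmorph_unit // unitfE.
  by move: char2; rewrite inE.
have := congr1 (mulmx^~ (copolar_mx R)) MB; rewrite -2!mulmxA polar_copolar !mul_mx_scalar.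
by move/(congr1 (fun A => 2%:R^-1 *: A)); rewrite !scalerA mulVr // !scale1r.
Qed.

End FormsOfAutomorphisms.

Lemma gam_mx_pull (R : comUnitRingType) (S : comNzRingType) (f : {rmorphism R -> S})
    (h : 'M[R]_7) (x : 'rV[S]_7) :
  (forall a b c, gamma_pull h (gamma0 R) a b c = gamma0 R a b c) ->
  map_mx f h *m gam_mx (x *m map_mx f h) *m (map_mx f h)^T = gam_mx x.
Proof.
move=> h_gamma; apply/matrixP => a b; rewrite !mxE.
have coefE (c : 'I_7) : (gamma_int a b c)%:~R = \sum_k f (h a k) *
    (\sum_l f (h b l) * (\sum_m f (h c m) * (gamma_int k l m)%:~R)).
  rewrite -(rmorph_int f) -gamma0E -h_gamma /gamma_pull trilin_evalE rmorph_sum.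
  apply: eq_bigr => k _; rewrite rmorphM rmorph_sum !mxE; congr (_ * _).
  apply: eq_bigr => l _; rewrite rmorphM rmorph_sum !mxE; congr (_ * _).
  by apply: eq_bigr => m _; rewrite rmorphM !mxE gamma0E rmorph_int.
under [RHS]eq_bigr do rewrite coefE mulr_suml.
rewrite [RHS]exchange_big.
under [LHS]eq_bigr do rewrite mxE mulr_suml.
rewrite [LHS]exchange_big; apply: eq_bigr => k _ /=.
under [RHS]eq_bigr do rewrite mulr_sumr mulr_suml.
rewrite [RHS]exchange_big; apply: eq_bigr => l _ /=.
rewrite !mxE mulr_sumr mulr_suml.
under [RHS]eq_bigr do rewrite mulr_sumr mulr_sumr mulr_suml.
rewrite [RHS]exchange_big; apply: eq_bigr => m _ /=.
rewrite !mxE !mulr_sumr mulr_suml; apply: eq_bigr => c _.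
rewrite !mxE; ring.
Qed.

Lemma map_polar_mx (R S : comNzRingType) (f : {rmorphism R -> S}) :
  map_mx f (polar_mx R) = polar_mx S.
Proof. by apply/matrixP => i j; rewrite !mxE rmorph_int. Qed.

Lemma map_copolar_mx (R S : comNzRingType) (f : {rmorphism R -> S}) :
  map_mx f (copolar_mx R) = copolar_mx S.
Proof. by apply/matrixP => i j; rewrite !mxE rmorph_int. Qed.

Section TermEquivarianceGL.

Variables (R : comUnitRingType) (S : comNzRingType) (f : {rmorphism R -> S}).
Local Notation C := (map_mx f).
Local Notation diff_at Y i :=
  (mxeval (env Y) (rdim (term_rep i.+1)) (rdim (term_rep i)) (resolution_diff i)).

Lemma term_equivariant i (g : 'M[R]_2) (h : 'M[R]_7) (Y : 'M[S]_(2, 7)) :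
  h \in unitmx ->
  (forall a b c, gamma_pull h (gamma0 R) a b c = gamma0 R a b c) ->
  h *m polar_mx R *m h^T = polar_mx R ->
  h^T *m copolar_mx R *m h = copolar_mx R ->
  C (ract (term_rep i.+1) g h) *m diff_at Y i =
  diff_at (C g *m Y *m C (invmx h)) i *m C (ract (term_rep i) g h).
Proof.
move=> uh h_gamma h_polar h_copolar.
(* The two factors are treated separately: (1, h) by the block formulas and (g, 1) by the polynomial
   identities. *)
have repE j : ract (term_rep j) g h = ract (term_rep j) g 1%:M *m ract (term_rep j) 1%:M h.
  by rewrite -(natural_repM (term_rep_natural j)) mulmx1 mul1mx.
have YE : Y = Y *m C (invmx h) *m C h by rewrite -mulmxA -map_mxM mulVmx // map_mx1 mulmx1.
rewrite !repE !map_mxM -mulmxA {1}YE term_equivariant_V.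
- by rewrite mulmxA term_equivariant_E !mulmxA.
- by move=> x; apply: gam_mx_pull.
- by rewrite -(map_polar_mx f) map_trmx -!map_mxM h_polar.
- by rewrite -(map_copolar_mx f) map_trmx -!map_mxM h_copolar.
Qed.

End TermEquivarianceGL.

Lemma ract_conj (U : rep) (R : comUnitRingType) (g : 'M[R]_2) (h M : 'M[R]_7) :
  natural_rep U -> M \in unitmx ->
  ract U g h *m ract U 1%:M M = ract U 1%:M M *m ract U g (invmx M *m h *m M).
Proof.
move=> nU uM; rewrite -!(natural_repM nU) mulmx1 mul1mx.
by rewrite !mulmxA mulmxV // mul1mx.
Qed.

Lemma ract_conjV (U : rep) (R : comUnitRingType) (g : 'M[R]_2) (h M : 'M[R]_7) :
  natural_rep U -> M \in unitmx ->
  ract U 1%:M (invmx M) *m ract U g h = ract U g (invmx M *m h *m M) *m ract U 1%:M (invmx M).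
Proof.
move=> nU uM; rewrite -!(natural_repM nU) mulmx1 mul1mx.
by rewrite mulmxK.
Qed.

Lemma map_mxeval_linear_subst (K : fieldType) (R : comUnitRingType) (P : 'M[K]_7)
    (iota : {rmorphism K -> R}) m n D :
  map_mx (map_mpoly iota) (map_mx (linear_subst 1%:M P) (mxeval (xenv K) m n D)) =
  mxeval (env (generic_mx R *m map_mx (@mpolyC (2 * 7) R) (map_mx iota P))) m n D.
Proof.
rewrite !mxeval_morph; apply/matrixP => s t; rewrite !mxE; apply: eq_peval => k /=.
have := env_morph (linear_subst 1%:M P) (generic_mx K) k.
rewrite /= -xenvE => ->; rewrite linear_subst_generic map_mx1 mul1mx.
have := env_morph (map_mpoly iota) (generic_mx K *m map_mx (@mpolyC (2 * 7) K) P) k.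
rewrite /= => ->; rewrite map_mxM; congr (env (_ *m _) k).
  by apply/matrixP => a l; rewrite !mxE /= map_mpolyX.
by apply/matrixP => a l; rewrite !mxE /= map_mpolyC.
Qed.

(** * The equivariant resolution of a general pair *)

Section EquivariantResolution.

Variables (K : fieldType) (gamma : trilinear K) (q : quadratic K) (P : 'M[K]_7).
Hypothesis uP : P \in unitmx.
Hypothesis gammaE : forall a b c, gamma a b c = gamma_pull P (gamma0 K) a b c.
Hypothesis qE : q = quad_pull P (q0 K).
Hypothesis char2 : 2 \notin [pchar K].

Local Notation A := {mpoly K[2 * 7]}.
Local Notation rk := (fun i => rdim (term_rep i)).
Local Notation dg := (fun i (_ : nat) => term_deg i).

(** The representations extend to all of GL(V), so P itself acts on each term, although it need not
    preserve any form. Twisting the differentials by this action makes them commute with h and not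
    merely with its conjugate by P. *)
Definition term_iso (M : 'M[K]_7) i : 'M[A]_(rdim (term_rep i)) :=
  map_mx (@mpolyC (2 * 7) K) (ract (term_rep i) 1%:M M).

Lemma term_isoM M M' i : M *m M' = 1%:M -> term_iso M i *m term_iso M' i = 1%:M.
Proof.
move=> MM'; rewrite -map_mxM -(natural_repM (term_rep_natural i)) MM' mulmx1.
by rewrite (natural_rep1 (term_rep_natural i)) map_mx1.
Qed.

Lemma term_iso_homogeneous M i :
  homogeneous_mx (fun=> (term_deg i)%:Z) (fun=> (term_deg i)%:Z) (term_iso M i).
Proof.
move=> s t; rewrite subrr mxE.
by rewrite /= -[_%:MP]mulr1 mul_mpolyC; apply: rpredZ; apply: dhomog1.
Qed.

Definition equivariant_complex : free_complex (2 * 7) K :=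
  @transported_complex K P rk dg resolution_diff (term_iso P) (term_iso (invmx P)).

Lemma equivariant_complex_resolves :
  resolves (ideal_Y2 gamma) equivariant_complex /\ minimal equivariant_complex.
Proof.
have [resF minF] := @resolution_resolves K rk dg char2 term_rank
  (fun i s => term_degE i s).
split; last exact: transported_minimal.
apply: (transported_resolves uP gammaE) resF => [i|i|i|i].
- by apply: term_isoM; rewrite mulmxV.
- by apply: term_isoM; rewrite mulVmx.
- exact: term_iso_homogeneous.
- exact: term_iso_homogeneous.
Qed.

Lemma equivariant_complex_diff (R : comUnitRingType) (iota : {rmorphism K -> R}) i :
  let PR := map_mx iota P in let C m n := @map_mx _ _ (@mpolyC (2 * 7) R) m n in
  map_mx (map_mpoly iota) (gdiff equivariant_complex i) =
  C _ _ (ract (term_rep i.+1) 1%:M PR)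
    *m mxeval (env (generic_mx R *m C _ _ PR)) _ _ (resolution_diff i)
    *m C _ _ (ract (term_rep i) 1%:M (invmx PR)).
Proof.
move=> PR C.
have mapC m n (M : 'M[K]_(m, n)) : map_mx (map_mpoly iota)
    (map_mx (@mpolyC (2 * 7) K) M) = C _ _ (map_mx iota M).
  by apply/matrixP => s t; rewrite !mxE map_mpolyC.
rewrite /= !map_mxM !mapC !(natural_rep_map (term_rep_natural _)) !map_mx1 map_invmx.
by rewrite (map_mxeval_linear_subst P iota).
Qed.

Local Notation C := (map_mx (@mpolyC (2 * 7) _)).

Lemma module_act_equivariant (R : comUnitRingType) (U W : rep) (g : 'M[R]_2) (h : 'M[R]_7)
    (D : 'M[coord_ring R]_(rdim U, rdim W)) (v : 'rV_(rdim U)) :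
  C (ract U g h) *m D = map_mx (linear_subst g (invmx h)) D *m C (ract W g h) ->
  module_act g h v *m D = module_act (U := W) g h (v *m D).
Proof.
move=> E; rewrite /module_act -mulmxA E mulmxA.
by rewrite -(map_mxM (linear_subst g (invmx h))).
Qed.

(** With Y = X P the differential is that of (gamma0, q0) at Y, between the actions of P and of its
    inverse. The substitution attached to (g, h) sends Y to g Y h0^-1, where h0 = P^-1 h P preserves
    the standard forms. So standard equivariance under (g, h0) applies, and the outer factors
    conjugate h0 back to h. *)
Lemma equivariant_complex_equivariant i :
  @equivariant K gamma q (term_rep i.+1) (term_rep i) (gdiff equivariant_complex i).
Proof.
move=> R iota g h ug hG v; apply: module_act_equivariant.
have [uh _ _] := hG; set PR := map_mx iota P.
have uPR : PR \in unitmx by rewrite map_unitmx.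
pose h0 := invmx PR *m h *m PR.
have uh0 : h0 \in unitmx by rewrite !unitmx_mul unitmx_inv uPR uh.
have h0V : PR *m invmx h0 = invmx h *m PR.
  apply: (can_inj (mulmxK uh0)); rewrite mulmxKV // /h0 -mulmxA !mulmxA.
  by rewrite mulmxK // mulVmx // mul1mx.
set Y := generic_mx R *m C PR.
have YE : C g *m Y *m C (invmx h0) = map_mx (linear_subst g (invmx h)) Y.
  rewrite map_mxM map_linear_substC linear_subst_generic -!mulmxA -!map_mxM.
  by rewrite h0V.
have envY : mxeval (env (map_mx (linear_subst g (invmx h)) Y)) (rdim (term_rep i.+1))
    (rdim (term_rep i)) (resolution_diff i) =
    map_mx (linear_subst g (invmx h)) (mxeval (env Y) _ _ (resolution_diff i)).
  by rewrite mxeval_morph; apply/matrixP => s t; rewrite !mxE; apply: eq_peval => k;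
    rewrite env_morph.
have eqv : C (ract (term_rep i.+1) g h0) *m mxeval (env Y) _ _ (resolution_diff i) =
    map_mx (linear_subst g (invmx h)) (mxeval (env Y) _ _ (resolution_diff i)) *m
    C (ract (term_rep i) g h0).
  rewrite -envY -YE; exact: (term_equivariant (@mpolyC (2 * 7) R) i g Y uh0
    (standard_form_gamma uP gammaE hG) (standard_form_polar uP qE hG)
    (standard_form_copolar uP qE hG char2)).
rewrite (equivariant_complex_diff iota i) -/PR -/Y.
rewrite !(map_mxM (linear_subst g (invmx h))) !map_linear_substC.
have conjE := congr1 C (ract_conj g h (term_rep_natural i.+1) uPR).
have conjVE := congr1 C (ract_conjV g h (term_rep_natural i) uPR).
rewrite !(map_mxM (@mpolyC (2 * 7) R)) /= -/h0 in conjE conjVE.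
rewrite -[RHS]mulmxA conjVE [RHS]mulmxA.
rewrite [LHS]mulmxA [X in X *m _]mulmxA conjE -(mulmxA _ _ (mxeval _ _ _ _)) eqv.
by rewrite !mulmxA.
Qed.

Lemma equivariant_complex_aug :
  @equivariant K gamma q (term_rep 0) repK (gaug equivariant_complex).
Proof.
move=> R iota g h ug hG v; apply: module_act_equivariant.
have -> : gaug equivariant_complex = 1%:M.
  by rewrite /= /term_iso /= mxeval1 !map_mx1 mulmx1.
by rewrite !map_mx1 !mulmx1.
Qed.

End EquivariantResolution.

Theorem theorem5p4 (K : fieldType) (gamma : trilinear K) (q : quadratic K)
    (hgq : compatible_nondegenerate gamma q) :
  [/\ (2%N \notin [pchar K] ->
        betti_table (ideal_Y2 gamma)
          [:: (0, 0, 1); (1, 2, 10); (2, 3, 16);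
              (3, 5, 16); (4, 6, 10); (5, 8, 1)]%N),
      (2%N \in [pchar K] ->
        betti_table (ideal_Y2 gamma)
          [:: (0, 0, 1); (1, 2, 10); (2, 3, 16); (2, 4, 1);
              (3, 4, 1); (3, 5, 16); (4, 6, 10); (5, 8, 1)]%N)
    & ([pchar K] =i pred0 ->
        has_equivariant_minimal_resolution gamma q (ideal_Y2 gamma)
          [:: (repK, 0);
              (repdetE \otimes repV \oplus repSym2E, 2);
              (repdetE \otimes repE \otimes (repK \oplus repV), 3);
              (repdetE \otimes repdetE \otimes repE
                 \otimes (repK \oplus repV), 5);
              (repdetE \otimes repdetE \otimes repdetE \otimes repV
                 \oplus repdetE \otimes repdetE \otimes repSym2E, 6);
              (repdetE \otimes repdetE \otimes repdetE \otimes repdetE,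
               8)]%N)].
Proof.
have [P uP [gammaE qE]] := hgq; split=> char_K.
- have [resF minF] := resolution_resolves char_K (frefl resolution_rank)
    (fun i => frefl (resolution_deg i)).
  exact: (transported_betti_table uP gammaE erefl resF minF resolution_betti).
- have [resF minF] := resolution2_resolves char_K.
  exact: (transported_betti_table uP gammaE erefl resF minF resolution2_betti).
- have char2 : 2 \notin [pchar K] by rewrite char_K.
  have [resF minF] := equivariant_complex_resolves uP gammaE char2.
  exists (gdiff (equivariant_complex P)), (gaug (equivariant_complex P)).
  split=> // [i|]; first exact: equivariant_complex_equivariant uP gammaE qE char2 i.
  exact: equivariant_complex_aug.
Qed.
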